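(* Let $\alpha\in(0,2]$, $p\in(0,1)$, $r\in[0,1]$ satisfy $(2r-1)\alpha p<1$. Let $\xi_1,\xi_2,\dots$ be i.i.d. real random variables and $(a_n)_{n\ge1}$ a sequence of positive constants such that $$\frac{1}{a_n}\sum_{k=1}^n\xi_k\stackrel{d}{\longrightarrow}S,$$ where $S$ is a symmetric $\alpha$-stable random variable with characteristic function $\mathbb{E}(e^{itS})=e^{-|t|^\alpha}$, $t\in\mathbb{R}$. Let $(T_n)_{n\ge1}$ be the unbalanced step-reinforced random walk with parameters $p,r$ built from $(\xi_k)$, and let $(T_k^0)_{k\ge1}$ be the elephant random walk with $T_1^0=1$ and memory parameter $r$ (both defined in the context). Then $$\frac{T_n}{a_n}\stackrel{d}{\longrightarrow}\big(c(\alpha,p,r)\big)^{1/\alpha}S,$$ where $$c(\alpha,p,r)=\frac{1-p}{p}\sum_{k=1}^\infty\mathbb{E}\big(|T_k^0|^\alpha\big)\,\mathrm{B}(k,1+1/p)$$ and $\mathrm{B}$ denotes the beta function.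
   Context: Unbalanced step-reinforced random walk: let $(U_n)_{n\ge2}$ be independent random variables with $U_n$ uniform on $\{1,\dots,n-1\}$, let $(\epsilon_n)_{n\ge2}$ be i.i.d. Bernoulli($p$) and $(\eta_n)_{n\ge2}$ i.i.d. Bernoulli($r$), with the sequences $(U_n)$, $(\epsilon_n)$, $(\eta_n)$, $(\xi_n)_{n\ge1}$ mutually independent. Set $X_1=\xi_1$ and for $n\ge2$: $X_n=X_{U_n}$ if $\epsilon_n=1,\eta_n=1$; $X_n=-X_{U_n}$ if $\epsilon_n=1,\eta_n=0$; $X_n=\xi_n$ if $\epsilon_n=0$. (So the three cases have probabilities $rp$, $(1-r)p$, $1-p$.) Then $T_n=\sum_{k=1}^nX_k$. Elephant random walk $T^0$: let $(U_n)_{n\ge2}$ be independent random variables with $U_n$ uniform on $\{1,\dots,n-1\}$, and let $(\eta_n)_{n\ge2}$ be i.i.d. Bernoulli($r$) random variables, independent of $(U_n)_{n\ge2}$. Set $X_1^0=1$ and for $n\ge2$, $X_n^0=X^0_{U_n}$ if $\eta_n=1$ (probability $r$) and $X_n^0=-X^0_{U_n}$ if $\eta_n=0$ (probability $1-r$). Then $T_n^0=\sum_{k=1}^nX_k^0$. *)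

(* Defs.v *)
From HB Require Import structures.
From mathcomp Require Import all_boot all_order all_algebra finmap.
From mathcomp Require Import all_classical all_reals all_analysis.
From mathcomp Require Import complex.

Set Implicit Arguments.
Unset Strict Implicit.
Unset Printing Implicit Defensive.

Import Order.TTheory GRing.Theory Num.Theory numFieldNormedType.Exports.

Local Open Scope classical_set_scope.
Local Open Scope ring_scope.

Section probability_notions.
Context d (T : measurableType d) (R : realType) (P : probability T R).

Definition independent_classes (I : choiceType) (D : set I)
    (F : I -> set_system T) : Prop :=
  forall (J : {fset I}) (A : I -> set T),
    (forall i, i \in J -> D i /\ F i (A i)) ->
    (P (\bigcap_(i in [set` J]) A i) = \prod_(i <- J) P (A i))%E.

Definition independent_list (Fs : seq (set_system T)) : Prop :=
  independent_classes setT (fun i : 'I_(size Fs) => nth set0 Fs i).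

Section sequences_of_variables.
Context d' (T' : measurableType d') (D : set nat) (X : nat -> {RV P >-> T'}).

Definition sigma_seq : set_system T :=
  <<s \bigcup_(n in D) g_sigma_algebra_preimage (X n) >>.

Definition independent_seq : Prop :=
  independent_classes D (fun n => g_sigma_algebra_preimage (X n)).

(* [distribution P X] is a total function on sets, only meaningful on the
   measurable ones, hence the restriction. *)
Definition identically_distributed : Prop :=
  forall m n, D m -> D n -> forall A, measurable A ->
    distribution P (X m) A = distribution P (X n) A.

End sequences_of_variables.

Definition uniform_upto (m : nat) (X : {RV P >-> nat}) : Prop :=
  forall k, (1 <= k <= m)%N -> distribution P X [set k] = (m%:R^-1)%:E.

Definition char_fun (X : {RV P >-> R}) (t : R) : R[i] :=
  Complex (fine 'E_P[fun w => cos (t * X w)%R])%E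
          (fine 'E_P[fun w => sin (t * X w)%R])%E.

End probability_notions.

(* The X n and Y may live on different probability spaces. *)
Definition cvg_in_distribution (R : realType)
    d (T : measurableType d) (P : probability T R) (X : nat -> T -> R)
    d' (T' : measurableType d') (P' : probability T' R) (Y : T' -> R) : Prop :=
  forall f : R -> R, continuous f -> (exists M, forall x, `|f x| <= M) ->
    'E_P[fun w => f (X n w)]%E @[n --> \oo] --> 'E_P'[fun w => f (Y w)]%E.

Section course_of_values.
Context (R : realType) (step : nat -> (nat -> R) -> R).

Fixpoint history (n : nat) : nat -> R :=
  if n is m.+1 then
    fun k => if k == m then step m (history m) else history m k
  else fun=> 0.

Definition recursive_seq (n : nat) : R := step n (history n).

Lemma historyE n k : history n k = if (k < n)%N then recursive_seq k else 0.
Proof.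
elim: n => //= n IH; case: eqP => [->|/eqP kn]; first by rewrite ltnSn.
by rewrite IH ltnS [in RHS]leq_eqVlt (negbTE kn).
Qed.

End course_of_values.

(* Index 0 is padding (value 0). The value u n lies in {1, ..., n - 1} only
   almost surely; the value of the walk on the exceptional event is
   irrelevant. *)
Definition srrw_step (R : realType) (u : nat -> nat) (e h : nat -> bool)
    (x : nat -> R) (n : nat) (past : nat -> R) : R :=
  if n == 0%N then 0 else if n == 1%N then x 1%N else
  if e n then (if h n then past (u n) else - past (u n)) else x n.

Definition srrw_increment (R : realType) (u : nat -> nat) (e h : nat -> bool)
    (x : nat -> R) : nat -> R := recursive_seq (srrw_step u e h x).

Definition erw_step (R : realType) (u : nat -> nat) (h : nat -> bool)
    (n : nat) (past : nat -> R) : R :=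
  if n == 0%N then 0 else if n == 1%N then 1 else
  if h n then past (u n) else - past (u n).

Definition erw_increment (R : realType) (u : nat -> nat) (h : nat -> bool) :
    nat -> R := recursive_seq (@erw_step R u h).

Lemma srrw_increment1 (R : realType) u e h (x : nat -> R) :
  srrw_increment u e h x 1 = x 1%N.
Proof. by []. Qed.

Lemma srrw_incrementE (R : realType) u e h (x : nat -> R) n :
  (2 <= n)%N -> (1 <= u n <= n.-1)%N ->
  srrw_increment u e h x n =
    if e n then
      (if h n then srrw_increment u e h x (u n)
       else - srrw_increment u e h x (u n))
    else x n.
Proof.
case: n => [//|[//|n]] _ /= /andP[_ un].
by rewrite /srrw_increment [LHS]/recursive_seq {1}/srrw_step !historyE ltnS un.
Qed.

Lemma erw_increment1 (R : realType) u h : erw_increment R u h 1 = 1.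
Proof. by []. Qed.

Lemma erw_incrementE (R : realType) u h n :
  (2 <= n)%N -> (1 <= u n <= n.-1)%N ->
  erw_increment R u h n =
    if h n then erw_increment R u h (u n) else - erw_increment R u h (u n).
Proof.
case: n => [//|[//|n]] _ /= /andP[_ un].
by rewrite /erw_increment [LHS]/recursive_seq {1}/erw_step !historyE ltnS un.
Qed.

Section walks.
Context d (T : measurableType d) (R : realType) (P : probability T R).

Definition srrw (U : nat -> {RV P >-> nat}) (eps eta : nat -> {RV P >-> bool})
    (xi : nat -> {RV P >-> R}) (n : nat) (w : T) : R :=
  \sum_(1 <= k < n.+1)
    srrw_increment (U ^~ w) (eps ^~ w) (eta ^~ w) (xi ^~ w) k.

Definition erw (U : nat -> {RV P >-> nat}) (eta : nat -> {RV P >-> bool})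
    (n : nat) (w : T) : R :=
  \sum_(1 <= k < n.+1) erw_increment R (U ^~ w) (eta ^~ w) k.

Record srrw_inputs (p r : R) (U : nat -> {RV P >-> nat})
    (eps eta : nat -> {RV P >-> bool}) (xi : nat -> {RV P >-> R}) : Prop := {
  srrw_U_uniform : forall n, (2 <= n)%N -> uniform_upto n.-1 (U n) ;
  srrw_eps_bernoulli : forall n, (2 <= n)%N ->
    distribution P (eps n) = bernoulli_prob p ;
  srrw_eta_bernoulli : forall n, (2 <= n)%N ->
    distribution P (eta n) = bernoulli_prob r ;
  srrw_xi_ident : identically_distributed [set n | (1 <= n)%N] xi ;
  srrw_U_indep : independent_seq [set n | (2 <= n)%N] U ;
  srrw_eps_indep : independent_seq [set n | (2 <= n)%N] eps ;
  srrw_eta_indep : independent_seq [set n | (2 <= n)%N] eta ;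
  srrw_xi_indep : independent_seq [set n | (1 <= n)%N] xi ;
  srrw_indep : independent_list P
    [:: sigma_seq [set n | (2 <= n)%N] U; sigma_seq [set n | (2 <= n)%N] eps;
        sigma_seq [set n | (2 <= n)%N] eta; sigma_seq [set n | (1 <= n)%N] xi]
}.

Record erw_inputs (r : R) (U : nat -> {RV P >-> nat})
    (eta : nat -> {RV P >-> bool}) : Prop := {
  erw_U_uniform : forall n, (2 <= n)%N -> uniform_upto n.-1 (U n) ;
  erw_eta_bernoulli : forall n, (2 <= n)%N ->
    distribution P (eta n) = bernoulli_prob r ;
  erw_U_indep : independent_seq [set n | (2 <= n)%N] U ;
  erw_eta_indep : independent_seq [set n | (2 <= n)%N] eta ;
  erw_indep : independent_list P
    [:: sigma_seq [set n | (2 <= n)%N] U; sigma_seq [set n | (2 <= n)%N] eta]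
}.

Lemma measurable_random_index (N : {RV P >-> nat}) (f : nat -> T -> R) :
  (forall k, measurable_fun setT (f k)) ->
  measurable_fun setT (fun w => f (N w) w).
Proof.
move=> mf _ B mB; rewrite setTI.
have -> : (fun w => f (N w) w) @^-1` B =
    \bigcup_k (N @^-1` [set k] `&` (setT `&` f k @^-1` B)).
  apply/seteqP; split => [w Bw|w [k _ [/= Nk [_ Bw]]]]; last by rewrite /= Nk.
  by exists (N w).
apply: bigcup_measurable => k _; apply: measurableI; last exact: mf.
by rewrite -[X in measurable X]setTI; exact: measurable_funPT.
Qed.

Lemma measurable_history (step : T -> nat -> (nat -> R) -> R) n k :
  (forall m, (forall j, measurable_fun setT (fun w => history (step w) m j)) ->
     measurable_fun setT (fun w => step w m (history (step w) m))) ->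
  measurable_fun setT (fun w => history (step w) n k).
Proof.
move=> ms; elim: n k => [|n IH] k /=; first exact: measurable_cst.
by case: (k == n); [exact: ms|exact: IH].
Qed.

Lemma measurable_srrw U eps eta xi n : measurable_fun setT (srrw U eps eta xi n).
Proof.
apply: measurable_sum => k; rewrite /srrw_increment /recursive_seq.
pose st w := srrw_step (U ^~ w) (eps ^~ w) (eta ^~ w) (xi ^~ w).
have ms m : (forall j, measurable_fun setT (fun w => history (st w) m j)) ->
    measurable_fun setT (fun w => st w m (history (st w) m)).
  move=> mh; rewrite /st /srrw_step; case: (m == 0%N); first exact: measurable_cst.
  case: (m == 1%N); first exact: measurable_funPT.
  have mhU := measurable_random_index (U m) mh.
  apply: measurable_fun_ifT; [exact: measurable_funPT| |exact: measurable_funPT].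
  apply: measurable_fun_ifT; [exact: measurable_funPT|exact: mhU|].
  exact: measurableT_comp mhU.
by apply: (ms k) => j; apply: (measurable_history _ _ ms).
Qed.

Lemma measurable_erw U eta n : measurable_fun setT (erw U eta n).
Proof.
apply: measurable_sum => k; rewrite /erw_increment /recursive_seq.
pose st w := @erw_step R (U ^~ w) (eta ^~ w).
have ms m : (forall j, measurable_fun setT (fun w => history (st w) m j)) ->
    measurable_fun setT (fun w => st w m (history (st w) m)).
  move=> mh; rewrite /st /erw_step; case: (m == 0%N); first exact: measurable_cst.
  case: (m == 1%N); first exact: measurable_cst.
  have mhU := measurable_random_index (U m) mh.
  apply: measurable_fun_ifT; [exact: measurable_funPT|exact: mhU|].
  exact: measurableT_comp mhU.
by apply: (ms k) => j; apply: (measurable_history _ _ ms).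
Qed.

End walks.

(* The library's [beta_fun] only takes natural parameters. *)
Definition beta (R : realType) (x y : R) : R :=
  \int[lebesgue_measure]_(t in `]0, 1[) (t `^ (x - 1) * (1 - t) `^ (y - 1)).

(* c(alpha, p, r), as an extended real number, for a walk T0 on (T, P);
   r enters through the law of T0. *)
Definition limit_constant (R : realType) (alpha p : R)
    d (T : measurableType d) (P : probability T R) (T0 : nat -> T -> R) : \bar R :=
  (((1 - p) / p)%:E *
   \sum_(1 <= k <oo) 'E_P[fun w => (`|T0 k w| `^ alpha)%R] *
     (beta k%:R (1 + p^-1))%:E)%E.

(* Main.v *)
(* Each step of the walk is, up to sign, a copy of one of the innovations xi_i, so T_n is
   the sum of W_i xi_i where W_i is the signed size of the cluster of the steps that copy
   xi_i. The clusters depend on (U, eps, eta) only, hence the characteristic function of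
   T_n / a_n is the mean of prod_i phi(t W_i / a_n), with phi the characteristic function
   of xi_1. The hypothesis gives n (phi(t / a_n) - exp(- |t|^alpha / n)) -> 0 locally
   uniformly, so the product is close to exp(- |t|^alpha (1/n) sum_i |W_i|^alpha), and it
   remains to see that (1/n) sum_i |W_i|^alpha converges to c. A cluster of size k has
   frequency (1 - p) / p * B(k, 1 + 1/p) (a linear recursion in k), and given its size its
   weight is distributed as T^0_k; second moments of the number of clusters of size k,
   weighted by a function of W_i, also satisfy a linear recursion.
   Tails are controlled by the Potter-type bound n |1 - phi(x / a_n)| <= C (1 + |x|^beta)
   for some beta > alpha such that E |T^0_k|^beta B(k, 1 + 1/p) is still summable; this
   uses (2r - 1) alpha p < 1 through the fourth moment of T^0_k. Probabilities over
   (U, eps, eta) become finite weighted sums over configurations. *)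
Require Import Defs.
From HB Require Import structures.
From mathcomp Require Import all_boot all_order all_algebra finmap.
From mathcomp Require Import all_classical all_reals all_analysis.
From mathcomp Require Import measurable_realfun.
From mathcomp Require Import complex ring lra.

Set Implicit Arguments.
Unset Strict Implicit.
Unset Printing Implicit Defensive.

Import Order.TTheory GRing.Theory Num.Theory numFieldNormedType.Exports.

Local Open Scope classical_set_scope.
Local Open Scope ring_scope.

(** * Expectations of bounded random variables *)

(** Two obstacles shape the proof. Weak convergence of the normalised sums controls the n-th power
    of phi(t / a_n), whereas the product over clusters needs phi itself; the n-th root is extracted
    by continuity along the segment from 0 to t, which selects the right root. Moreover the W_i are
    unbounded, so local uniformity does not suffice and large clusters must be summed with moments.
    There the hypothesis enters: E|T^0_k|^4 is O(k^g) for every g > max(2, 4(2r-1)); concavity of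
    the power alpha/4 makes E|T^0_k|^alpha of order at most k^(g alpha/4), while B(k, 1+1/p) decays
    like k^(-1-1/p). The series converges if max(alpha/2, (2r-1) alpha) < 1/p, which follows from
    alpha <= 2, p < 1 and the hypothesis; the inequality being strict, a slightly larger exponent
    beta is still summable. The elephant walk is read as the reinforced walk with p = 1, whose only
    cluster contains every step, so one calculus of configurations serves both walks. As a rule,
    index j stands for clusters of size j + 1 and index m for time m + 1. *)

Section bounded_expectation.
Context d (T : measurableType d) (R : realType) (P : probability T R).
Implicit Types f g : T -> R.

Definition bounded_rv f :=
  measurable_fun setT f /\ exists M : R, forall w, `|f w| <= M.

Lemma bounded_rvP f : bounded_rv f ->
  exists M : R, [/\ 0 < M, forall w, `|f w| <= M & measurable_fun setT f].
Proof.
move=> [mf [M fM]]; exists (`|M| + 1); split => //.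
move=> w; rewrite (le_trans (fM w))// (le_trans (ler_norm _))//.
by rewrite lerDl.
Qed.

Lemma bounded_rv_cst c : bounded_rv (cst c).
Proof. by split => //; exists `|c|. Qed.

Lemma bounded_rvD f g : bounded_rv f -> bounded_rv g -> bounded_rv (f \+ g).
Proof.
move=> [mf [M fM]] [mg [N gN]]; split; first exact: measurable_funD.
by exists (M + N) => w; rewrite (le_trans (ler_normD _ _))// lerD.
Qed.

Lemma bounded_rvM f g : bounded_rv f -> bounded_rv g -> bounded_rv (f \* g).
Proof.
move=> [mf [M fM]] [mg [N gN]]; split; first exact: measurable_funM.
by exists (M * N) => w; rewrite normrM ler_pM.
Qed.

Lemma bounded_rvN f : bounded_rv f -> bounded_rv (\- f).
Proof.
move=> [mf [M fM]]; split; first exact: measurableT_comp.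
by exists M => w; rewrite normrN.
Qed.

Lemma bounded_rvB f g : bounded_rv f -> bounded_rv g -> bounded_rv (f \- g).
Proof. by move=> bf bg; apply: bounded_rvD => //; exact: bounded_rvN. Qed.

Lemma bounded_rvZ c f : bounded_rv f -> bounded_rv (fun w => c * f w).
Proof. by move=> bf; apply: bounded_rvM => //; exact: bounded_rv_cst. Qed.

Lemma bounded_rv_sum I (s : seq I) (F : I -> T -> R) :
  (forall i, bounded_rv (F i)) -> bounded_rv (fun w => \sum_(i <- s) F i w).
Proof.
move=> bF; elim: s => [|i s IH].
  by under eq_fun do rewrite big_nil; exact: bounded_rv_cst.
by under eq_fun do rewrite big_cons; exact: bounded_rvD.
Qed.

Lemma bounded_rv_indic (A : set T) : measurable A -> bounded_rv \1_A.
Proof.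
move=> mA; split; first exact: measurable_indic.
by exists 1 => w; rewrite indicE; case: (_ \in _); rewrite ?normr1// normr0.
Qed.

Lemma bounded_rv_cos f : measurable_fun setT f -> bounded_rv (fun w => cos (f w)).
Proof.
move=> mf; split; last by exists 1 => w; exact: cos_max.
by apply: measurableT_comp => //; apply: continuous_measurable_fun;
  exact: continuous_cos.
Qed.

Lemma bounded_rv_sin f : measurable_fun setT f -> bounded_rv (fun w => sin (f w)).
Proof.
move=> mf; split; last by exists 1 => w; exact: sin_max.
by apply: measurableT_comp => //; apply: continuous_measurable_fun;
  exact: continuous_sin.
Qed.

Lemma bounded_rv_comp f (g : R -> R) : measurable_fun setT f ->
  measurable_fun setT g -> (exists M : R, forall x, `|g x| <= M) ->
  bounded_rv (fun w => g (f w)).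
Proof.
by move=> mf mg [M gM]; split; [exact: measurableT_comp|exists M].
Qed.

Lemma bounded_rv_integrable f : bounded_rv f -> P.-integrable setT (EFin \o f).
Proof.
move=> [mf [M fM]]; apply: measurable_bounded_integrable => //.
  by rewrite (le_lt_trans (probability_le1 P measurableT))// ltry.
exists M; split; first exact: num_real.
by move=> x Mx w _ /=; rewrite (le_trans (fM w))// ltW.
Qed.

Definition Ex f : R := fine ('E_P[f])%E.

Lemma ExE f : Ex f = \int[P]_w f w.
Proof. by rewrite /Ex unlock. Qed.

Lemma expectationE f : bounded_rv f -> ('E_P[f] = (Ex f)%:E)%E.
Proof.
move=> bf; rewrite /Ex unlock fineK//.
exact: integrable_fin_num (bounded_rv_integrable bf).
Qed.

Lemma eq_Ex f g : f =1 g -> Ex f = Ex g.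
Proof. by move=> fg; congr (Ex _); apply/funext. Qed.

Lemma Ex_cst c : Ex (cst c) = c.
Proof. by rewrite /Ex expectation_cst. Qed.

Lemma ExD f g : bounded_rv f -> bounded_rv g -> Ex (f \+ g) = Ex f + Ex g.
Proof.
by move=> bf bg; rewrite !ExE RintegralD//; exact: bounded_rv_integrable.
Qed.

Lemma ExB f g : bounded_rv f -> bounded_rv g -> Ex (f \- g) = Ex f - Ex g.
Proof.
by move=> bf bg; rewrite !ExE RintegralB//; exact: bounded_rv_integrable.
Qed.

Lemma ExZ c f : bounded_rv f -> Ex (fun w => c * f w) = c * Ex f.
Proof.
by move=> bf; rewrite !ExE RintegralZl//; exact: bounded_rv_integrable.
Qed.

Lemma Ex_sum I (s : seq I) (F : I -> T -> R) : (forall i, bounded_rv (F i)) ->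
  Ex (fun w => \sum_(i <- s) F i w) = \sum_(i <- s) Ex (F i).
Proof.
move=> bF; elim: s => [|i s IH].
  by under eq_Ex do rewrite big_nil; rewrite big_nil Ex_cst.
under eq_Ex do rewrite big_cons.
by rewrite ExD ?IH ?big_cons//; exact: bounded_rv_sum.
Qed.

Lemma le_Ex f g : bounded_rv f -> bounded_rv g -> (forall w, f w <= g w) ->
  Ex f <= Ex g.
Proof.
by move=> bf bg fg; rewrite !ExE le_Rintegral//; exact: bounded_rv_integrable.
Qed.

Lemma Ex_ge0 f : (forall w, 0 <= f w) -> 0 <= Ex f.
Proof. by move=> f0; rewrite ExE Rintegral_ge0. Qed.

Lemma normr_Ex f : bounded_rv f -> `|Ex f| <= Ex (fun w => `|f w|).
Proof.
by move=> bf; rewrite !ExE le_normr_Rintegral//; exact: bounded_rv_integrable.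
Qed.

Lemma normr_Ex_le f M : bounded_rv f -> (forall w, `|f w| <= M) -> `|Ex f| <= M.
Proof.
move=> bf fM; rewrite (le_trans (normr_Ex bf))// -[leRHS]Ex_cst le_Ex//.
  split; first by apply: measurableT_comp => //; case: bf.
  by exists M => w; rewrite normr_id.
exact: bounded_rv_cst.
Qed.

Lemma Ex_indic (A : set T) : measurable A -> Ex \1_A = fine (P A).
Proof. by move=> mA; rewrite /Ex expectation_indic. Qed.

Lemma Ex_dominated (F : nat -> T -> R) f (M : R) :
  (forall n, measurable_fun setT (F n)) -> measurable_fun setT f ->
  (forall n w, `|F n w| <= M) -> (forall w, F ^~ w @ \oo --> f w) ->
  Ex (F n) @[n --> \oo] --> Ex f.
Proof.
move=> mF mf FM Ff.
have [] := @dominated_convergence _ _ _ P setT measurableT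
  (fun n => EFin \o F n) (EFin \o f) (cst M%:E).
- by move=> n; exact/measurable_EFinP.
- exact/measurable_EFinP.
- by apply: aeW => w _; apply: cvg_EFin; [exact: nearW|exact: Ff].
- exact: (bounded_rv_integrable (bounded_rv_cst M)).
- by apply: aeW => w n _ /=; rewrite lee_fin.
move=> fi _ cv.
have bF n : bounded_rv (F n) by split => //; exists M.
have -> : (fun n => Ex (F n)) = fine \o (fun n => \int[P]_x (F n x)%:E)%E.
  by apply/funext => n; rewrite /Ex unlock.
apply: fine_cvg; rewrite ExE /Rintegral fineK//; exact: integrable_fin_num fi.
Qed.

End bounded_expectation.

(** The sum counts the integers from 1 to [K] that are at most [y], so it is the integer part of [y]
    and the difference is the fractional part. *)
Lemma layer_sum (R : realType) (K : nat) (y : R) : 0 <= y <= K%:R ->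
  0 <= y - \sum_(j < K) ((j.+1%:R <= y)%R : nat)%:R <= 1.
Proof.
elim: K => [|K IH]; first by rewrite big_ord0 => y0; lra.
move=> /andP[y0 yK]; rewrite big_ord_recr /=.
have [yltK|Kley] := ltP y K.+1%:R; last first.
  have -> : y = K.+1%:R by apply/le_anti; rewrite yK Kley.
  rewrite (eq_bigr (fun=> 1)) => [|i _]; last by rewrite ler_nat ltnS (ltnW (ltn_ord i)).
  by rewrite sumr_const card_ord mulr1n -natr1; lra.
rewrite addr0; have [yK'|Ky] := leP y K%:R; first by apply: IH; rewrite y0.
rewrite (eq_bigr (fun=> 1)) => [|i _].
  by rewrite sumr_const card_ord; move: yK; rewrite -natr1; lra.
by rewrite (le_trans _ (ltW Ky))// ler_nat.
Qed.

Lemma le0_div_nat (R : realType) (x K : R) :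
  (forall N : nat, x <= K * N.+1%:R^-1) -> x <= 0.
Proof.
move=> xK; rewrite leNgt; apply/negP => x0.
have K0 : 0 < K.
  by have := xK 0; rewrite invr1 mulr1; exact: lt_le_trans.
have := xK (Num.bound (K / x)); apply/negP; rewrite -ltNge ltr_pdivrMr// mulrC.
rewrite -ltr_pdivrMr// (lt_le_trans (archi_boundP _)) ?ler_nat//.
by rewrite divr_ge0 ?ltW.
Qed.

(** * Factorisation of expectations under independence *)

Section independence.
Context d (T : measurableType d) (R : realType) (P : probability T R).
Local Notation Ex := (Ex P).

(* [f] is approximated uniformly by the step functions of its layer-cake
   representation. *)
Lemma Ex_indep (G : T -> R) (X : T -> R) (f : R -> R) :
  bounded_rv G -> measurable_fun setT X ->
  measurable_fun setT f -> (exists M : R, forall x, `|f x| <= M) ->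
  (forall A, measurable A ->
     Ex (fun w => G w * \1_A (X w)) = Ex G * Ex (fun w => \1_A (X w))) ->
  Ex (fun w => G w * f (X w)) = Ex G * Ex (fun w => f (X w)).
Proof.
move=> bG mX mf bf GX.
have bind A : measurable A -> bounded_rv (fun w => \1_A (X w) : R).
  move=> mA; apply: bounded_rv_comp => //.
  by exists 1 => x; rewrite indicE; case: (_ \in _); rewrite ?normr1// normr0.
have [M fM] : exists M : nat, forall x, `|f x| <= M%:R.
  have [M fM] := bf; exists (Num.bound M) => x; rewrite (le_trans (fM x))// ltW//.
  by rewrite archi_boundP// (le_trans _ (fM x)).
have [K [K0 GK mG]] := bounded_rvP bG.
pose A N j : set R := [set x | j.+1%:R <= N.+1%:R * (f x + M%:R)].
have mA N j : measurable (A N j).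
  rewrite -[A N j]setTI; apply: measurable_fun_le => //.
  apply: measurable_funM; first exact: measurable_cst.
  by apply: measurable_funD => //; exact: measurable_cst.
(* Layer cake at mesh [1 / (N + 1)]: the shift by [M] makes the function nonnegative, and
   [2 M (N + 1)] levels exhaust its range. *)
pose fN N x : R := N.+1%:R^-1 * \sum_(j < N.+1 * M.*2) \1_(A N j) x - M%:R.
have fNE N x : `|f x - fN N x| <= N.+1%:R^-1.
  have /andP[f1 f2] : - (M%:R) <= f x <= M%:R by rewrite -ler_norml.
  have N0 : 0 < N.+1%:R :> R by rewrite ltr0n.
  have : 0 <= N.+1%:R * (f x + M%:R) <= (N.+1 * M.*2)%:R.
    rewrite natrM -muln2 natrM pmulr_rge0// ler_pM2l//; lra.
  move=> /layer_sum; rewrite (eq_bigr (fun j : 'I__ => \1_(A N j) x)); last first.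
    by move=> j _; rewrite indicE; congr (nat_of_bool _)%:R; apply/idP/idP;
      rewrite inE.
  rewrite /fN; set S := \sum_(j < _) _ => /andP[l1 l2].
  have -> : f x - (N.+1%:R^-1 * S - M%:R) = N.+1%:R^-1 * (N.+1%:R * (f x + M%:R) - S).
    by rewrite mulrBr mulKf ?gt_eqF// opprB addrA.
  rewrite ger0_norm; last by rewrite mulr_ge0// invr_ge0 ltW.
  by rewrite -[leRHS]mulr1 ler_pM2l ?invr_gt0.
have mfN N : measurable_fun setT (fN N).
  apply: measurable_funB; last exact: measurable_cst.
  apply: measurable_funM; first exact: measurable_cst.
  by apply: measurable_sum => j; exact: measurable_indic.
have bX (g : R -> R) : measurable_fun setT g -> (exists M : R, forall x, `|g x| <= M) ->
  bounded_rv (fun w => g (X w)) by move=> *; exact: bounded_rv_comp.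
have bF := bX _ mf bf.
have bfN N : bounded_rv (fun w => fN N (X w)).
  apply: bX => //; exists (M%:R + N.+1%:R^-1) => x.
  have := fNE N x; have := fM x; rewrite !ler_norml; move: (N.+1%:R^-1) (M%:R) => q m; lra.
have ind j N := bind _ (mA N j).
have sbind N : bounded_rv (fun w => \sum_(j < N.+1 * M.*2) \1_(A N j) (X w) : R).
  exact: bounded_rv_sum.
have GfN N : Ex (fun w => G w * fN N (X w)) = Ex G * Ex (fun w => fN N (X w)).
  have E1 : (fun w => fN N (X w)) =
    (fun w => N.+1%:R^-1 * \sum_(j < N.+1 * M.*2) \1_(A N j) (X w)) \- cst M%:R.
    by [].
  rewrite [in RHS]E1 ExB; [|exact: bounded_rvZ|exact: bounded_rv_cst].
  rewrite ExZ// Ex_sum// Ex_cst.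
  have -> : (fun w => G w * fN N (X w)) =
     (fun w => N.+1%:R^-1 * \sum_(j < N.+1 * M.*2) G w * \1_(A N j) (X w)) \-
     (fun w => M%:R * G w).
    by apply/funext => w /=; rewrite /fN -mulr_sumr; ring.
  have bGA j : bounded_rv (fun w => G w * \1_(A N j) (X w)) by exact: bounded_rvM.
  rewrite ExB ?ExZ// ?Ex_sum//; [|exact: bounded_rv_sum|..]; last 2 first.
  - by apply: bounded_rvZ; exact: bounded_rv_sum.
  - exact: bounded_rvZ.
  rewrite (eq_bigr (fun j : 'I__ => Ex G * Ex (fun w => \1_(A N j) (X w)))); last first.
    by move=> j _; exact: GX.
  rewrite -mulr_sumr; ring.
(* Replacing [f] by [fN N] costs at most [K / (N + 1)] on each side of the identity, [K] being a
   bound of [G]. *)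
apply/eqP; rewrite -subr_eq0 -normr_le0; apply: (@le0_div_nat _ _ (K + K)) => N.
have bd : bounded_rv (fun w => f (X w) - fN N (X w)) by exact: bounded_rvB.
have -> : Ex (fun w => G w * f (X w)) - Ex G * Ex (fun w => f (X w)) =
    Ex (fun w => G w * (f (X w) - fN N (X w))) -
    Ex G * Ex (fun w => f (X w) - fN N (X w)).
  have -> : (fun w => G w * (f (X w) - fN N (X w))) =
     (fun w => G w * f (X w)) \- (fun w => G w * fN N (X w)).
    by apply/funext => w /=; rewrite mulrBr.
  by rewrite (ExB P bF (bfN N)) ExB ?GfN; [ring|exact: bounded_rvM..].
rewrite (le_trans (ler_normB _ _))// mulrDl lerD//.
  apply: normr_Ex_le => [|w]; first exact: bounded_rvM.
  by rewrite normrM ler_pM.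
by rewrite normrM ler_pM//; [exact: normr_Ex_le|apply: normr_Ex_le => // w].
Qed.

End independence.

(** * Complex expectations *)

Notation normc := Normc.normc.

Section complex_modulus.
Context (R : realType).
Implicit Types (z : R[i]) (x : R).

Lemma normc_ge0 z : 0 <= normc z.
Proof. by case: z => a b; exact: sqrtr_ge0. Qed.

Lemma normcR x : normc x%:C%C = `|x|.
Proof. by rewrite /= expr0n/= addr0 sqrtr_sqr. Qed.

Lemma normc_sqr z : normc z ^+ 2 = complex.Re z ^+ 2 + complex.Im z ^+ 2.
Proof. by case: z => a b /=; rewrite sqr_sqrtr ?addr_ge0 ?sqr_ge0. Qed.

Lemma normc_leRI z : normc z <= `|complex.Re z| + `|complex.Im z|.
Proof.
rewrite -(@ler_pXn2r _ 2) ?nnegrE ?addr_ge0 ?normc_ge0//.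
rewrite normc_sqr sqrrD !real_normK ?num_real//.
by rewrite addrAC lerDl mulrn_wge0// mulr_ge0.
Qed.

Lemma normr_Re z : `|complex.Re z| <= normc z.
Proof.
rewrite -(@ler_pXn2r _ 2) ?nnegrE ?normc_ge0//.
by rewrite normc_sqr real_normK ?num_real// lerDl sqr_ge0.
Qed.

Lemma normr_Im z : `|complex.Im z| <= normc z.
Proof.
rewrite -(@ler_pXn2r _ 2) ?nnegrE ?normc_ge0//.
by rewrite normc_sqr real_normK ?num_real// lerDr sqr_ge0.
Qed.

Lemma le_normcB z1 z2 : normc (z1 - z2) <= normc z1 + normc z2.
Proof. by rewrite (le_trans (le_normcD _ _))// normcN. Qed.

Lemma normcC z1 z2 : normc (z1 - z2) = normc (z2 - z1).
Proof. by rewrite -normcN opprB. Qed.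

Lemma le_normc_sum I (s : seq I) (P : pred I) (F : I -> R[i]) :
  normc (\sum_(i <- s | P i) F i) <= \sum_(i <- s | P i) normc (F i).
Proof.
elim/big_rec2: _ => [|i x z _ IH]; first by rewrite Normc.normc0.
by rewrite (le_trans (le_normcD _ _))// lerD2l.
Qed.

Lemma normc_prod_le1 I (s : seq I) (F : I -> R[i]) :
  (forall i, normc (F i) <= 1) -> normc (\prod_(i <- s) F i) <= 1.
Proof.
move=> F1; elim/big_rec: _ => [|i z _ IH]; first by rewrite Normc.normc1.
by rewrite Normc.normcM mulr_ile1 ?normc_ge0.
Qed.

(** Telescoping: the factors are exchanged one at a time, and the untouched ones have modulus at
    most 1. *)
Lemma normc_prodB I (s : seq I) (F G : I -> R[i]) :
  (forall i, normc (F i) <= 1) -> (forall i, normc (G i) <= 1) ->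
  normc (\prod_(i <- s) F i - \prod_(i <- s) G i) <=
    \sum_(i <- s) normc (F i - G i).
Proof.
move=> F1 G1; elim: s => [|i s IH].
  by rewrite !big_nil subrr Normc.normc0.
rewrite !big_cons.
have -> : F i * \prod_(j <- s) F j - G i * \prod_(j <- s) G j =
  (F i - G i) * \prod_(j <- s) F j +
    G i * (\prod_(j <- s) F j - \prod_(j <- s) G j) by ring.
rewrite (le_trans (le_normcD _ _))// !Normc.normcM lerD//.
  by rewrite ler_piMr ?normc_ge0// normc_prod_le1.
by rewrite (le_trans _ IH)// ler_piMl ?normc_ge0.
Qed.

Definition cis x : R[i] := Complex (cos x) (sin x).

Lemma cisD x y : cis (x + y) = cis x * cis y.
Proof.
apply/eqP; rewrite eq_complex /= cosD sinD eqxx/=; apply/eqP.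
by rewrite addrC.
Qed.

Lemma cis0 : cis 0 = 1.
Proof. by rewrite /cis cos0 sin0. Qed.

Lemma normc_cis x : normc (cis x) = 1.
Proof. by rewrite /= cos2Dsin2 sqrtr1. Qed.

End complex_modulus.

Section complex_expectation.
Context d (T : measurableType d) (R : realType) (P : probability T R).
Local Notation Ex := (Ex P).
Implicit Types F G : T -> R[i].

Definition bounded_rvC F := bounded_rv (fun w => complex.Re (F w)) /\
  bounded_rv (fun w => complex.Im (F w)).

Definition EC F : R[i] :=
  Complex (Ex (fun w => complex.Re (F w))) (Ex (fun w => complex.Im (F w))).

Lemma bounded_rvCM F G : bounded_rvC F -> bounded_rvC G -> bounded_rvC (F \* G).
Proof.
move=> [F1 F2] [G1 G2]; split.
  have -> : (fun w => complex.Re ((F \* G) w)) =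
    (fun w => complex.Re (F w) * complex.Re (G w)) \-
    (fun w => complex.Im (F w) * complex.Im (G w)).
    by apply/funext => w /=; case: (F w) (G w) => [a b] [c e].
  by apply: bounded_rvB; exact: bounded_rvM.
have -> : (fun w => complex.Im ((F \* G) w)) =
  (fun w => complex.Re (F w) * complex.Im (G w)) \+
  (fun w => complex.Im (F w) * complex.Re (G w)).
  by apply/funext => w /=; case: (F w) (G w) => [a b] [c e].
by apply: bounded_rvD; exact: bounded_rvM.
Qed.

Lemma bounded_rvCR (f : T -> R) : bounded_rv f -> bounded_rvC (fun w => (f w)%:C%C).
Proof. by move=> bf; split => //=; exact: bounded_rv_cst. Qed.

Lemma bounded_rvC_cis (f : T -> R) : measurable_fun setT f ->
  bounded_rvC (fun w => cis (f w)).
Proof. by move=> mf; split; [exact: bounded_rv_cos|exact: bounded_rv_sin]. Qed.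

Lemma ECR (f : T -> R) : EC (fun w => (f w)%:C%C) = (Ex f)%:C%C.
Proof. by rewrite /EC /= (Ex_cst P 0). Qed.

(** Projection on the direction of [z = EC F]: [|z|^2] is the mean of the real part of [conj(z) F],
    which is at most [|z| |F|] pointwise. *)
Lemma normc_EC F (g : T -> R) : bounded_rvC F -> bounded_rv g ->
  (forall w, normc (F w) <= g w) -> normc (EC F) <= Ex g.
Proof.
move=> [bR bI] bg Fg; set z := EC F.
have [z0|z0] := eqVneq (normc z) 0.
  by rewrite z0 Ex_ge0// => w; rewrite (le_trans _ (Fg w))// normc_ge0.
have zp : 0 < normc z by rewrite lt_def z0 normc_ge0.
rewrite -(ler_pM2l zp) -expr2 normc_sqr !expr2 {1}/z {2}/z /= -!ExZ//.
rewrite -ExD; [|exact: bounded_rvZ..].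
apply: le_Ex; [by apply: bounded_rvD; exact: bounded_rvZ|exact: bounded_rvZ|].
move=> w /=; apply: (@le_trans _ _ (normc z * normc (F w))); last first.
  by rewrite ler_wpM2l ?normc_ge0.
rewrite /z /EC; set a := Ex _; set b := Ex _; case: (F w) => c e /=.
have := normr_Re (Complex a (- b) * Complex c e); rewrite Normc.normcM /= sqrrN.
by apply: le_trans; rewrite mulNr opprK ler_norm.
Qed.

(** Real and imaginary parts of [G] are each tested against cosine and sine, so [Ex_indep] applies
    four times. The assumption is on complex products because the induction of [EC_prod_indep]
    delivers it in this form. *)
Lemma EC_indep (G : T -> R[i]) (X : T -> R) (s : R) :
  bounded_rvC G -> measurable_fun setT X ->
  (forall A, measurable A ->
     EC (fun w => G w * (\1_A (X w))%:C%C) = EC G * (Ex (fun w => \1_A (X w)))%:C%C) ->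
  EC (fun w => G w * cis (s * X w)) = EC G * EC (fun w => cis (s * X w)).
Proof.
move=> [bR bI] mX GA.
have msX : measurable_fun setT (fun x : R => s * x).
  by apply: measurable_funM => //; exact: measurable_cst.
have mcos : measurable_fun setT (fun x : R => cos (s * x)).
  by apply: measurableT_comp => //; apply: continuous_measurable_fun;
    exact: continuous_cos.
have msin : measurable_fun setT (fun x : R => sin (s * x)).
  by apply: measurableT_comp => //; apply: continuous_measurable_fun;
    exact: continuous_sin.
have bcos : exists M : R, forall x, `|cos (s * x)| <= M.
  by exists 1 => x; exact: cos_max.
have bsin : exists M : R, forall x, `|sin (s * x)| <= M.
  by exists 1 => x; exact: sin_max.
have GRA A : measurable A -> Ex (fun w => complex.Re (G w) * \1_A (X w)) =
    Ex (fun w => complex.Re (G w)) * Ex (fun w => \1_A (X w)).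
  move=> mA; move: (congr1 (@complex.Re R) (GA A mA)) => /=.
  rewrite mulr0 subr0 => <-; apply: eq_Ex => w.
  by case: (G w) => a b /=; rewrite mulr0 subr0.
have GIA A : measurable A -> Ex (fun w => complex.Im (G w) * \1_A (X w)) =
    Ex (fun w => complex.Im (G w)) * Ex (fun w => \1_A (X w)).
  move=> mA; move: (congr1 (@complex.Im R) (GA A mA)) => /=.
  rewrite mulr0 add0r => <-; apply: eq_Ex => w.
  by case: (G w) => a b /=; rewrite mulr0 add0r.
have bc : bounded_rv (fun w => cos (s * X w)).
  exact: (bounded_rv_comp mX mcos bcos).
have bs : bounded_rv (fun w => sin (s * X w)).
  exact: (bounded_rv_comp mX msin bsin).
apply/eqP; rewrite eq_complex /=.
rewrite -(Ex_indep bR mX mcos bcos GRA) -(Ex_indep bR mX msin bsin GRA).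
rewrite -(Ex_indep bI mX mcos bcos GIA) -(Ex_indep bI mX msin bsin GIA).
rewrite -ExB; [|exact: bounded_rvM..].
rewrite -ExD; [|exact: bounded_rvM..].
by apply/andP; split; apply/eqP; apply: eq_Ex => w /=; case: (G w).
Qed.

Definition cf (X : T -> R) t : R[i] := EC (fun w => cis (t * X w)).

Lemma eq_EC F G : F =1 G -> EC F = EC G.
Proof. by move=> FG; congr EC; apply/funext. Qed.

(* Complex exponentials replace the indicators one variable at a time. *)
Lemma EC_prod_indep (B : set T) (xi : nat -> T -> R) (n : nat) (s : nat -> R) :
  measurable B -> (forall i, measurable_fun setT (xi i)) ->
  (forall A : nat -> set R, (forall i, measurable (A i)) ->
    Ex (fun w => \1_B w * \prod_(1 <= i < n.+1) \1_(A i) (xi i w)) =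
    Ex \1_B * \prod_(1 <= i < n.+1) Ex (fun w => \1_(A i) (xi i w))) ->
  EC (fun w => (\1_B w)%:C%C * cis (\sum_(1 <= i < n.+1) s i * xi i w)) =
    (Ex \1_B)%:C%C * \prod_(1 <= i < n.+1) cf (xi i) (s i).
Proof.
move=> mB mxi ind.
have bB := bounded_rv_indic R mB.
have bA (A : nat -> set R) i : measurable (A i) ->
    bounded_rv (fun w => \1_(A i) (xi i w) : R).
  move=> mA; apply: bounded_rv_comp => //.
  by exists 1 => x; rewrite indicE; case: (_ \in _); rewrite ?normr1// normr0.
have bprod (A : nat -> set R) (r : seq nat) : (forall i, measurable (A i)) ->
    bounded_rv (fun w => \prod_(i <- r) \1_(A i) (xi i w) : R).
  move=> mA; elim: r => [|i r IH].
    by under eq_fun do rewrite big_nil; exact: bounded_rv_cst.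
  by under eq_fun do rewrite big_cons; apply: bounded_rvM => //; exact: bA.
(* The variables up to [m] carry exponentials, the later ones still carry indicators of arbitrary
   sets; this freedom is what the next replacement uses. *)
suff claim m : (m <= n)%N -> forall A : nat -> set R, (forall i, measurable (A i)) ->
    EC (fun w => (\1_B w * \prod_(m.+1 <= i < n.+1) \1_(A i) (xi i w))%:C%C *
       cis (\sum_(1 <= i < m.+1) s i * xi i w)) =
    (Ex \1_B * \prod_(m.+1 <= i < n.+1) Ex (fun w => \1_(A i) (xi i w)))%:C%C *
       \prod_(1 <= i < m.+1) cf (xi i) (s i).
  have := claim n (leqnn n) (fun=> setT) (fun=> measurableT).
  rewrite big_geq// mulr1 => <-; apply: eq_EC => w.
  by rewrite big_geq// mulr1.
elim: m => [|m IH] mn A mA.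
  rewrite [X in _ = _ * X]big_geq// mulr1 -ind// -ECR; apply: eq_EC => w.
  by rewrite [X in cis X]big_geq// cis0 mulr1.
have mn' : (m <= n)%N by exact: ltnW.
pose G w := (\1_B w * \prod_(m.+2 <= i < n.+1) \1_(A i) (xi i w))%:C%C *
       cis (\sum_(1 <= i < m.+1) s i * xi i w).
(* Inserting [C] at index [m + 1] turns the induction hypothesis into a factorisation of [G] and
   [xi m.+1]; [C = setT] computes [EC G]. *)
pose A' C i := if i == m.+1 then C else A i.
have mA' C : measurable C -> forall i, measurable (A' C i).
  by move=> mC i; rewrite /A'; case: ifP.
have recA' C : EC (fun w => G w * (\1_C (xi m.+1 w))%:C%C) = EC (fun w =>
    (\1_B w * \prod_(m.+1 <= i < n.+1) \1_(A' C i) (xi i w))%:C%C *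
       cis (\sum_(1 <= i < m.+1) s i * xi i w)).
  apply: eq_EC => w; rewrite [in RHS]big_ltn// {1}/A' eqxx.
  rewrite (eq_big_nat _ _ (F2 := fun i => \1_(A i) (xi i w))); last first.
    by move=> i /andP[mi _]; rewrite /A' gtn_eqF.
  rewrite /G mulrAC -!rmorphM/=; congr (_%:C%C * _); ring.
have recE C : \prod_(m.+1 <= i < n.+1) Ex (fun w => \1_(A' C i) (xi i w)) =
  Ex (fun w => \1_C (xi m.+1 w)) *
    \prod_(m.+2 <= i < n.+1) Ex (fun w => \1_(A i) (xi i w)).
  rewrite big_ltn// {1}/A' eqxx; congr (_ * _).
  by apply: eq_big_nat => i /andP[mi _]; rewrite /A' gtn_eqF.
have GE : EC G = (Ex \1_B * \prod_(m.+2 <= i < n.+1) Ex (fun w => \1_(A i) (xi i w)))%:C%C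
    * \prod_(1 <= i < m.+1) cf (xi i) (s i).
  have := IH mn' _ (mA' _ measurableT); rewrite -recA' recE.
  have -> : Ex (fun w => \1_setT (xi m.+1 w)) = 1.
    by rewrite -[RHS](Ex_cst P); apply: eq_Ex => w; rewrite indicE in_setT.
  rewrite mul1r => <-; apply: eq_EC => w.
  by rewrite indicE in_setT mulr1.
have msum (r : seq nat) : measurable_fun setT (fun w => \sum_(i <- r) s i * xi i w).
  apply: measurable_sum => i; apply: measurable_funM => //; exact: measurable_cst.
rewrite (@eq_EC _ (fun w => G w * cis (s m.+1 * xi m.+1 w))); last first.
  by move=> w; rewrite [X in cis X]big_nat_recr//= cisD mulrA.
rewrite EC_indep//.
- by rewrite GE -mulrA; congr (_ * _); rewrite [in RHS]big_nat_recr.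
- apply: bounded_rvCM; last exact: bounded_rvC_cis.
  by apply: bounded_rvCR; apply: bounded_rvM => //; exact: bprod.
move=> C mC; rewrite recA' IH//; last exact: mA'.
rewrite recE GE !rmorphM/=; ring.
Qed.
End complex_expectation.

(** * Levy's continuity theorem *)

Lemma ler_boundS {R : realType} (x : R) : x <= (Num.bound x).+1%:R.
Proof.
have [x0|/ltW x0] := leP 0 x; last by rewrite (le_trans x0).
by rewrite (le_trans (ltW (archi_boundP x0)))// ler_nat.
Qed.

Lemma cvg_sumr (R : realType) I (r : seq I) (F : I -> nat -> R) (l : I -> R) :
  (forall i, F i n @[n --> \oo] --> l i) ->
  \sum_(i <- r) F i n @[n --> \oo] --> \sum_(i <- r) l i.
Proof.
move=> Fl; elim: r => [|i r IH].
  by rewrite big_nil; under eq_fun do rewrite big_nil; exact: cvg_cst.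
by rewrite big_cons; under eq_fun do rewrite big_cons; exact: cvgD.
Qed.

(** * Trigonometric inequalities *)

Section trigonometric_bounds.
Context {R : realType}.
Implicit Types x y : R.

Lemma sin_MVT x : 0 <= x -> exists2 c, 0 <= c <= x & sin x = x * cos c.
Proof.
move=> x0; have sc : {within `[0, x], continuous (@sin R)}.
  by apply: continuous_subspaceT; exact: continuous_sin.
have [c] := MVT_segment x0 (fun y _ => is_derive_sin y) sc.
by rewrite in_itv/= sin0 !subr0 mulrC; exists c.
Qed.

Lemma ler_norm_sin x : `|sin x| <= `|x|.
Proof.
wlog x0 : x / 0 <= x => [h|].
  have [/h//|/ltW x0] := leP 0 x.
  by have := h (- x); rewrite sinN !normrN; apply; rewrite oppr_ge0.
by have [c _ ->] := sin_MVT x0; rewrite normrM ler_piMr// cos_max.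
Qed.

Lemma cos_sin_half x : 1 - cos x = 2 * sin (x / 2) ^+ 2.
Proof.
have : cos (x / 2 *+ 2) = cos x by congr cos; lra.
by rewrite cos_mulr2n => <-; rewrite cos2sin2; lra.
Qed.

Lemma cos_le1B x : 1 - cos x <= x ^+ 2 / 2.
Proof.
rewrite cos_sin_half.
have : `|sin (x / 2)| ^+ 2 <= `|x / 2| ^+ 2.
  by rewrite ler_pXn2r ?nnegrE// ler_norm_sin.
by rewrite !real_normK ?num_real// exprMn exprVn; lra.
Qed.

Lemma sin_ge_half x : 0 <= x <= 1 -> x / 2 <= sin x.
Proof.
move=> /andP[x0 x1]; have [c /andP[c0 cx] ->] := sin_MVT x0.
rewrite ler_wpM2l//.
have := cos_le1B c; have : c ^+ 2 <= 1 by rewrite expr_le1// (le_trans cx).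
lra.
Qed.

Lemma normc_cisB x y : normc (cis x - cis y) = 2 * `|sin ((x - y) / 2)|.
Proof.
have -> : x = y + (x - y) by ring.
rewrite cisD; set u := x - y.
have -> : cis y * cis u - cis y = cis y * (cis u - 1) by ring.
rewrite Normc.normcM normc_cis mul1r [y + u - y]addrAC subrr add0r.
apply/eqP; rewrite -(@eqrXn2 _ 2)// ?normc_ge0 ?mulr_ge0//.
rewrite normc_sqr exprMn real_normK ?num_real//=; apply/eqP.
have := cos_sin_half u; have := cos2Dsin2 u; rewrite subr0 sqrrB expr1n mulr1.
lra.
Qed.

Lemma normc_cisB_le x y : normc (cis x - cis y) <= Num.min 2 `|x - y|.
Proof.
rewrite normc_cisB le_min; apply/andP; split.
  by rewrite -[leRHS]mulr1 ler_wpM2l// sin_max.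
rewrite mulrC -ler_pdivlMr//; apply: le_trans (ler_norm_sin _) _.
by rewrite normrM (ger0_norm (_ : 0 <= 2^-1)).
Qed.

(* Viete's telescoping product [sin x = 2^N sin (x / 2^N) * prod cos (x / 2^j)]. *)
Lemma prod_cos_half N x :
  2 ^+ N * sin (x / 2 ^+ N) * \prod_(j < N) cos (x / 2 ^+ j.+1) = sin x.
Proof.
elim: N => [|N <-]; first by rewrite big_ord0 !expr0 mulr1 mul1r divr1.
rewrite big_ord_recr/=.
have -> : sin (x / 2 ^+ N) = 2 * (cos (x / 2 ^+ N.+1) * sin (x / 2 ^+ N.+1)).
  rewrite mulr_natl -sin_mulr2n; congr sin.
  rewrite exprS invfM; field; exact: expf_neq0.
rewrite (exprS _ N); ring.
Qed.

(** For [x >= 0], the factor [2^N sin (x / 2^N)] of Viete's product is at least [x / 2 >= 2], since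
    [sin y >= y / 2] on [[0, 1]]. The whole product being [sin x <= 1], the cosines contribute at
    most 1/2. *)
Lemma prod_cos_half_le N x : 4 <= `|x| <= 2 ^+ N ->
  \prod_(j < N) cos (x / 2 ^+ j.+1) <= 2^-1.
Proof.
wlog x0 : x / 0 <= x => [h|].
  have [/h//|/ltW x0] := leP 0 x.
  have := h (- x); rewrite normrN oppr_ge0 => /(_ x0) /[apply].
  by under eq_bigr do rewrite mulNr cosN.
rewrite (ger0_norm x0) => /andP[x4 xN].
have N0 : 0 < 2 ^+ N :> R by rewrite exprn_gt0.
have sN : x / 2 ^+ N / 2 <= sin (x / 2 ^+ N).
  by apply: sin_ge_half; rewrite divr_ge0 ?(ltW N0)//= ler_pdivrMr// mul1r.
set p := \prod_(_ < _) _; have [|p0] := leP p 0; first by lra.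
have : 2 ^+ N * sin (x / 2 ^+ N) * p <= 1 by rewrite prod_cos_half sin_le1.
have : 2 <= 2 ^+ N * sin (x / 2 ^+ N).
  rewrite mulrC -ler_pdivrMr//; apply: le_trans sN.
  by rewrite mulrAC ler_pM2r ?invr_gt0//; lra.
set q := _ * sin _ => q2 qp.
have : 2 * p <= q * p by rewrite ler_wpM2r// ltW.
lra.
Qed.

End trigonometric_bounds.

(** * Tightness from the characteristic function near 0 *)

Section tightness.
Context d (T : measurableType d) (R : realType) (P : probability T R).
Local Notation Ex := (Ex P).

(** Product-to-sum formulas write the product as an average of cosines of multiples of [X], all of
    frequency at most [delta]; each induction step absorbs one factor into [y]. *)
Lemma le_cf_prod_cos (X : T -> R) (delta eps : R) : measurable_fun setT X ->
  (forall t, `|t| <= delta -> 1 - Ex (fun w => cos (t * X w)) <= eps) ->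
  forall N (u : nat -> R) y, `|y| + \sum_(j < N) `|u j| <= delta ->
  1 - Ex (fun w => cos (y * X w) * \prod_(j < N) cos (u j * X w)) <= eps.
Proof.
move=> mX Xe; have mtX t : measurable_fun setT (fun w => t * X w).
  by apply: measurable_funM => //; exact: measurable_cst.
elim => [|N IH] u y.
  rewrite big_ord0 addr0 => yd; under eq_Ex do rewrite big_ord0 mulr1.
  exact: Xe.
rewrite big_ord_recr/= => yd.
have bp z : bounded_rv (fun w => cos (z * X w) * \prod_(j < N) cos (u j * X w)).
  apply: bounded_rvM; first exact: bounded_rv_cos.
  elim: N {IH yd} => [|N IH].
    by under eq_fun do rewrite big_ord0; exact: bounded_rv_cst.
  by under eq_fun do rewrite big_ord_recr; apply: bounded_rvM => //; exact: bounded_rv_cos.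
have -> : Ex (fun w => cos (y * X w) * \prod_(j < N.+1) cos (u j * X w)) =
  2^-1 * (Ex (fun w => cos ((y + u N) * X w) * \prod_(j < N) cos (u j * X w)) +
          Ex (fun w => cos ((y - u N) * X w) * \prod_(j < N) cos (u j * X w))).
  rewrite -ExD// -ExZ; last exact: bounded_rvD.
  apply: eq_Ex => w /=; rewrite big_ord_recr/= mulrDl mulrBl cosD cosB.
  by set p := \prod_(_ < _) _; field.
have h1 : `|y + u N| + \sum_(j < N) `|u j| <= delta.
  by apply: le_trans yd; rewrite [leRHS]addrA [leRHS]addrAC lerD2r ler_normD.
have h2 : `|y - u N| + \sum_(j < N) `|u j| <= delta.
  by apply: le_trans yd; rewrite [leRHS]addrA [leRHS]addrAC lerD2r ler_normB.
by have := IH u _ h1; have := IH u _ h2; lra.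
Qed.

(** The frequencies [delta / 2^(j+1)] sum to at most [delta], so the product of their cosines has
    mean at least [1 - eps]; yet it is at most 1/2 where [|delta X| >= 4], so half of that
    probability is at most [eps]. The cut-off [2^N] comes from [prod_cos_half_le] and is removed by
    continuity from below. *)
Lemma tightness (X : T -> R) (delta eps : R) : measurable_fun setT X -> 0 <= delta ->
  (forall t, `|t| <= delta -> 1 - Ex (fun w => cos (t * X w)) <= eps) ->
  fine (P [set w | 4 <= `|delta * X w|]) <= 2 * eps.
Proof.
move=> mX d0 Xe.
have mdX : measurable_fun setT (fun w => `|delta * X w|).
  apply: measurableT_comp => //.
  by apply: measurable_funM => //; exact: measurable_cst.
pose A N := [set w | 4 <= `|delta * X w|] `&` [set w | `|delta * X w| <= 2 ^+ N].
have mA1 : measurable [set w | 4 <= `|delta * X w|].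
  by rewrite -[X in measurable X]setTI; exact: measurable_fun_le.
have mA N : measurable (A N).
  apply: measurableI => //.
  by rewrite -[X in measurable X]setTI; exact: measurable_fun_le.
have PA N : fine (P (A N)) <= 2 * eps.
  have := @le_cf_prod_cos X delta eps mX Xe N (fun j => delta / 2 ^+ j.+1) 0.
  have -> : \sum_(j < N) `|delta / 2 ^+ j.+1| = delta * (1 - (2 ^+ N)^-1).
    elim: N => [|N IH]; first by rewrite big_ord0 expr0 invr1 subrr mulr0.
    rewrite big_ord_recr/= IH ger0_norm ?divr_ge0 ?exprn_ge0// exprS invfM.
    by field; rewrite expf_neq0.
  rewrite normr0 add0r => /(_ _)/wrap[].
    rewrite ler_piMr// gerBl invr_ge0 exprn_ge0//.
  set F := fun w => _ * _ => hF.
  have bF : bounded_rv F.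
    apply: bounded_rvM; first by apply: bounded_rv_cos; apply: measurable_funM => //; exact: measurable_cst.
    elim: N {hF F} => [|N IH].
      by under eq_fun do rewrite big_ord0; exact: bounded_rv_cst.
    under eq_fun do rewrite big_ord_recr; apply: bounded_rvM => //.
    by apply: bounded_rv_cos; apply: measurable_funM => //; exact: measurable_cst.
  have bA := bounded_rv_indic R (mA N).
  rewrite -Ex_indic//.
  suff : 2^-1 * Ex \1_(A N) <= Ex (cst 1) - Ex F by rewrite Ex_cst; lra.
  rewrite -ExZ// -ExB//; last exact: bounded_rv_cst.
  apply: le_Ex; [exact: bounded_rvZ|by apply: bounded_rvB => //; exact: bounded_rv_cst|].
  move=> w /=; rewrite /F mul0r cos0 mul1r.
  have E : \prod_(j < N) cos (delta / 2 ^+ j.+1 * X w) =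
      \prod_(j < N) cos ((delta * X w) / 2 ^+ j.+1).
    by apply: eq_bigr => j _; congr cos; rewrite mulrAC.
  rewrite indicE; have [wA|wA] := boolP (w \in A N).
    rewrite inE in wA; case: wA => w4 wN.
    have := @prod_cos_half_le R N (delta * X w); rewrite -E w4 wN => /(_ isT).
    by rewrite mulr1; lra.
  rewrite mulr0 subr_ge0 (le_trans (ler_norm _))// normr_prod.
  by apply: prodr_ile1 => j _; rewrite normr_ge0 cos_max.
have UA : \bigcup_N A N = [set w | 4 <= `|delta * X w|].
  apply/seteqP; split => [w [N _ []//]|w /= wA].
  exists (Num.bound `|delta * X w|) => //; split => //=.
  rewrite (le_trans (ltW (archi_boundP _)))// -natrX ler_nat ltnW//.
  exact: ltn_expl.
have cv : (P \o A) N @[N --> \oo] --> P [set w | 4 <= `|delta * X w|].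
  rewrite -UA; apply: nondecreasing_cvg_mu => //; first by rewrite UA.
  move=> n m nm; apply/subsetPset => w [wA wn]; split => //=.
  by rewrite (le_trans wn)// ler_weXn2l// ler1n.
rewrite -lee_fin fineK ?fin_num_measure// -(cvg_lim _ cv)//.
apply: lime_le; first by apply/cvg_ex; eexists; exact: cv.
by apply: nearW => N /=; rewrite -[P _]fineK ?fin_num_measure// lee_fin.
Qed.

End tightness.

(** * Bernstein polynomials and uniform approximation *)

Section weierstrass.
Context {R : realType}.

Lemma continuous_unif_segment (f : R -> R) (a b eps : R) : continuous f -> 0 < eps ->
  exists2 delta : R, 0 < delta & forall x y : R, a <= x <= b -> `|y - x| <= delta ->
    `|f y - f x| <= eps.
Proof.
move=> cf e0.
have /compact_near_coveringP cpt := @segment_compact R a b.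
have : \forall delta \near (0 : R)^'+, `[a, b] `<=`
    (fun x => forall y, `|y - x| <= delta -> `|f y - f x| <= eps).
  apply: (cpt _ _ (fun delta x => forall y, `|y - x| <= delta -> `|f y - f x| <= eps)).
  move=> x _; have /cvgrPdist_le/(_ (eps / 2)) := cf x.
  rewrite divr_gt0// => /(_ isT) [r /= r0 fr].
  exists ([set x' | `|x - x'| < r / 2], [set delta | 0 < delta < r / 2]) => /=.
    split; first by exists (r / 2) => //=; rewrite divr_gt0.
    exists (r / 2) => /=; first by rewrite divr_gt0.
    by move=> z /=; rewrite sub0r normrN => zr z0; rewrite z0 (le_lt_trans _ zr)// ler_norm.
  move=> [x' delta] /= [xx' /andP[d0 dr]] y yd.
  have h1 : `|f x - f x'| <= eps / 2 by apply: fr => /=; lra.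
  have h2 : `|f x - f y| <= eps / 2.
    apply: fr => /=; rewrite -(subrKA x') (le_lt_trans (ler_normD _ _))//.
    by rewrite (distrC x'); lra.
  rewrite -(subrKA (f x)) (le_trans (ler_normD _ _))// distrC; lra.
move=> H; have [delta [d0 dP]] : exists delta : R, 0 < delta /\ `[a, b] `<=`
    (fun x => forall y, `|y - x| <= delta -> `|f y - f x| <= eps).
  near (0 : R)^'+ => delta; exists delta.
  by split; near: delta; [exact: nbhs_right_gt|exact: H].
by exists delta => // x y xab; apply: dP; rewrite /= in_itv.
Unshelve. all: by end_near. Qed.

(** Conditioning on the first of [n] trials: for [0 <= x <= 1] the value at [x] is the mean of [c]
    under the binomial law of parameters [n] and [x]. *)
Fixpoint bernstein (n : nat) (c : nat -> R) : {poly R} :=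
  if n is m.+1 then
    'X * bernstein m (fun k => c k.+1) + (1 - 'X) * bernstein m c
  else (c 0)%:P.

Lemma bernsteinS n c x : (bernstein n.+1 c).[x] =
  x * (bernstein n (fun k => c k.+1)).[x] + (1 - x) * (bernstein n c).[x].
Proof. by rewrite /= !hornerE. Qed.

Lemma le_bernstein n c c' x : 0 <= x <= 1 ->
  (forall k, (k <= n)%N -> c k <= c' k) ->
  (bernstein n c).[x] <= (bernstein n c').[x].
Proof.
move=> /andP[x0 x1]; elim: n c c' => [|n IH] c c' cc'.
  by rewrite /= !hornerE cc'.
rewrite !bernsteinS lerD// ler_wpM2l ?subr_ge0//; apply: IH => k kn.
  by rewrite cc'.
by rewrite cc'// leqW.
Qed.

Lemma bernsteinD n c c' x : (bernstein n (fun k => c k + c' k)).[x] =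
  (bernstein n c).[x] + (bernstein n c').[x].
Proof.
elim: n c c' => [|n IH] c c'; first by rewrite /= !hornerE.
rewrite !bernsteinS !IH; ring.
Qed.

Lemma bernsteinZ n a c x : (bernstein n (fun k => a * c k)).[x] =
  a * (bernstein n c).[x].
Proof.
elim: n c => [|n IH] c; first by rewrite /= !hornerE.
rewrite !bernsteinS !IH; ring.
Qed.

Lemma bernstein_cst n a x : (bernstein n (fun=> a)).[x] = a.
Proof. elim: n => [|n IH]; [by rewrite /= !hornerE|rewrite bernsteinS IH; ring]. Qed.

(** Binomial variance plus squared bias. The centre [a] must be free, because a success in the first
    trial shifts it by one. *)
Lemma bernstein_var n a x : (bernstein n (fun k => (k%:R - a) ^+ 2)).[x] =
  n%:R * x * (1 - x) + (n%:R * x - a) ^+ 2.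
Proof.
elim: n a => [|n IH] a; first by rewrite /= !hornerE; ring.
rewrite bernsteinS IH; under [X in bernstein n X]funext => k.
  have -> : k.+1%:R - a = k%:R - (a - 1) by rewrite -natr1; ring.
  over.
rewrite IH -natr1; ring.
Qed.

Lemma weierstrass_unit (f : R -> R) (eps : R) : continuous f ->
  (exists M : R, forall x, `|f x| <= M) -> 0 < eps ->
  exists q : {poly R}, forall x : R, 0 <= x <= 1 -> `|f x - q.[x]| <= eps.
Proof.
move=> cf [M fM] e0; have e20 : 0 < eps / 2 by rewrite divr_gt0.
have [delta d0 fd] := @continuous_unif_segment f 0 1 _ cf e20.
have M0 : 0 <= M by rewrite (le_trans _ (fM 0)).
(* Chebyshev's argument: [C (k/n - x)^2] exceeds [2 M] once [|k/n - x| > delta], and its binomial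
   mean is at most [C / n]. *)
pose C := 2 * M / delta ^+ 2.
have C0 : 0 <= C by rewrite divr_ge0 ?sqr_ge0// mulr_ge0.
pose n := (Num.bound (2 * C / eps)).+1.
have nC : C / n%:R <= eps / 2.
  rewrite ler_pdivrMr ?ltr0n// -ler_pdivrMl// (@le_trans _ _ (2 * C / eps))//.
    by rewrite invf_div mulrAC.
  exact: ler_boundS.
exists (bernstein n (fun k => f (k%:R / n%:R))) => x x01.
have n0 : 0 < n%:R :> R by rewrite ltr0n.
have key k : `|f (k%:R / n%:R) - f x| <= eps / 2 + C / n%:R ^+ 2 * (k%:R - n%:R * x) ^+ 2.
  have -> : C / n%:R ^+ 2 * (k%:R - n%:R * x) ^+ 2 = C * (k%:R / n%:R - x) ^+ 2.
    by field; rewrite gt_eqF.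
  have [kd|kd] := leP `|k%:R / n%:R - x| delta.
    by rewrite (le_trans (fd _ _ x01 kd))// lerDl mulr_ge0// sqr_ge0.
  rewrite (le_trans (ler_normB _ _))// (@le_trans _ _ (2 * M)) //.
    by have := fM (k%:R / n%:R); have := fM x; lra.
  rewrite (@le_trans _ _ (C * delta ^+ 2))//.
    by rewrite /C divfK// expf_neq0// gt_eqF.
  rewrite ler_wpDl ?(ltW e20)// ler_wpM2l// -[leRHS]real_normK ?num_real//.
  by rewrite ler_pXn2r ?nnegrE// ltW.
have var : eps / 2 + C / n%:R ^+ 2 * (n%:R * x * (1 - x) + (n%:R * x - n%:R * x) ^+ 2) <= eps.
  have -> : C / n%:R ^+ 2 * (n%:R * x * (1 - x) + (n%:R * x - n%:R * x) ^+ 2) =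
      C / n%:R * (x * (1 - x)) by field; rewrite gt_eqF.
  have : C / n%:R * (x * (1 - x)) <= C / n%:R.
    by case/andP: x01 => x0 x1; apply: ler_piMr; [exact: divr_ge0 (ltW n0)|nra].
  lra.
pose g k : R := eps / 2 + C / n%:R ^+ 2 * (k%:R - n%:R * x) ^+ 2.
have gE : (bernstein n g).[x] <= eps.
  by rewrite /g bernsteinD bernstein_cst bernsteinZ bernstein_var.
have h1 : (bernstein n (fun k => f (k%:R / n%:R))).[x] <= f x + (bernstein n g).[x].
  rewrite -{1}(bernstein_cst n (f x) x) -bernsteinD.
  by apply: le_bernstein => // k _; have := key k; rewrite /g ler_norml; lra.
have h2 : f x <= (bernstein n (fun k => f (k%:R / n%:R))).[x] + (bernstein n g).[x].
  rewrite -{1}(bernstein_cst n (f x) x) -bernsteinD.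
  by apply: le_bernstein => // k _; have := key k; rewrite /g ler_norml; lra.
by rewrite ler_norml; lra.
Qed.

End weierstrass.

(* [L * asin (sin (x / L)) = x] for [|x| <= L]; the clipping keeps [asin] away
   from the endpoints of its domain. *)
Lemma sin_poly_approx (R : realType) (f : R -> R) (L M eps : R) : continuous f ->
  (forall x, `|f x| <= M) -> 0 < L -> 0 < eps ->
  exists q : {poly R}, forall x,
    `|f x - q.[sin (L^-1 * x)]| <= eps + 2 * M * (L <= `|x|)%R%:R.
Proof.
move=> cf fM L0 e0; pose s1 : R := sin 1.
have s10 : 0 <= s1.
  by have := @sin_ge_half R 1; rewrite ler01 lexx => /(_ isT); rewrite -/s1; lra.
have s11 : s1 < 1.
  have := sin2cos2 (1 : R); have : 0 < cos 1 :> R by exact: cos1_gt0.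
  rewrite -/s1 => c0 sc; rewrite ltNge; apply/negP => h.
  have : 1 <= s1 ^+ 2 by rewrite expr_ge1.
  have : 0 < cos (1 : R) ^+ 2 by rewrite exprn_gt0.
  lra.
(* Clamping to [[- sin 1, sin 1]], the range of [sin (x / L)] for [|x| <= L]; absolute values make
   its continuity immediate. *)
pose clip (s : R) : R := (`|s + s1| - `|s - s1|) / 2.
have clipin s : - s1 <= clip s <= s1.
  have := ler_dist_dist (s + s1) (s - s1).
  have -> : (s + s1) - (s - s1) = 2 * s1 by ring.
  by rewrite (ger0_norm (mulr_ge0 _ s10))// /clip ler_norml; lra.
have cclip : continuous clip.
  move=> s; apply: cvgM; last exact: cvg_cst.
  apply: cvgB; apply: cvg_norm; first by apply: cvgD; [exact: cvg_id|exact: cvg_cst].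
  by apply: cvgB; [exact: cvg_id|exact: cvg_cst].
pose g s := f (L * asin (clip s)).
have cg : continuous (fun v : R => g (2 * v - 1) : R).
  move=> v; apply: continuous_comp; last first.
    rewrite /g; set s := 2 * v - 1.
    apply: (@continuous_comp _ _ _ (fun s => L * asin (clip s)) f); last exact: cf.
    apply: continuousM; first exact: cst_continuous.
    apply: continuous_comp; first exact: cclip.
    by apply: continuous_asin; have := clipin s; lra.
  apply: continuousB; last exact: cst_continuous.
  by apply: continuousM; [exact: cst_continuous|exact: cvg_id].
have [|q hq] := weierstrass_unit cg _ e0; first by exists M => x; exact: fM.
exists (q \Po (2^-1 *: ('X + 1))) => x; set s := sin _.
rewrite horner_comp !hornerE.
have s01 : 0 <= 2^-1 * (s + 1) <= 1.
  by have := sin_le1 (L^-1 * x); have := sin_geN1 (L^-1 * x); rewrite -/s; lra.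
have := hq _ s01; have -> : 2 * (2^-1 * (s + 1)) - 1 = s by lra.
have [xL|Lx] := leP L `|x|.
  have := fM x; have := fM (L * asin (clip s)); rewrite /g !ler_norml mulr1.
  lra.
rewrite mulr0 addr0; suff -> : g s = f x by [].
rewrite /g; suff -> : asin (clip s) = L^-1 * x by rewrite mulVKf// gt_eqF.
have u1 : -1 <= L^-1 * x <= 1.
  by rewrite -ler_norml normrM normfV (gtr0_norm L0) ler_pdivrMl// mulr1 ltW.
have pi1 := @pihalf_ge1 R.
have -> : clip s = s.
  have msin : {in `[- (pi / 2), pi / 2] &, {mono (@sin R) : x y / x <= y}}.
    by apply: le_mono_in => y z yin zin yz; rewrite ltr_sin.
  have : sin (-1) <= s <= s1.
    by rewrite /s /s1 !msin// ?in_itv/=; lra.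
  rewrite sinN -/s1 /clip => h.
  have -> : `|s + s1| = s + s1 by rewrite ger0_norm//; lra.
  have -> : `|s - s1| = s1 - s by rewrite ler0_norm ?opprB//; lra.
  lra.
by rewrite /s sinK// in_itv/=; lra.
Qed.

Section levy.
Context d (T : measurableType d) (R : realType) (P : probability T R).
Context d' (T' : measurableType d') (P' : probability T' R).
Variables (X : nat -> T -> R) (Y : T' -> R).
Hypothesis mX : forall n, measurable_fun setT (X n).
Hypothesis mY : measurable_fun setT Y.
Hypothesis cX : forall t, Ex P (fun w => cos (t * X n w)) @[n --> \oo] -->
  Ex P' (fun w => cos (t * Y w)).
Hypothesis sX : forall t, Ex P (fun w => sin (t * X n w)) @[n --> \oo] -->
  Ex P' (fun w => sin (t * Y w)).

Let mtX t n : measurable_fun setT (fun w => t * X n w).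
Proof. by apply: measurable_funM => //; exact: measurable_cst. Qed.

Let mtY t : measurable_fun setT (fun w => t * Y w).
Proof. by apply: measurable_funM => //; exact: measurable_cst. Qed.

Let bXs s n : bounded_rv (fun w => sin (s * X n w)).
Proof. exact: bounded_rv_sin. Qed.

Let bYs s : bounded_rv (fun w => sin (s * Y w)).
Proof. exact: bounded_rv_sin. Qed.

Let bXp s k n : bounded_rv (fun w => sin (s * X n w) ^+ k).
Proof.
elim: k => [|k IH]; first exact: bounded_rv_cst.
by under eq_fun do rewrite exprS; exact: bounded_rvM.
Qed.

Let bYp s k : bounded_rv (fun w => sin (s * Y w) ^+ k).
Proof.
elim: k => [|k IH]; first exact: bounded_rv_cst.
by under eq_fun do rewrite exprS; exact: bounded_rvM.
Qed.

(** Product-to-sum formulas lower the power of the sine by one and exchange cosine and sine in the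
    last factor, so the two families of limits are proved together, starting from the characteristic
    functions. *)
Let cvg_sin_pow (s : R) k :
  (forall t, Ex P (fun w => sin (s * X n w) ^+ k * cos (t * X n w)) @[n --> \oo] -->
    Ex P' (fun w => sin (s * Y w) ^+ k * cos (t * Y w))) /\
  (forall t, Ex P (fun w => sin (s * X n w) ^+ k * sin (t * X n w)) @[n --> \oo] -->
    Ex P' (fun w => sin (s * Y w) ^+ k * sin (t * Y w))).
Proof.
elim: k => [|k [IHc IHs]].
  split => t.
    under eq_fun do under eq_Ex do rewrite expr0 mul1r.
    by under eq_Ex do rewrite expr0 mul1r; exact: cX.
  under eq_fun do under eq_Ex do rewrite expr0 mul1r.
  by under eq_Ex do rewrite expr0 mul1r; exact: sX.
have bc t n : bounded_rv (fun w => sin (s * X n w) ^+ k * cos (t * X n w)).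
  by apply: bounded_rvM => //; exact: bounded_rv_cos.
have bs t n : bounded_rv (fun w => sin (s * X n w) ^+ k * sin (t * X n w)).
  exact: bounded_rvM.
have bcY t : bounded_rv (fun w => sin (s * Y w) ^+ k * cos (t * Y w)).
  by apply: bounded_rvM => //; exact: bounded_rv_cos.
have bsY t : bounded_rv (fun w => sin (s * Y w) ^+ k * sin (t * Y w)).
  exact: bounded_rvM.
split => t.
  have E (x : R) : sin (s * x) ^+ k.+1 * cos (t * x) =
     2^-1 * (sin (s * x) ^+ k * sin ((s + t) * x) + sin (s * x) ^+ k * sin ((s - t) * x)).
    by rewrite exprS mulrDl mulrBl sinD sinB; field.
  rewrite (_ : (fun n => _) = (fun n => 2^-1 *
     (Ex P (fun w => sin (s * X n w) ^+ k * sin ((s + t) * X n w)) +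
      Ex P (fun w => sin (s * X n w) ^+ k * sin ((s - t) * X n w))))); last first.
    apply/funext => n; rewrite -ExD// -ExZ; last exact: bounded_rvD.
    by apply: eq_Ex => w; exact: E.
  rewrite (_ : Ex P' _ = 2^-1 *
     (Ex P' (fun w => sin (s * Y w) ^+ k * sin ((s + t) * Y w)) +
      Ex P' (fun w => sin (s * Y w) ^+ k * sin ((s - t) * Y w)))); last first.
    rewrite -ExD// -ExZ; last exact: bounded_rvD.
    by apply: eq_Ex => w; exact: E.
  by apply: cvgZr => //; apply: cvgD; exact: IHs.
have E (x : R) : sin (s * x) ^+ k.+1 * sin (t * x) =
   2^-1 * (sin (s * x) ^+ k * cos ((s - t) * x) - sin (s * x) ^+ k * cos ((s + t) * x)).
  by rewrite exprS mulrBl cosB mulrDl cosD; field.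
rewrite (_ : (fun n => _) = (fun n => 2^-1 *
   (Ex P (fun w => sin (s * X n w) ^+ k * cos ((s - t) * X n w)) -
    Ex P (fun w => sin (s * X n w) ^+ k * cos ((s + t) * X n w))))); last first.
  apply/funext => n; rewrite -ExB// -ExZ; last exact: bounded_rvB.
  by apply: eq_Ex => w; exact: E.
rewrite (_ : Ex P' _ = 2^-1 *
   (Ex P' (fun w => sin (s * Y w) ^+ k * cos ((s - t) * Y w)) -
    Ex P' (fun w => sin (s * Y w) ^+ k * cos ((s + t) * Y w)))); last first.
  rewrite -ExB// -ExZ; last exact: bounded_rvB.
  by apply: eq_Ex => w; exact: E.
by apply: cvgZr => //; apply: cvgB; exact: IHc.
Qed.

Let cvg_poly_sin (s : R) (q : {poly R}) :
  Ex P (fun w => q.[sin (s * X n w)]) @[n --> \oo] --> Ex P' (fun w => q.[sin (s * Y w)]).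
Proof.
have -> : (fun n => Ex P (fun w => q.[sin (s * X n w)])) =
  (fun n => \sum_(i < size q) q`_i * Ex P (fun w => sin (s * X n w) ^+ i)).
  apply/funext => n; under eq_Ex do rewrite horner_coef.
  rewrite Ex_sum => [|i]; last exact: bounded_rvZ.
  by apply: eq_bigr => i _; rewrite ExZ.
have -> : Ex P' (fun w => q.[sin (s * Y w)]) =
  \sum_(i < size q) q`_i * Ex P' (fun w => sin (s * Y w) ^+ i).
  under eq_Ex do rewrite horner_coef.
  rewrite Ex_sum => [|i]; last exact: bounded_rvZ.
  by apply: eq_bigr => i _; rewrite ExZ.
apply: cvg_sumr => i; apply: cvgZr => //.
have := (cvg_sin_pow s i).1 0.
under eq_fun do under eq_Ex do rewrite mul0r cos0 mulr1.
by under eq_Ex do rewrite mul0r cos0 mulr1.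
Qed.

(** Up to [eps], and up to [2 M] where [|x| >= L], the test function is a polynomial in
    [sin (x / L)], whose mean converges by [cvg_poly_sin]. The assumption bounds the probability of
    large values through [tightness], for [X n] and, in the limit, for [Y]. *)
Lemma levy_continuity :
  (forall eps : R, 0 < eps -> exists2 delta : R, 0 < delta &
    \forall n \near \oo, forall t, `|t| <= delta ->
      1 - Ex P (fun w => cos (t * X n w)) <= eps) ->
  cvg_in_distribution P X P' Y.
Proof.
move=> tight f cf [M fM].
have M0 : 0 <= M by rewrite (le_trans _ (fM 0)).
have mf : measurable_fun setT f by exact: continuous_measurable_fun.
have bfX n : bounded_rv (fun w => f (X n w)).
  by apply: bounded_rv_comp => //; exists M.
have bfY : bounded_rv (fun w => f (Y w)).
  by apply: bounded_rv_comp => //; exists M.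
rewrite expectationE//; under eq_fun do rewrite expectationE//.
apply: cvg_EFin; first exact: nearW.
have -> : fine \o (fun n => (Ex P (fun w => f (X n w)))%:E) =
  (fun n => Ex P (fun w => f (X n w))) by [].
apply/cvgrPdist_le => e e0.
(* Error budget: [eps + 4 M eps] for replacing [f] under each of the two laws, and [eps] for the
   convergence of the polynomial. *)
pose eps := e / (3 + 8 * M).
have eps0 : 0 < eps by rewrite divr_gt0//; lra.
have epsE : 3 * eps + 8 * M * eps = e by rewrite /eps; field; lra.
have [delta d0 dX] := tight _ eps0.
have dY t : `|t| <= delta -> 1 - Ex P' (fun w => cos (t * Y w)) <= eps.
  move=> td; have cv : 1 - Ex P (fun w => cos (t * X n w)) @[n --> \oo] -->
      1 - Ex P' (fun w => cos (t * Y w)) by apply: cvgB => //; exact: cvg_cst.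
  apply: (cvgr_to_le cv); near=> n; near: n.
  by apply: filterS dX => n; exact.
(* With this [L], the event [|x| >= L] is the event [|delta x| >= 4] of [tightness]. *)
pose L := 4 / delta; have L0 : 0 < L by rewrite divr_gt0.
have [q hq] := sin_poly_approx cf fM L0 eps0.
have approx d1 (T1 : measurableType d1) (Q : probability T1 R) (Z : T1 -> R) :
    measurable_fun setT Z ->
    (forall t, `|t| <= delta -> 1 - Ex Q (fun w => cos (t * Z w)) <= eps) ->
    bounded_rv (fun w => q.[sin (L^-1 * Z w)]) ->
    `|Ex Q (fun w => f (Z w)) - Ex Q (fun w => q.[sin (L^-1 * Z w)])| <= eps + 4 * M * eps.
  move=> mZ hZ bqZ; have bfZ : bounded_rv (fun w => f (Z w)).
    by apply: bounded_rv_comp => //; exists M.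
  have PZ := tightness mZ (ltW d0) hZ.
  set A := [set w | _] in PZ.
  have mA : measurable A.
    rewrite -[A]setTI; apply: measurable_fun_le => //.
    apply: measurableT_comp => //.
    by apply: measurable_funM => //; exact: measurable_cst.
  have bA := bounded_rv_indic R mA.
  rewrite -ExB//; apply: (le_trans (normr_Ex _ _)); first exact: bounded_rvB.
  apply: (@le_trans _ _ (Ex Q (cst eps \+ (fun w => 2 * M * \1_A w)))).
    apply: le_Ex.
    - have [mfg [K hK]] : bounded_rv ((fun w => f (Z w)) \- (fun w => q.[sin (L^-1 * Z w)])).
        exact: bounded_rvB.
      by split; [exact: measurableT_comp|exists K => w; rewrite normr_id].
    - by apply: bounded_rvD; [exact: bounded_rv_cst|exact: bounded_rvZ].
    move=> w /=; apply: le_trans (hq _) _; rewrite lerD2l ler_wpM2l ?mulr_ge0//.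
    rewrite indicE ler_nat; case: (leP L) => //= LZ.
    suff -> : w \in A by [].
    by rewrite inE /A/= normrM (gtr0_norm d0) mulrC -ler_pdivrMr.
  rewrite ExD; [|exact: bounded_rv_cst|exact: bounded_rvZ].
  rewrite Ex_cst ExZ// Ex_indic// lerD2l.
  have -> : 4 * M * eps = 2 * M * (2 * eps) by ring.
  by rewrite ler_wpM2l ?mulr_ge0.
have bqX n : bounded_rv (fun w => q.[sin (L^-1 * X n w)]).
  by under eq_fun do rewrite horner_coef; apply: bounded_rv_sum => i; exact: bounded_rvZ.
have bqY : bounded_rv (fun w => q.[sin (L^-1 * Y w)]).
  by under eq_fun do rewrite horner_coef; apply: bounded_rv_sum => i; exact: bounded_rvZ.
have aY := approx _ _ _ _ mY dY bqY.
have /cvgrPdist_le/(_ _ eps0) hq2 := @cvg_poly_sin L^-1 q.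
near=> n.
have aX : `|Ex P (fun w => f (X n w)) - Ex P (fun w => q.[sin (L^-1 * X n w)])| <=
    eps + 4 * M * eps.
  by apply: approx => //; near: n.
have cn : `|Ex P' (fun w => q.[sin (L^-1 * Y w)]) -
    Ex P (fun w => q.[sin (L^-1 * X n w)])| <= eps by near: n.
move: aX aY cn; rewrite !ler_norml; lra.
Unshelve. all: by end_near. Qed.

End levy.

(** * Characteristic functions in a domain of attraction *)

Lemma realC1 (R : realType) : (1 : R)%:C%C = 1 :> R[i].
Proof. by []. Qed.

Section powers.
Context {R : realType}.
Implicit Types x t alpha : R.

Lemma continuous_fun_comp (f g : R -> R) :
  continuous f -> continuous g -> continuous (fun x => g (f x)).
Proof. by move=> cf cg x; apply: continuous_comp; [exact: cf|exact: cg]. Qed.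

Lemma continuous_norm_powR alpha : 0 < alpha -> continuous (fun t : R => `|t| `^ alpha).
Proof.
move=> a0 t; have [->|t0] := eqVneq t 0; last first.
  apply: (@continuous_comp _ _ _ (fun t : R => `|t|) (fun x => x `^ alpha)).
    exact: norm_continuous.
  apply: differentiable_continuous; apply/derivable1_diffP.
  by apply: derivable_powR; rewrite in_itv/= normr_gt0 t0.
apply/cvgrPdist_le => e e0; exists (e `^ alpha^-1) => /=; first by rewrite powR_gt0.
move=> s /=; rewrite sub0r normrN normr0 powR0 ?gt_eqF// sub0r normrN => se.
rewrite ger0_norm ?powR_ge0//.
have -> : e = (e `^ alpha^-1) `^ alpha by rewrite -powRrM mulVf ?gt_eqF// powRr1// ltW.
by rewrite ge0_ler_powR ?nnegrE ?powR_ge0// ltW.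
Qed.

Lemma expRN_bounds x : 0 <= x -> 0 <= x - (1 - expR (- x)) <= x ^+ 2.
Proof.
move=> x0; have h1 := expR_ge1Dx (- x); have h2 := expR_ge1Dx x.
have xp : 0 < 1 + x by lra.
have h3 : expR (- x) <= (1 + x)^-1.
  by rewrite expRN lef_pV2// posrE// (lt_le_trans xp).
have h4 : (1 + x)^-1 <= 1 - x + x ^+ 2.
  rewrite -[X in X <= _]mul1r ler_pdivrMr//.
  have -> : (1 - x + x ^+ 2) * (1 + x) = 1 + x ^+ 3 by ring.
  by rewrite lerDl exprn_ge0.
lra.
Qed.

(* Compare n-th powers: [n |z - y|] is controlled by [|z^n - y^n|], provided it is
   already known to be small. *)
Lemma normc_expB_ge (z : R[i]) (y m : R) n : 0 < m -> m <= y -> y <= 1 -> m <= y ^+ n ->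
  n%:R * normc (z - y%:C%C) <= m / 4 ->
  n%:R * normc (z - y%:C%C) <= 2 / m * normc (z ^+ n - (y%:C%C) ^+ n).
Proof.
move=> m0 my y1 myn small; have y0 : 0 < y by exact: lt_le_trans my.
have yC0 : y%:C%C != 0 :> R[i] by rewrite eq_complex/= gt_eqF.
pose u := (z - y%:C%C) / y%:C%C.
have zE : z = y%:C%C * (1 + u) by rewrite /u mulrDr mulr1 mulrCA divff// mulr1 addrC subrK.
have nu : normc u = normc (z - y%:C%C) / y.
  by rewrite /u Normc.normcM Normc.normcV normcR gtr0_norm.
have nu4 : n%:R * normc u <= 4^-1.
  rewrite nu mulrA ler_pdivrMr// (le_trans small)//.
  by rewrite mulrC ler_pM2l// invr_gt0.
(* As [n |u| <= 1/4], the powers [(1 + u)^i] stay within 1/2 of 1 up to [i = n]; their sum, a factor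
   of the difference of n-th powers, is thus at least [n / 2] in modulus. *)
have pow_le i : (i <= n)%N -> normc ((1 + u) ^+ i - 1) <= 2 * (i%:R * normc u).
  elim: i => [|i IH] i_n; first by rewrite expr0 subrr Normc.normc0 mul0r mulr0.
  have {}IH := IH (ltnW i_n).
  have -> : (1 + u) ^+ i.+1 - 1 = ((1 + u) ^+ i - 1) + u * (1 + ((1 + u) ^+ i - 1)).
    by rewrite exprS; ring.
  have inu : i%:R * normc u <= 4^-1.
    by rewrite (le_trans _ nu4)// ler_wpM2r ?normc_ge0// ler_nat ltnW.
  rewrite (le_trans (le_normcD _ _))// Normc.normcM.
  have h1 : normc (1 + ((1 + u) ^+ i - 1)) <= 2.
    rewrite (le_trans (le_normcD _ _))// Normc.normc1; lra.
  have : normc u * normc (1 + ((1 + u) ^+ i - 1)) <= normc u * 2.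
    by rewrite ler_wpM2l ?normc_ge0.
  by rewrite -natr1; lra.
have E : z ^+ n - y%:C%C ^+ n = (y ^+ n)%:C%C * (u * \sum_(i < n) (1 + u) ^+ i).
  rewrite {1}zE exprMn rmorphXn/= -{2}[y%:C%C ^+ n]mulr1 -mulrBr; congr (_ * _).
  by rewrite subrX1 [1 + u]addrC addrK.
have S : n%:R / 2 <= normc (\sum_(i < n) (1 + u) ^+ i).
  have -> : \sum_(i < n) (1 + u) ^+ i = n%:R%:C%C - (\sum_(i < n) (1 - (1 + u) ^+ i)).
    by rewrite sumrB sumr_const card_ord rmorph_nat subKr.
  have h : normc (\sum_(i < n) (1 - (1 + u) ^+ i)) <= n%:R / 2.
    rewrite (le_trans (le_normc_sum _ _ _))//.
    rewrite (le_trans (ler_sum _ (G := fun=> 2^-1) _))//.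
      move=> i _; rewrite normcC (le_trans (pow_le _ (ltnW (ltn_ord i))))//.
      have : i%:R * normc u <= 4^-1.
        by rewrite (le_trans _ nu4)// ler_wpM2r ?normc_ge0// ler_nat ltnW.
      lra.
    by rewrite sumr_const card_ord -[leLHS]mulr_natl.
  have := le_normcD (n%:R%:C%C - \sum_(i < n) (1 - (1 + u) ^+ i)) (\sum_(i < n) (1 - (1 + u) ^+ i)).
  by rewrite subrK normcR ger0_norm//; lra.
rewrite E 2!Normc.normcM normcR (ger0_norm (exprn_ge0 n (ltW y0))).
rewrite -ler_pdivrMl ?divr_gt0// invf_div mulrCA.
have h1 : normc (z - y%:C%C) <= normc u.
  by rewrite nu ler_pdivlMr// ler_piMr// normc_ge0.
have h2 : normc (z - y%:C%C) * (n%:R / 2) <= normc u * normc (\sum_(i < n) (1 + u) ^+ i).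
  by apply: ler_pM => //; rewrite ?normc_ge0// divr_ge0.
have h3 := ler_pM (ltW m0) (mulr_ge0 (normc_ge0 _) (divr_ge0 (ler0n _ n) (ler0n _ 2))) myn h2.
by apply: le_trans h3; rewrite le_eqVlt; apply/orP; left; apply/eqP; ring.
Qed.

End powers.

Lemma powR_exprn {R : realType} (b x : R) j : 0 <= b -> (b `^ x) ^+ j = (b ^+ j) `^ x.
Proof.
move=> b0; elim: j => [|j IH]; first by rewrite !expr0 powR1.
by rewrite !exprS powRM ?exprn_ge0// IH.
Qed.

Lemma dyadic {R : realType} (x : R) : 1 <= x ->
  exists j v, [/\ x = 2 ^+ j * v, 1 <= v & v < 2].
Proof.
move=> x1; have ex : exists j, x < 2 ^+ j.+1.
  exists (Num.bound x); rewrite (le_lt_trans (ler_boundS x))// -natrX ltr_nat.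
  exact: ltn_expl.
case: (ex_minnP ex) => j xj jmin; have j0 : 0 < 2 ^+ j :> R by rewrite exprn_gt0.
exists j, (x / 2 ^+ j); split; first by rewrite mulrCA mulfV ?mulr1// gt_eqF.
  rewrite ler_pdivlMr// mul1r; case: j xj jmin j0 => [//|j] xj jmin j0.
  by rewrite leNgt; apply/negP => /jmin; rewrite ltnn.
by rewrite ltr_pdivrMr// -exprS.
Qed.

(** * Behaviour of 1 - phi at 0: root extraction and Potter bound *)

Section char_asymptotics.
Context {R : realType}.
Variables (phi : R -> R[i]) (a : nat -> R) (alpha : R).
Hypothesis alpha0 : 0 < alpha.
Hypothesis phi0 : phi 0 = 1.
Hypothesis phi_le1 : forall t, normc (phi t) <= 1.
Hypothesis phiN : forall t, normc (1 - phi (- t)) = normc (1 - phi t).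
Hypothesis phi_cont : forall t e : R, 0 < e ->
  exists2 delta : R, 0 < delta & forall s, `|s - t| < delta -> normc (phi s - phi t) <= e.
Hypothesis a0 : forall n, (1 <= n)%N -> 0 < a n.
Hypothesis phi_pow : forall M e : R, 0 < e -> \forall n \near \oo, forall t, `|t| <= M ->
  normc (phi (t / a n) ^+ n - (expR (- (`|t| `^ alpha)))%:C%C) <= e.

Let root_continuous n t : (0 < n)%N -> continuous (fun s : R =>
  n%:R * normc (phi (s * t / a n) - (expR (- (`|s * t| `^ alpha / n%:R)))%:C%C) : R).
Proof.
move=> n0 s; apply: cvgM; first exact: cvg_cst.
have cE : continuous (fun s : R => expR (- (`|s * t| `^ alpha / n%:R)) : R).
  apply: (@continuous_fun_comp _ (fun s => - (`|s * t| `^ alpha / n%:R)) expR).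
    move=> r; apply: cvgN; apply: cvgM; last exact: cvg_cst.
    apply: (@continuous_fun_comp _ (fun s => s * t) (fun t : R => `|t| `^ alpha)).
      by move=> q; apply: cvgM; [exact: cvg_id|exact: cvg_cst].
    exact: continuous_norm_powR.
  exact: continuous_expR.
apply/cvgrPdist_le => e e0; have e20 : 0 < e / 2 by rewrite divr_gt0.
have /cvgrPdist_le/(_ _ e20) [d1 /= d10 h1] := cE s.
have [d2 d20 h2] := phi_cont (s * t / a n) e20.
have an := a0 n0.
exists (Num.min d1 (d2 / ((`|t| + 1) / a n))) => /=.
  by rewrite lt_min d10 divr_gt0// divr_gt0// ltr_wpDl.
move=> r /=; rewrite lt_min => /andP[r1 r2].
have dist (x y : R[i]) : `|normc x - normc y| <= normc (x - y).
  have := le_normcD (x - y) y; rewrite subrK.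
  by have := le_normcD (y - x) x; rewrite subrK (normcC y) ler_norml; lra.
apply: le_trans (dist _ _) _.
have -> : forall p q x y : R[i], p - x - (q - y) = (p - q) - (x - y) by move=> *; ring.
apply: le_trans (le_normcB _ _) _; rewrite -rmorphB normcR.
have H1 := h1 r r1; have H2 : normc (phi (s * t / a n) - phi (r * t / a n)) <= e / 2.
  rewrite normcC; apply: h2; rewrite -!mulrA -mulrBl normrM -(opprB s) normrN.
  move: r2; rewrite ltr_pdivlMr ?divr_gt0 ?ltr_wpDl//; apply: le_lt_trans.
  rewrite ler_wpM2l// normrM (gtr0_norm (_ : 0 < (a n)^-1)) ?invr_gt0//.
  by rewrite ler_pM2r ?invr_gt0// lerDl.
by move: H1 => /=; lra.
Qed.

(** Closeness of n-th powers leaves the choice of the root open. Along [s t] with [s] in [[0, 1]],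
    the quantity [x s] is continuous, vanishes at 0 and, by [normc_expB_ge], is at most [m / 8]
    whenever it is at most [m / 4]; by the intermediate value theorem it cannot pass [m / 4]. *)
Lemma phi_root (M e : R) : 0 < e -> \forall n \near \oo, forall t, `|t| <= M ->
  n%:R * normc (phi (t / a n) - (expR (- (`|t| `^ alpha / n%:R)))%:C%C) <= e.
Proof.
move=> e0; have := expR_gt0 (- (`|M| `^ alpha)); set m := expR _ => m0.
(* The two requirements make [2 z / m] at most [e], the target, and at most [m / 8], the gap that
   excludes the value [m / 4]. *)
have [z z0 [z1 z2]] : exists2 z, 0 < z & z <= m * e / 2 /\ z <= m ^+ 2 / 16.
  exists (Num.min (m * e / 2) (m ^+ 2 / 16)).
    by rewrite lt_min !divr_gt0 ?mulr_gt0 ?exprn_gt0.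
  by rewrite !ge_min !lexx orbT.
have m0' := ltW m0.
near=> n => t tM.
have n0 : (0 < n)%N by near: n; exact: nbhs_infty_gt.
have n1 : 1 <= n%:R :> R by rewrite ler1n.
have hz s : `|s| <= M -> normc (phi (s / a n) ^+ n - (expR (- (`|s| `^ alpha)))%:C%C) <= z.
  by move: s; near: n; exact: phi_pow.
pose x s := n%:R * normc (phi (s * t / a n) - (expR (- (`|s * t| `^ alpha / n%:R)))%:C%C).
have key s : 0 <= s <= 1 -> x s <= m / 4 -> x s <= 2 / m * z.
  move=> /andP[s0 s1] xm; have stM : `|s * t| <= M.
    by rewrite normrM (ger0_norm s0) (le_trans _ tM)// ler_piMl.
  have stp : `|s * t| `^ alpha <= `|M| `^ alpha.
    by rewrite ge0_ler_powR ?nnegrE ?(ltW alpha0)// (le_trans stM)// ler_norm.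
  have yn : expR (- (`|s * t| `^ alpha / n%:R)) ^+ n = expR (- (`|s * t| `^ alpha)).
    by rewrite -expRM_natl mulrN mulrCA mulfV ?mulr1// gt_eqF// ltr0n.
  apply: le_trans (normc_expB_ge m0 _ _ _ xm) _.
  - rewrite ler_expR lerN2 (le_trans _ stp)// ler_pdivrMr ?ltr0n//.
    by rewrite ler_peMr// powR_ge0.
  - by rewrite -expR0 ler_expR oppr_le0 divr_ge0 ?powR_ge0.
  - by rewrite yn ler_expR lerN2.
  rewrite ler_wpM2l ?divr_ge0 ?(ltW m0)// -rmorphXn/= yn; exact: hz.
have xE : x 1 = n%:R * normc (phi (t / a n) - (expR (- (`|t| `^ alpha / n%:R)))%:C%C).
  by rewrite /x mul1r.
have cx : {within `[0, 1], continuous x}.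
  by apply: continuous_subspaceT; exact: root_continuous.
have x0 : x 0 = 0.
  rewrite /x mul0r mul0r phi0 normr0 powR0; last by rewrite gt_eqF.
  by rewrite mul0r oppr0 expR0 realC1 subrr Normc.normc0 mulr0.
rewrite -xE; clearbody x; clear hz xE.
have zm : 2 / m * z <= m / 8.
  have -> : m / 8 = 2 / m * (m ^+ 2 / 16) by field; rewrite gt_eqF.
  by rewrite ler_wpM2l ?divr_ge0.
have ze : 2 / m * z <= e.
  have -> : e = 2 / m * (m * e / 2) by field; rewrite gt_eqF.
  by rewrite ler_wpM2l ?divr_ge0.
have [xm|mx] := leP (x 1) (m / 4).
  by apply: le_trans ze; apply: key => //; rewrite ler01 lexx.
have [|c] := IVT ler01 cx (v := m / 4).
  by rewrite x0 ge_min le_max (ltW mx) orbT andbT divr_ge0.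
rewrite in_itv/= => c01 xc; have := key c c01; rewrite xc lexx => /(_ isT).
by move: zm; move: (2 / m * z) => q; lra.
Unshelve. all: by end_near. Qed.

Definition chi s := normc (1 - phi s).

Lemma chi_asymp (M e : R) : 0 < e -> \forall n \near \oo, forall t, `|t| <= M ->
  `|n%:R * chi (t / a n) - `|t| `^ alpha| <= e.
Proof.
move=> e0; have e20 : 0 < e / 2 by rewrite divr_gt0.
pose B := `|M| `^ alpha.
near=> n => t tM.
have n0 : (0 < n)%N by near: n; exact: nbhs_infty_gt.
have n0' : 0 < n%:R :> R by rewrite ltr0n.
have nB : B ^+ 2 * 2 / e <= n%:R.
  rewrite (le_trans (ler_boundS _))// ler_nat; near: n.
  exact: nbhs_infty_ge.
have h : n%:R * normc (phi (t / a n) - (expR (- (`|t| `^ alpha / n%:R)))%:C%C) <= e / 2.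
  by move: t tM; near: n; exact: phi_root.
have tB : `|t| `^ alpha <= B.
  by rewrite ge0_ler_powR ?nnegrE ?(ltW alpha0)// (le_trans tM)// ler_norm.
set u := `|t| `^ alpha in tB h *; have u0 : 0 <= u by exact: powR_ge0.
set y := expR _ in h.
have /andP[b1 b2] := expRN_bounds (divr_ge0 u0 (ltW n0')); rewrite -/y in b1 b2.
have B2 : n%:R * (u / n%:R) ^+ 2 <= e / 2.
  have -> : n%:R * (u / n%:R) ^+ 2 = u ^+ 2 / n%:R by field; rewrite gt_eqF.
  rewrite ler_pdivrMr//; move: nB; rewrite ler_pdivrMr// => nB.
  have : u ^+ 2 <= B ^+ 2 by rewrite ler_pXn2r ?nnegrE// (le_trans u0).
  lra.
have y1 : 0 <= 1 - y.
  by rewrite subr_ge0 -expR0 ler_expR oppr_le0 divr_ge0//; exact: ltW.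
have c1 : chi (t / a n) <= normc (phi (t / a n) - y%:C%C) + (1 - y).
  have -> : chi (t / a n) = normc ((y%:C%C - phi (t / a n)) + (1 - y)%:C%C).
    by rewrite rmorphB rmorph1 /chi; congr normc; ring.
  by rewrite (le_trans (le_normcD _ _))// normcR ger0_norm// normcC.
have c2 : 1 - y <= chi (t / a n) + normc (phi (t / a n) - y%:C%C).
  have -> : 1 - y = normc (1 - y)%:C%C by rewrite normcR ger0_norm.
  have -> : (1 - y)%:C%C = (1 - phi (t / a n)) + (phi (t / a n) - y%:C%C).
    by rewrite rmorphB rmorph1; ring.
  exact: le_normcD.
have nu : n%:R * (u / n%:R) = u by rewrite mulrCA divff ?mulr1// gt_eqF.
have k1 := ler_wpM2l (ltW n0') c1; have k2 := ler_wpM2l (ltW n0') c2.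
have k3 := ler_wpM2l (ltW n0') b1; have k4 := ler_wpM2l (ltW n0') b2.
move: k1 k2 k3 k4; rewrite !mulrDr !mulrN !mulr1 mulr0 nu ler_norml => k1 k2 k3 k4.
lra.
Unshelve. all: by end_near. Qed.

Let chi_ge0 s : 0 <= chi s. Proof. exact: normc_ge0. Qed.

Let chi_le2 s : chi s <= 2.
Proof.
rewrite /chi (le_trans (le_normcB _ _))// Normc.normc1.
by have := phi_le1 s; lra.
Qed.

(** At a fixed [s] with [chi s > 0], an index with [a n < K] would give [n chi s <= |s K|^alpha + 1]
    by [chi_asymp] at [t = s a_n], which fails for large [n]. *)
Let a_infty K : \forall n \near \oo, K <= a n.
Proof.
have [n1 n1_gt0 c1] : exists2 n1, (0 < n1)%N & 0 < chi (1 / a n1).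
  have h := @chi_asymp 1 2^-1 ltac:(lra).
  near \oo => n; exists n; first by near: n; exact: nbhs_infty_gt.
  have /(_ 1) : forall t : R, `|t| <= 1 -> `|n%:R * chi (t / a n) - `|t| `^ alpha| <= 2^-1.
    by near: n.
  rewrite normr1 lexx powR1 => /(_ isT); rewrite ler_norml => /andP[h1 _].
  by rewrite -(pmulr_rgt0 _ (_ : 0 < n%:R)) ?ltr0n; [lra|near: n; exact: nbhs_infty_gt].
set s := 1 / a n1 in c1 *; have s0 : 0 < s by rewrite divr_gt0// a0.
near=> n; rewrite leNgt; apply/negP => anK.
have n0 : (0 < n)%N by near: n; exact: nbhs_infty_gt.
have an := a0 n0.
have h : `|n%:R * chi (s * a n / a n) - `|s * a n| `^ alpha| <= 1.
  have : `|s * a n| <= s * `|K|.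
    rewrite normrM (gtr0_norm s0) (gtr0_norm an) ler_wpM2l ?(ltW s0)//.
    by rewrite (le_trans (ltW anK))// ler_norm.
  by move: (s * a n); near: n; exact: chi_asymp.
have sK : `|s * a n| `^ alpha <= `|s * K| `^ alpha.
  rewrite ge0_ler_powR ?nnegrE ?(ltW alpha0)//.
  by rewrite !normrM ler_wpM2l// (gtr0_norm an) (le_trans (ltW anK))// ler_norm.
have : n%:R * chi s <= `|s * K| `^ alpha + 1.
  by move: h; rewrite mulfK ?gt_eqF// ler_norml; lra.
apply/negP; rewrite -ltNge -ltr_pdivrMr//.
apply: lt_le_trans (_ : (Num.bound ((`|s * K| `^ alpha + 1) / chi s)).+2%:R <= _).
  by rewrite (le_lt_trans (ler_boundS _))// ltr_nat.
by rewrite ler_nat; near: n; exact: nbhs_infty_ge.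
Unshelve. all: by end_near. Qed.

(** Were [a n.+1 > 2 a n], then [chi (1 / a n.+1)] would be about [1 / (n + 1)] by the asymptotics
    at [n + 1], but at most about [2^(- alpha) / n] by those at [n]. *)
Let a_double : \forall n \near \oo, a n.+1 <= 2 * a n.
Proof.
pose th : R := 2^-1 `^ alpha.
have th1 : th < 1.
  have : th < 1 `^ alpha by rewrite gt0_ltr_powR// ?nnegrE//; lra.
  by rewrite powR1.
have th0 : 0 <= th by exact: powR_ge0.
pose e := (1 - th) / 4; have e0 : 0 < e by rewrite /e; lra.
near=> n; rewrite leNgt; apply/negP => an2.
have n0 : (0 < n)%N by near: n; exact: nbhs_infty_gt.
have an := a0 n0; have anS := a0 (ltn0Sn n).
have hh : forall t : R, `|t| <= 1 -> `|n%:R * chi (t / a n) - `|t| `^ alpha| <= e.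
  by near: n; exact: chi_asymp.
have hS : forall t : R, `|t| <= 1 -> `|n.+1%:R * chi (t / a n.+1) - `|t| `^ alpha| <= e.
  near: n; have := @chi_asymp 1 e e0; move=> [N _ hN]; exists N => // n /= Nn.
  by apply: hN; rewrite /= leqW.
have := hS 1; rewrite normr1 lexx powR1 => /(_ isT).
have t1 : `|a n / a n.+1| <= 2^-1.
  by rewrite gtr0_norm ?divr_gt0// ler_pdivrMr//; lra.
have t1' : `|a n / a n.+1| <= 1 by lra.
have := hh _ t1'; have -> : a n / a n.+1 / a n = 1 / a n.+1.
  by field; rewrite !gt_eqF.
have : `|a n / a n.+1| `^ alpha <= th.
  by rewrite ge0_ler_powR ?nnegrE ?(ltW alpha0).
set c := chi _; set u := _ `^ alpha => uth.
have c0 : 0 <= c by exact: chi_ge0.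
have nE : n.+1%:R = n%:R + 1 :> R by rewrite -natr1.
have ne : 1 / e <= n%:R.
  rewrite (le_trans (ler_boundS _))// ler_nat; near: n; exact: nbhs_infty_ge.
rewrite nE !ler_norml => /andP[_ h1] /andP[h2 _].
have cth : n%:R * c <= th + e by lra.
have thE : th = 1 - 4 * e by rewrite /e; lra.
have ce : c <= e.
  rewrite -(@ler_pM2l _ n%:R) ?ltr0n// (le_trans cth)//.
  by move: ne; rewrite ler_pdivrMr// => ne; lra.
lra.
Unshelve. all: by end_near. Qed.

Variable beta : R.
Hypothesis alpha_beta : alpha < beta.

(** When [s a_m] lies in [[1, 2)], [m chi s] is about [(s a_m)^alpha] and [m chi (2 s)] about
    [2^alpha] times that, so any [beta > alpha] absorbs the errors. The last clause serves to bound
    [n] from above in [chi_bound]. *)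
Let chi_doubling : exists s0 c0 : R, [/\ 0 < s0, 0 < c0,
  forall s, 0 < s <= s0 -> chi (2 * s) <= 2 `^ beta * chi s &
  forall s, s0 / 2 <= s <= s0 -> c0 <= chi s].
Proof.
pose A : R := 2 `^ alpha; pose B : R := 2 `^ beta.
have A0 : 0 < A by exact: powR_gt0.
have AB : A < B.
  rewrite /A /B -[beta](subrK alpha) addrC powRD ?pnatr_eq0 ?implybT//.
  rewrite ltr_pMr// -[ltLHS](powRr0 2) /powR pnatr_eq0/= ltr_expR ltr_pM2r ?subr_gt0//.
  by rewrite ln_gt0// ltr1n.
(* The relative error that turns the factor [A] into [B]: the solution of
   [A (1 + e) = B (1 - e)]. *)
pose e := (B - A) / (B + A).
have e0 : 0 < e by rewrite divr_gt0; lra.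
have e1 : e < 1 by rewrite ltr_pdivrMr; lra.
have eE : A * (1 + e) = B * (1 - e) by rewrite /e; field; lra.
have [n1 n1_gt0 hn1] : exists2 n1, (0 < n1)%N & forall n, (n1 <= n)%N ->
    a n.+1 <= 2 * a n /\ forall t : R, `|t| <= 4 -> `|n%:R * chi (t / a n) - `|t| `^ alpha| <= e.
  have [N1 _ h1] := a_double; have [N2 _ h2] := @chi_asymp 4 e e0.
  exists (maxn N1 N2).+1 => // n /ltnW; rewrite geq_max => /andP[n1 n2].
  by split; [exact: h1|exact: h2].
have an1 := a0 n1_gt0.
pose s0 := (2 * a n1)^-1; have s00 : 0 < s0 by rewrite invr_gt0 mulr_gt0.
have [m0 m0n1 m0s] : exists2 m0, (n1 <= m0)%N & 2 / s0 <= a m0.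
  near \oo => n; exists n; near: n; [exact: nbhs_infty_ge|exact: a_infty].
(* [m] is the first index with [s a_m >= 1]; minimality and [a_(m+1) <= 2 a_m] give
   [s a_m < 2], so both [s] and [2 s] are in the range of [chi_asymp] at [m]. *)
have scale s : 0 < s <= s0 -> exists m, [/\ (n1 <= m)%N,
    forall m', (n1 <= m')%N -> 1 <= s * a m' -> (m <= m')%N & 1 <= s * a m < 2].
  move=> /andP[sp ss0].
  have ex : exists m, (n1 <= m)%N && (1 <= s * a m).
    near \oo => n; exists n; apply/andP; split; near: n; first exact: nbhs_infty_ge.
    apply: filterS (a_infty s^-1) => n.
    by move=> h; rewrite -(mulfV (lt0r_neq0 sp)) ler_pM2l.
  case: (ex_minnP ex) => m /andP[n1m sam] mmin.
  exists m; split => //; first by move=> m' h1 h2; apply: mmin; rewrite h1.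
  rewrite sam/=.
  have mn1 : (n1 < m)%N.
    rewrite ltn_neqAle n1m andbT; apply/eqP => mE; move: sam; rewrite -mE.
    apply/negP; rewrite -ltNge.
    have : s * a n1 <= s0 * a n1 by rewrite ler_wpM2r// ltW.
    have -> : s0 * a n1 = 2^-1 by rewrite /s0; field; rewrite gt_eqF.
    lra.
  have mE : m = m.-1.+1 by rewrite prednK// (leq_ltn_trans _ mn1).
  have n1m1 : (n1 <= m.-1)%N by rewrite -ltnS -mE.
  have [am _] := hn1 _ n1m1.
  have sam1 : s * a m.-1 < 1.
    rewrite ltNge; apply/negP => h; have := mmin m.-1; rewrite n1m1 h => /(_ isT).
    by rewrite {1}mE ltnn.
  rewrite mE; have := ler_wpM2l (ltW sp) am; lra.
have pow1 u : 1 <= u -> 1 <= u `^ alpha.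
  move=> u1; have : 1 `^ alpha <= u `^ alpha by rewrite ge0_ler_powR ?nnegrE ?(ltW alpha0)//; lra.
  by rewrite powR1.
have low s m : (n1 <= m)%N -> 1 <= s * a m < 2 ->
    (s * a m) `^ alpha * (1 - e) <= m%:R * chi s.
  move=> n1m /andP[u1 u2]; have [_ /(_ (s * a m))] := hn1 _ n1m.
  have am : 0 < a m by apply: a0; exact: leq_trans n1_gt0 n1m.
  rewrite mulfK ?gt_eqF// ger0_norm; last by lra.
  move=> /(_ ltac:(lra)); rewrite ler_norml => /andP[h _].
  have : e <= (s * a m) `^ alpha * e by rewrite ler_peMl ?(ltW e0)// pow1.
  lra.
exists s0, ((1 - e) / m0%:R); split => //.
- apply: divr_gt0; first by lra.
  by rewrite ltr0n; exact: leq_trans n1_gt0 m0n1.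
- move=> s ss0; have [m [n1m _ sam]] := scale s ss0.
  have lo := low _ _ n1m sam; have [_ /(_ (2 * s * a m))] := hn1 _ n1m.
  have am : 0 < a m by apply: a0; exact: leq_trans n1_gt0 n1m.
  have m0' : 0 < m%:R :> R by rewrite ltr0n; exact: leq_trans n1_gt0 n1m.
  rewrite mulfK ?gt_eqF// -mulrA ger0_norm; last by lra.
  move=> /(_ ltac:(lra)); rewrite ler_norml => /andP[_ h].
  case/andP: sam => u1 u2.
  have hi : m%:R * chi (2 * s) <= A * (s * a m) `^ alpha * (1 + e).
    have -> : A * (s * a m) `^ alpha = (2 * (s * a m)) `^ alpha.
      by rewrite [RHS]powRM//; lra.
    have : e <= (2 * (s * a m)) `^ alpha * e.
      by rewrite ler_peMl ?(ltW e0)// pow1//; lra.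
    lra.
  rewrite -(ler_pM2l m0') (le_trans hi)// mulrAC eE mulrCA -mulrA.
  rewrite ler_pM2l; first by rewrite mulrC.
  by rewrite (lt_trans A0).
- move=> s /andP[s1 s2].
  have sp : 0 < s by apply: lt_le_trans s1; rewrite divr_gt0.
  have [|m [n1m mmin sam]] := scale s; first by rewrite sp.
  have mm0 : (m <= m0)%N.
    apply: mmin => //; apply: le_trans (ler_wpM2l (ltW sp) m0s).
    by rewrite mulrA ler_pdivlMr// mul1r; lra.
  have m0' : 0 < m%:R :> R by rewrite ltr0n; exact: leq_trans n1_gt0 n1m.
  have lo := low _ _ n1m sam.
  rewrite ler_pdivrMr ?ltr0n//; last exact: leq_trans n1_gt0 m0n1.
  case/andP: sam => u1 u2.
  have h1 : 1 - e <= (s * a m) `^ alpha * (1 - e) by rewrite ler_peMl ?pow1//; lra.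
  rewrite (le_trans h1)// (le_trans lo)// mulrC ler_wpM2l ?ler_nat//.
Unshelve. all: by end_near. Qed.

Lemma chi_bound : exists2 C : R, 0 <= C & \forall n \near \oo, forall x,
  n%:R * chi (x / a n) <= C * (1 + `|x| `^ beta).
Proof.
have [s0 [c0 [s00 c00 dbl low]]] := chi_doubling.
pose B : R := 2 `^ beta; have B0 : 0 < B by exact: powR_gt0.
have beta0 : 0 < beta by exact: lt_trans alpha_beta.
have B1 : 1 <= B.
  have : 2 `^ 0 <= B :> R by rewrite ler_powR ?ler1n//; exact: ltW.
  by rewrite powRr0.
have Bpow j : B ^+ j = (2 ^+ j) `^ beta.
  exact: powR_exprn.
rewrite -/B in dbl; clearbody B.
have iter s j : 0 < s -> 2 ^+ j * s <= 2 * s0 -> chi (2 ^+ j * s) <= B ^+ j * chi s.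
  move=> sp; elim: j => [|j IH]; first by rewrite !expr0 !mul1r.
  rewrite !exprS -!mulrA ler_pM2l// => js0.
  rewrite (le_trans (dbl _ _)) ?mulr_gt0 ?exprn_gt0//= ler_pM2l//.
  by apply: IH; lra.
pose C1 : R := 2 `^ alpha + 1; have C10 : 0 < C1 by rewrite ltr_wpDl ?powR_ge0.
have C2 : 0 <= C1 * (1 + 2 / c0).
  by rewrite mulr_ge0 ?(ltW C10)// addr_ge0// divr_ge0// ltW.
exists (C1 * (1 + 2 / c0)) => //; near=> n => x.
have n0 : (0 < n)%N by near: n; exact: nbhs_infty_gt.
have n0' : 0 < n%:R :> R by rewrite ltr0n.
have an := a0 n0.
have hC1 t : `|t| <= 2 -> n%:R * chi (t / a n) <= C1.
  move=> t2; have : `|n%:R * chi (t / a n) - `|t| `^ alpha| <= 1.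
    by move: t t2; near: n; exact: chi_asymp.
  have : `|t| `^ alpha <= 2 `^ alpha by rewrite ge0_ler_powR ?nnegrE ?(ltW alpha0).
  by rewrite ler_norml /C1; lra.
have a2 : 2 / s0 <= a n by near: n; exact: a_infty.
wlog x0 : x / 0 <= x => [h|].
  have [/h//|/ltW x0] := leP 0 x.
  by have := h (- x); rewrite oppr_ge0 normrN mulNr /chi phiN; exact.
have xb : 0 <= `|x| `^ beta by exact: powR_ge0.
have [x1|x1] := leP x 1.
  rewrite (le_trans (hC1 _ _))//; first by rewrite ger0_norm//; lra.
  rewrite -mulrA ler_peMr ?(ltW C10)//.
  have h1 : 0 <= 2 / c0 by rewrite divr_ge0// ltW.
  by rewrite -[leLHS]mulr1 ler_pM// lerDl.
have [j [v [xE v1 v2]]] := dyadic (ltW x1).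
have v0 : 0 < v by exact: lt_le_trans v1.
pose s := v / a n; have sp : 0 < s by rewrite divr_gt0.
have xsE : x / a n = 2 ^+ j * s by rewrite xE -mulrA.
have hs : n%:R * chi s <= C1 by apply: hC1; rewrite gtr0_norm// ltW.
have jx : B ^+ j <= `|x| `^ beta.
  rewrite Bpow ge0_ler_powR ?nnegrE ?(ltW beta0) ?exprn_ge0// ger0_norm// xE.
  by rewrite ler_peMr// exprn_ge0.
have fin : n%:R * chi (x / a n) <= C1 * (1 + 2 / c0) * `|x| `^ beta.
  rewrite xsE; have [js|js] := leP (2 ^+ j * s) (2 * s0).
    rewrite (le_trans (ler_wpM2l (ltW n0') (iter _ _ sp js)))// mulrCA.
    rewrite mulrC ler_pM ?exprn_ge0 ?mulr_ge0 ?chi_ge0 ?(ltW B0)//.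
    rewrite (le_trans hs)// ler_peMr ?(ltW C10)// lerDl divr_ge0// ltW//.
  have ss0 : s <= s0.
    rewrite /s ler_pdivrMr//; move: a2; rewrite ler_pdivrMr// => a2.
    by rewrite mulrC (le_trans (ltW v2)).
  have /dyadic[i [v' [yE v'1 v'2]]] : 1 <= s0 / s by rewrite ler_pdivlMr// mul1r.
  have v'0 : 0 < v' by exact: lt_le_trans v'1.
  have s0E : s0 = 2 ^+ i * s * v' by rewrite mulrAC -yE divfK// gt_eqF.
  have is0 : s0 / 2 <= 2 ^+ i * s <= s0.
    have : 0 < 2 ^+ i * s by rewrite mulr_gt0// exprn_gt0.
    rewrite s0E; set w := 2 ^+ i * s => w0; rewrite ler_peMr ?(ltW w0)// andbT.
    by rewrite -mulrA ler_piMr ?(ltW w0)// ler_pdivrMr// mul1r ltW.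
  have ij : (i <= j)%N.
    rewrite -(@ler_eXn2l R 2) ?ltr1n// -(ler_pM2r sp).
    by case/andP: is0 => _ h; rewrite ltW// (le_lt_trans h)// (lt_trans _ js)// ltr_pMl// ltr1n.
  have iBj : B ^+ i <= B ^+ j.
    exact: ler_weXn2l.
  (* Doubling from [s] to the scale [2^i s] in [[s0 / 2, s0]], where [chi >= c0], gives
     [n c0 <= n B^i chi s <= C1 B^j]. *)
  have nB : n%:R <= C1 / c0 * B ^+ j.
    rewrite mulrAC ler_pdivlMr//.
    have h1 : n%:R * c0 <= n%:R * (B ^+ i * chi s).
      rewrite ler_pM2l// (le_trans (low _ is0))// iter//.
      by case/andP: is0 => _ h; rewrite (le_trans h)// ler_peMl ?(ltW s00)// ler1n.
    rewrite (le_trans h1)// mulrCA mulrC ler_pM ?mulr_ge0 ?exprn_ge0 ?chi_ge0//; exact: ltW.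
  rewrite (le_trans (ler_wpM2l (ltW n0') (chi_le2 _)))//.
  have h2 : n%:R * 2 <= C1 * (2 / c0) * B ^+ j.
    have -> : C1 * (2 / c0) * B ^+ j = (C1 / c0 * B ^+ j) * 2 by ring.
    by rewrite ler_pM2r.
  rewrite (le_trans h2)// ler_pM ?exprn_ge0 ?mulr_ge0 ?divr_ge0 ?invr_ge0 ?(ltW B0) ?(ltW C10) ?(ltW c00)//.
  by rewrite ler_pM2l// lerDr.
by rewrite (le_trans fin)// ler_wpM2l// lerDr.
Unshelve. all: by end_near. Qed.

End char_asymptotics.

(** * The forest of copied steps *)

Section forest.
Context (R : realType).

(* A configuration records, for each time, the values of [U], [eps] and [eta]. *)
Definition choice3 : Type := (nat * bool * bool)%type.
Definition config := nat -> choice3.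

Definition upd (c : config) n (x : choice3) : config := fun k => if k == n then x else c k.

(* By linearity of the recursion, the signed indicator that step [k] copies the
   innovation [xi_i] is the increment obtained with [xi] the [i]-th unit vector. *)
Definition copy (c : config) (i k : nat) : R :=
  srrw_increment (fun k => (c k).1.1) (fun k => (c k).1.2) (fun k => (c k).2)
    (fun j => (j == i)%:R) k.

Lemma eq_recursive_seq (s1 s2 : nat -> (nat -> R) -> R) n :
  (forall m past, (m <= n)%N -> s1 m past = s2 m past) ->
  recursive_seq s1 n = recursive_seq s2 n.
Proof.
move=> s12; have H m : (m <= n)%N -> history s1 m = history s2 m.
  elim: m => //= m IH mn; rewrite IH; last exact: ltnW.
  by rewrite s12// ltnW.
by rewrite /recursive_seq H// s12.
Qed.

Lemma copy_upd c i k n x : (k < n)%N -> copy (upd c n x) i k = copy c i k.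
Proof.
move=> kn; apply: eq_recursive_seq => m past mk.
have mn : (m == n) = false by rewrite ltn_eqF// (leq_ltn_trans mk).
by rewrite /srrw_step /upd mn.
Qed.

Lemma copy_new c i n v e h : (1 <= n)%N -> (1 <= v <= n)%N ->
  copy (upd c n.+1 (v, e, h)) i n.+1 =
    if e then (if h then copy c i v else - copy c i v) else (n.+1 == i)%:R.
Proof.
move=> n1 vn; rewrite /copy srrw_incrementE//= /upd ?eqxx//=.
have := @copy_upd c i v n.+1 (v, e, h); rewrite /copy /upd => -> //.
by case/andP: vn.
Qed.

(** Valid for any [c]: a choice that does not point to the past reads the default 0 of [history]. *)
Lemma copyE c i k : (2 <= k)%N -> copy c i k =
  let past := if ((c k).1.1 < k)%N then copy c i (c k).1.1 else 0 in
  if (c k).1.2 then (if (c k).2 then past else - past) else (k == i)%:R.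
Proof.
by case: k => [//|[//|k]] _; rewrite {1}/copy /srrw_increment [LHS]/recursive_seq
  {1}/srrw_step !historyE.
Qed.

Lemma copy0 c i : copy c i 0 = 0. Proof. by []. Qed.

Lemma copy1 c i : copy c i 1 = (1%N == i)%:R. Proof. by []. Qed.

Lemma copy_lt c i k : (k < i)%N -> copy c i k = 0.
Proof.
have [n] := ubnP k; elim: n k => // n IH [|[|k]] /= kn ki; first exact: copy0.
  by rewrite copy1 ltn_eqF.
rewrite copyE//; case: ifP => [lt|_] /=; last by rewrite oppr0 (ltn_eqF ki) mulr0n !if_same.
rewrite IH; [by rewrite oppr0 (ltn_eqF ki) mulr0n !if_same| |exact: ltn_trans ki].
exact: leq_trans lt _.
Qed.

Lemma copy_values c i k : [\/ copy c i k = 0, copy c i k = 1 | copy c i k = -1].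
Proof.
have ind (b : bool) : [\/ b%:R = 0 :> R, b%:R = 1 :> R | b%:R = -1 :> R].
  by case: b; [constructor 2|constructor 1].
have [n] := ubnP k; elim: n k => // n IH [|[|k]] /= kn; first by constructor 1.
  exact: ind.
rewrite copyE//=; case: (c k.+2).1.2; last exact: ind.
case: (ltnP (c k.+2).1.1 k.+2) => [lt|_]; last by rewrite oppr0 if_same; constructor 1.
have [|->|->|->] := IH (c k.+2).1.1; first exact: leq_trans lt _.
- by rewrite oppr0 if_same; constructor 1.
- by case: (c k.+2).2; [constructor 2|constructor 3].
- by rewrite opprK; case: (c k.+2).2; [constructor 3|constructor 2].
Qed.

Lemma normr_copy c i k : `|copy c i k| = (copy c i k != 0)%:R.
Proof.
by case: (copy_values c i k) => ->; rewrite ?normr0 ?eqxx// ?normrN normr1 ?oppr_eq0 oner_eq0.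
Qed.

Lemma sum_copy_le1 c n k : \sum_(1 <= i < n.+1) `|copy c i k| <= 1.
Proof.
have ind j : \sum_(1 <= i < n.+1) `|(j == i)%:R| <= 1 :> R.
  have [jn|jn] := boolP (j \in index_iota 1 n.+1); last first.
    rewrite big_seq big1 ?ler01// => i ii.
    have [ji|] := eqVneq j i; last by rewrite normr0.
    by rewrite ji ii in jn.
  rewrite (bigD1_seq j)//= ?iota_uniq// eqxx normr1 big1 ?addr0// => i ij.
  by rewrite eq_sym (negbTE ij) normr0.
have [m] := ubnP k; elim: m k => // m IH [|[|k]] /= kn.
- by rewrite big1 ?ler01// => i _; rewrite copy0 normr0.
- exact: ind.
under eq_bigr do rewrite copyE//=.
case: (c k.+2).1.2; last exact: ind.
case: (ltnP (c k.+2).1.1 k.+2) => [lt|_]; last by rewrite big1 ?ler01// => i _; rewrite oppr0 if_same normr0.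
have := IH (c k.+2).1.1 (leq_trans lt _); rewrite -ltnS => /(_ kn).
by apply: le_trans; apply: ler_sum => i _; case: (c k.+2).2; rewrite ?normrN.
Qed.

Definition csize c i n : nat := (\sum_(1 <= k < n.+1) (copy c i k != 0)%R)%N.
Definition cweight c i n : R := \sum_(1 <= k < n.+1) copy c i k.

Lemma csizeE c i n : (csize c i n)%:R = \sum_(1 <= k < n.+1) `|copy c i k|.
Proof. by rewrite natr_sum; apply: eq_bigr => k _; rewrite normr_copy. Qed.

Lemma cweight_le c i n : `|cweight c i n| <= (csize c i n)%:R.
Proof. by rewrite csizeE; exact: ler_norm_sum. Qed.

Lemma csize_le c i n : (csize c i n <= n)%N.
Proof.
apply: (@leq_trans (\sum_(1 <= k < n.+1) 1)%N); last by rewrite sum_nat_const_nat subn1 muln1.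
by apply: leq_sum => k _; case: (_ != _).
Qed.

Lemma csize0 c i n : csize c i n = 0%N -> cweight c i n = 0.
Proof. by move=> K0; apply/eqP; rewrite -normr_le0 (le_trans (cweight_le _ _ _))// K0. Qed.

Lemma csize_lt c i n : (n < i)%N -> csize c i n = 0%N.
Proof.
move=> ni; rewrite /csize big_nat big1// => k /andP[_ kn].
by rewrite copy_lt ?eqxx// (leq_ltn_trans _ ni).
Qed.

Lemma csizeS c i n x : csize (upd c n.+1 x) i n.+1 =
  (csize c i n + (copy (upd c n.+1 x) i n.+1 != 0)%R)%N.
Proof.
rewrite /csize big_nat_recr//=; congr (_ + _)%N.
by apply: eq_big_nat => k /andP[_ kn]; rewrite copy_upd.
Qed.

Lemma cweightS c i n x : cweight (upd c n.+1 x) i n.+1 =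
  cweight c i n + copy (upd c n.+1 x) i n.+1.
Proof.
rewrite /cweight big_nat_recr//=; congr (_ + _).
by apply: eq_big_nat => k /andP[_ kn]; rewrite copy_upd.
Qed.

(* A sum over the clusters of the forest at time [n]; an innovation that has not been
   used contributes [g 0 0], so [g 0 0 = 0] is assumed throughout. *)
Definition csum (g : nat -> R -> R) n c : R :=
  \sum_(1 <= i < n.+1) g (csize c i n) (cweight c i n).

Lemma csum_new g n c v h : g 0%N 0 = 0 -> (1 <= n)%N -> (1 <= v <= n)%N ->
  csum g n.+1 (upd c n.+1 (v, false, h)) = csum g n c + g 1%N 1.
Proof.
move=> g0 n1 vn; rewrite /csum big_nat_recr//=; congr (_ + _).
  apply: eq_big_nat => i /andP[i1 in1].
  by rewrite csizeS cweightS copy_new//= gtn_eqF// eqxx addn0 addr0.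
by rewrite csizeS cweightS copy_new//= eqxx oner_eq0 csize_lt// csize0 ?csize_lt// add0r.
Qed.

Lemma csum_copy g n c v (h : bool) : g 0%N 0 = 0 -> (1 <= n)%N -> (1 <= v <= n)%N ->
  csum g n.+1 (upd c n.+1 (v, true, h)) =
    \sum_(1 <= i < n.+1) g (csize c i n + (copy c i v != 0)%R)%N
      (cweight c i n + (if h then copy c i v else - copy c i v)).
Proof.
move=> g0 n1 vn; rewrite /csum big_nat_recr//= [X in _ + X = _](_ : _ = 0).
  rewrite addr0; apply: eq_big_nat => i _; rewrite csizeS cweightS copy_new//=.
  by case: h; rewrite ?oppr_eq0.
rewrite csizeS cweightS copy_new//= csize_lt// csize0 ?csize_lt//.
have -> : copy c n.+1 v = 0 by apply: copy_lt; case/andP: vn.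
by rewrite oppr0 if_same eqxx addr0.
Qed.

Definition options n : seq choice3 :=
  [seq (v, eh.1, eh.2) | v <- iota 1 n,
     eh <- [:: (true, true); (true, false); (false, true); (false, false)]].

Arguments options : simpl never.

(* The configurations for the times [2 .. m + 1]. *)
Fixpoint configs m : seq config :=
  if m is m'.+1 then [seq upd c m'.+2 x | c <- configs m', x <- options m'.+1]
  else [:: fun=> (0%N, true, true)].

(** The kernel is left free: [weight] gives the law of the choices, indicator kernels give the
    events of [cexp_indicator_le1]. Factor [k] concerns time [k + 2], since choices start at time
    2. *)
Definition cexp (kappa : nat -> choice3 -> R) m (G : config -> R) : R :=
  \sum_(c <- configs m) (\prod_(k < m) kappa k (c k.+2)) * G c.

Lemma cexp0 kappa G : cexp kappa 0 G = G (fun=> (0%N, true, true)).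
Proof. by rewrite /cexp /= big_seq1 big_ord0 mul1r. Qed.

Lemma cexpS kappa m G : cexp kappa m.+1 G =
  cexp kappa m (fun c => \sum_(x <- options m.+1) kappa m x * G (upd c m.+2 x)).
Proof.
rewrite /cexp (_ : configs m.+1 = [seq upd c m.+2 x | c <- configs m, x <- options m.+1])//.
rewrite big_allpairs_dep/=; apply: eq_bigr => c _.
rewrite mulr_sumr; apply: eq_bigr => x _; rewrite big_ord_recr/= mulrA.
congr (_ * _ * _); last by rewrite /upd eqxx.
by apply: eq_bigr => k _; rewrite /upd !eqSS ltn_eqF.
Qed.

Lemma eq_cexp kappa m G H : G =1 H -> cexp kappa m G = cexp kappa m H.
Proof. by move=> GH; congr cexp; apply/funext. Qed.

Lemma cexpD kappa m G H : cexp kappa m (fun c => G c + H c) =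
  cexp kappa m G + cexp kappa m H.
Proof. by rewrite -big_split/=; apply: eq_bigr => c _; rewrite mulrDr. Qed.

Lemma cexpZ kappa m a G : cexp kappa m (fun c => a * G c) = a * cexp kappa m G.
Proof. by rewrite /cexp mulr_sumr; apply: eq_bigr => c _; rewrite mulrCA. Qed.

Lemma cexp_sum kappa m I (s : seq I) (G : I -> config -> R) :
  cexp kappa m (fun c => \sum_(i <- s) G i c) = \sum_(i <- s) cexp kappa m (G i).
Proof.
by rewrite /cexp exchange_big/=; apply: eq_bigr => c _; rewrite mulr_sumr.
Qed.

(** * Recursions for the numbers of clusters of a given size *)

Section walk.
Variables (p r : R).

(** Law of the choices at time [n + 2], when there are [n + 1] earlier steps. *)
Definition weight n (x : choice3) : R :=
  n.+1%:R^-1 * ((if x.1.2 then p else 1 - p) * (if x.2 then r else 1 - r)).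

Lemma sum_options n (G : choice3 -> R) :
  \sum_(x <- options n.+1) weight n x * G x =
  n.+1%:R^-1 * \sum_(1 <= v < n.+2)
    (p * (r * G (v, true, true) + (1 - r) * G (v, true, false)) +
     (1 - p) * (r * G (v, false, true) + (1 - r) * G (v, false, false))).
Proof.
rewrite /options big_allpairs_dep/= mulr_sumr /index_iota subn1; apply: eq_bigr => v _.
rewrite !big_cons big_nil /weight/=; ring.
Qed.

Local Notation Ec := (cexp weight).

Lemma sum_options1 n : \sum_(x <- options n.+1) weight n x = 1.
Proof.
under eq_bigr do rewrite -[weight _ _]mulr1.
rewrite sum_options (eq_bigr (fun=> 1)) => [|v _]; last by ring.
by rewrite sumr_const_nat subn1 mulVf// pnatr_eq0.
Qed.

Lemma cexp_cst m a : Ec m (fun=> a) = a.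
Proof.
elim: m => [|m IH]; first by rewrite cexp0.
by rewrite cexpS; under eq_cexp do rewrite -mulr_suml sum_options1 mul1r.
Qed.

Hypothesis p01 : 0 < p <= 1.
Hypothesis r01 : 0 <= r <= 1.

Lemma weight_ge0 n x : 0 <= weight n x.
Proof.
rewrite /weight mulr_ge0 ?invr_ge0//; case/andP: p01 => p0 p1; case/andP: r01 => r0 r1.
by rewrite mulr_ge0//; case: ifP => // _; rewrite ?subr_ge0// ltW.
Qed.

Lemma le_cexp m G H : (forall c, G c <= H c) -> Ec m G <= Ec m H.
Proof.
move=> GH; apply: ler_sum => c _; rewrite ler_wpM2l// prodr_ge0// => k _.
exact: weight_ge0.
Qed.

Lemma cexp_ge0 m G : (forall c, 0 <= G c) -> 0 <= Ec m G.
Proof. by move=> G0; rewrite -(cexp_cst m 0) le_cexp. Qed.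

Lemma cexp_sqr m G : (Ec m (fun c => `|G c|)) ^+ 2 <= Ec m (fun c => G c ^+ 2).
Proof.
set a := Ec m _; have : 0 <= Ec m (fun c => (`|G c| - a) ^+ 2).
  by apply: cexp_ge0 => c; exact: sqr_ge0.
rewrite (@eq_cexp _ _ _ (fun c => G c ^+ 2 + ((- (2 * a)) * `|G c| + a ^+ 2))); last first.
  by move=> c; rewrite sqrrB real_normK ?num_real// -mulr_natl; ring.
by rewrite cexpD cexpD cexpZ cexp_cst -/a; lra.
Qed.

Let rho := 2 * r - 1.

(** A cluster of size [K] and weight [W] has [(K + W) / 2] steps of sign plus and [(K - W) / 2] of
    sign minus. The copied step being uniform and its sign kept with probability [r], the weight
    goes up with probability [p (K + rho W) / (2 (m + 1))] and down with
    [p (K - rho W) / (2 (m + 1))]; a fresh innovation adds [g 1 1]. *)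
Lemma sum_options_csum m g c : g 0%N 0 = 0 ->
  \sum_(x <- options m.+1) weight m x * csum g m.+2 (upd c m.+2 x) =
  csum g m.+1 c + (1 - p) * g 1%N 1 + p / m.+1%:R *
    \sum_(1 <= i < m.+2)
       (((csize c i m.+1)%:R + rho * cweight c i m.+1) / 2 *
         (g (csize c i m.+1).+1 (cweight c i m.+1 + 1) - g (csize c i m.+1) (cweight c i m.+1)) +
        ((csize c i m.+1)%:R - rho * cweight c i m.+1) / 2 *
         (g (csize c i m.+1).+1 (cweight c i m.+1 - 1) - g (csize c i m.+1) (cweight c i m.+1))).
Proof.
move=> g0; rewrite (sum_options m (fun x => csum g m.+2 (upd c m.+2 x))).
pose u i := g (csize c i m.+1).+1 (cweight c i m.+1 + 1) - g (csize c i m.+1) (cweight c i m.+1).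
pose d i := g (csize c i m.+1).+1 (cweight c i m.+1 - 1) - g (csize c i m.+1) (cweight c i m.+1).
pose S := csum g m.+1 c.
(* [(|x| + x) / 2] and [(|x| - x) / 2] are the indicators of [x = 1] and [x = -1] among the three
   possible values of a copy. *)
have step i v (h : bool) : g (csize c i m.+1 + (copy c i v != 0)%R)%N
     (cweight c i m.+1 + (if h then copy c i v else - copy c i v)) =
   g (csize c i m.+1) (cweight c i m.+1) +
     (if h then (`|copy c i v| + copy c i v) / 2 * u i + (`|copy c i v| - copy c i v) / 2 * d i
      else (`|copy c i v| - copy c i v) / 2 * u i + (`|copy c i v| + copy c i v) / 2 * d i).
  have n10 : (-1 != 0 :> R) by rewrite oppr_eq0 oner_eq0.
  by case: (copy_values c i v) => ->; rewrite ?normr0 ?normrN ?normr1 ?eqxx ?oner_eq0 ?n10 ?opprK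
    ?oppr0 ?if_same ?addn0 ?addn1 ?addr0; case: h; rewrite /u /d; field.
rewrite (eq_big_nat _ _ (F2 := fun v => S + (1 - p) * g 1%N 1 + p * \sum_(1 <= i < m.+2)
   ((`|copy c i v| + rho * copy c i v) / 2 * u i +
    (`|copy c i v| - rho * copy c i v) / 2 * d i))); last first.
  move=> v vm; rewrite !csum_new// -/S.
  have copyv (h : bool) : csum g m.+2 (upd c m.+2 (v, true, h)) = S + \sum_(1 <= i < m.+2)
     (if h then (`|copy c i v| + copy c i v) / 2 * u i + (`|copy c i v| - copy c i v) / 2 * d i
      else (`|copy c i v| - copy c i v) / 2 * u i + (`|copy c i v| + copy c i v) / 2 * d i).
    by rewrite csum_copy// (eq_bigr _ (fun i _ => step i v h)) big_split.
  rewrite !copyv.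
  set E1 := \sum_(_ <= _ < _) _; set E2 := \sum_(_ <= _ < _) _; set E3 := \sum_(_ <= _ < _) _.
  suff -> : E3 = r * E1 + (1 - r) * E2 by ring.
  rewrite /E1 /E2 /E3 !mulr_sumr -big_split/=; apply: eq_bigr => i _.
  by rewrite /rho; field.
rewrite big_split/= sumr_const_nat subn1 /= -mulr_sumr exchange_big/=.
set D := \sum_(_ <= _ < _) _; set D' := \sum_(_ <= _ < _) _.
suff -> : D = D'.
  rewrite -/S -(mulr_natl (S + _)) mulrDr mulKf ?pnatr_eq0//.
  by rewrite mulrA [_^-1 * p]mulrC.
apply: eq_bigr => i _; rewrite big_split/= -!mulr_suml big_split/= sumrB -!mulr_sumr.
by rewrite csizeE /cweight.
Qed.

(** Transition operator of the elephant random walk from time [k] to [k + 1]: at position [w] a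
    uniform past step is [+1] with probability [(1 + w / k) / 2], which the random sign turns into
    [(1 + rho w / k) / 2]. *)
Definition erw_op k (f : R -> R) (w : R) : R :=
  (1 + rho * w / k%:R) / 2 * f (w + 1) + (1 - rho * w / k%:R) / 2 * f (w - 1).

(* [erw_mean j f] is the expectation of [f] under the law of the elephant random
   walk at time [j + 1]. *)
Fixpoint erw_mean j (f : R -> R) : R :=
  if j is j'.+1 then erw_mean j' (erw_op j f) else f 1.

(* [size_freq j] is the asymptotic frequency of the clusters of size [j + 1]. *)
Fixpoint size_freq j : R :=
  if j is j'.+1 then size_freq j' * (p * j%:R) / (1 + p * j.+1%:R)
  else (1 - p) / (1 + p).

Definition count j (f : R -> R) : nat -> config -> R :=
  csum (fun k w => (k == j.+1)%:R * f w).

(** For [|w| <= j + 1], the range of the walk at that time, the two coefficients are probabilities;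
    elsewhere they may be negative, hence the bounded ranges in all comparisons. *)
Lemma erw_op_ge0 j (f : R -> R) : (forall w, `|w| <= j.+2%:R -> 0 <= f w) ->
  forall w, `|w| <= j.+1%:R -> 0 <= erw_op j.+1 f w.
Proof.
move=> f0 w wj; have j0 : 0 < j.+1%:R :> R by rewrite ltr0n.
have jj : j.+2%:R = j.+1%:R + 1 :> R by rewrite -natr1.
have h1 : `|rho * w / j.+1%:R| <= 1.
  rewrite normrM normfV (gtr0_norm j0) ler_pdivrMr// mul1r normrM.
  have rho1 : `|rho| <= 1.
    by case/andP: r01 => r0 r1; rewrite ler_norml /rho; apply/andP; split; lra.
  by rewrite (le_trans _ wj)// ler_piMl.
move: h1; rewrite ler_norml => /andP[h1 h2].
rewrite /erw_op addr_ge0// mulr_ge0 ?divr_ge0// ?subr_ge0 -?lerBlDl ?sub0r//.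
  by apply: f0; rewrite jj (le_trans (ler_normD _ _))// normr1 lerD2r.
by apply: f0; rewrite jj (le_trans (ler_normB _ _))// normr1 lerD2r.
Qed.

Lemma erw_opD k f g w : erw_op k (fun w => f w + g w) w = erw_op k f w + erw_op k g w.
Proof. by rewrite /erw_op; ring. Qed.

Lemma erw_opZ k a f w : erw_op k (fun w => a * f w) w = a * erw_op k f w.
Proof. by rewrite /erw_op; ring. Qed.

Lemma eq_erw_mean j f g : f =1 g -> erw_mean j f = erw_mean j g.
Proof. by move=> fg; congr erw_mean; apply/funext. Qed.

Lemma erw_meanD j f g : erw_mean j (fun w => f w + g w) = erw_mean j f + erw_mean j g.
Proof.
elim: j f g => //= j IH f g; rewrite -IH; apply: eq_erw_mean => w; exact: erw_opD.
Qed.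

Lemma erw_meanZ j a f : erw_mean j (fun w => a * f w) = a * erw_mean j f.
Proof.
elim: j f => //= j IH f; rewrite -IH; apply: eq_erw_mean => w; exact: erw_opZ.
Qed.

Lemma erw_mean_cst j a : erw_mean j (fun=> a) = a.
Proof.
by elim: j => //= j IH; rewrite -[RHS]IH; apply: eq_erw_mean => w; rewrite /erw_op; field.
Qed.

Lemma erw_mean_ge0 j f : (forall w, `|w| <= j.+1%:R -> 0 <= f w) -> 0 <= erw_mean j f.
Proof.
elim: j f => [|j IH] f f0 /=; first by apply: f0; rewrite normr1.
by apply: IH; exact: erw_op_ge0.
Qed.

Lemma le_erw_mean j f g : (forall w, `|w| <= j.+1%:R -> f w <= g w) ->
  erw_mean j f <= erw_mean j g.
Proof.
move=> fg; rewrite -subr_ge0 -mulN1r -erw_meanZ -erw_meanD.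
by apply: erw_mean_ge0 => w wj; rewrite mulN1r subr_ge0 fg.
Qed.

Lemma size_freq_gt0 j : p < 1 -> 0 < size_freq j.
Proof.
case/andP: p01 => p0 _ p1; elim: j => [|j IH] /=; first by rewrite divr_gt0; lra.
by rewrite divr_gt0 ?mulr_gt0 ?ltr0n// ltr_wpDl// mulr_gt0// ltr0n.
Qed.

(** Balance of flows: when counts grow like [n] times the frequencies, that of size [j + 2] is the
    inflow [p (j + 1) size_freq j] minus the outflow [p (j + 2) size_freq j.+1]. *)
Lemma size_freqS j : (1 + p * j.+2%:R) * size_freq j.+1 = p * j.+1%:R * size_freq j.
Proof.
case/andP: p01 => p0 _.
have : 1 + p * j.+2%:R != 0 :> R.
  by rewrite gt_eqF// ltr_wpDl// mulr_gt0// ltr0n.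
by rewrite /=; set a := 1 + _ => a0; field.
Qed.

Lemma normr_count j f n c (M : R) : (forall w, `|w| <= j.+1%:R -> `|f w| <= M) ->
  `|count j f n c| <= M * n%:R.
Proof.
move=> fM; rewrite /count /csum (le_trans (ler_norm_sum _ _ _))//.
have M0 : 0 <= M by rewrite (le_trans _ (fM 0 _)) ?normr0.
rewrite (@le_trans _ _ (\sum_(1 <= i < n.+1) M))//; last first.
  by rewrite sumr_const_nat subn1 /= mulr_natr.
apply: ler_sum => i _; case: eqP => [K|_]; last by rewrite mul0r normr0.
by rewrite mul1r fM// -K cweight_le.
Qed.

Lemma count_gt j f n c : (n <= j)%N -> count j f n c = 0.
Proof.
move=> nj; rewrite /count /csum big1// => i _.
by rewrite ltn_eqF ?mul0r// ltnS (leq_trans (csize_le c i n)).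
Qed.

Lemma csum_count (g : nat -> R -> R) n c : g 0%N 0 = 0 ->
  csum g n c = \sum_(j < n) count j (g j.+1) n c.
Proof.
move=> g0; rewrite /count /csum exchange_big/=; apply: eq_bigr => i _.
have [K0|K0] := posnP (csize c i n).
  by rewrite csize0// K0 g0 big1// => j _; rewrite mul0r.
have Kn : ((csize c i n).-1 < n)%N by rewrite prednK// csize_le.
rewrite (bigD1 (Ordinal Kn))//= prednK// eqxx mul1r big1 ?addr0// => j /eqP jK.
rewrite (_ : _ == _ = false) ?mul0r//; apply/eqP => Kj; apply: jK.
by apply: val_inj; rewrite /= Kj.
Qed.

(** Size [j + 1] is left with probability [p (j + 1) / (m + 1)] per cluster and reached from size
    [j]. A growing cluster of size [j] moves its weight by the elephant transition at time [j], so
    the inflow is a count with test function [erw_op j f]; size 1 is fed by fresh innovations. *)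
Lemma sum_options_count m j f c :
  \sum_(x <- options m.+1) weight m x * count j f m.+2 (upd c m.+2 x) =
  count j f m.+1 c - p * j.+1%:R / m.+1%:R * count j f m.+1 c +
  (if j is j'.+1 then p * j%:R / m.+1%:R * count j' (erw_op j f) m.+1 c
   else (1 - p) * f 1).
Proof.
rewrite sum_options_csum ?mul0r//.
set S := \sum_(_ <= _ < _) _.
have -> : S = - (j.+1%:R * count j f m.+1 c) +
    (if j is j'.+1 then j%:R * count j' (erw_op j f) m.+1 c else 0).
  have -> : - (j.+1%:R * count j f m.+1 c) = \sum_(1 <= i < m.+2)
     - (j.+1%:R * ((csize c i m.+1 == j.+1)%:R * f (cweight c i m.+1))).
    by rewrite sumrN mulr_sumr.
  case: j @S => [|j] S.
    rewrite addr0; apply: eq_bigr => i _.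
    have [K0|K0] := posnP (csize c i m.+1).
      by rewrite csize0// K0 /= ?mulr0n ?mulr1n; ring.
    rewrite !eqSS gtn_eqF//; case: eqP => [->|_]; rewrite /= ?mulr0n ?mulr1n; last by ring.
    by field.
  rewrite mulr_sumr -big_split/=; apply: eq_bigr => i _; rewrite !eqSS.
  have [K1|K1] := eqVneq (csize c i m.+1) j.+1.
    rewrite K1 ltn_eqF ?ltnSn//= /erw_op ?mulr0n ?mulr1n; field; by rewrite nat1r pnatr_eq0.
  have [K2|K2] := eqVneq (csize c i m.+1) j.+2.
    by rewrite K2 /= ?mulr0n ?mulr1n; field.
  by rewrite /= ?mulr0n ?mulr1n; field.
rewrite -/(count j f m.+1 c); case: j {S} => [|j]; rewrite /= ?mulr0n ?mulr1n; field;
  by rewrite nat1r pnatr_eq0.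
Qed.

Lemma cexp_count m j f : Ec m.+1 (count j f m.+2) =
  (1 - p * j.+1%:R / m.+1%:R) * Ec m (count j f m.+1) +
  (if j is j'.+1 then p * j%:R / m.+1%:R * Ec m (count j' (erw_op j f) m.+1)
   else (1 - p) * f 1).
Proof.
rewrite cexpS (eq_cexp _ _ (fun c => sum_options_count m j f c)).
case: j => [|j].
  rewrite (eq_cexp _ _ (H := fun c => (1 - p * 1 / m.+1%:R) * count 0 f m.+1 c + (1 - p) * f 1)).
    by rewrite cexpD cexpZ cexp_cst.
  by move=> c; ring.
rewrite (eq_cexp _ _ (H := fun c => (1 - p * j.+2%:R / m.+1%:R) * count j.+1 f m.+1 c +
    p * j.+1%:R / m.+1%:R * count j (erw_op j.+1 f) m.+1 c)).
  by rewrite cexpD !cexpZ.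
by move=> c; ring.
Qed.

(* For [p = 1] the first cluster is never left, and its weight is an elephant
   random walk. *)
Lemma cexp_count_erw m f : p = 1 -> Ec m (count m f m.+1) = erw_mean m f.
Proof.
move=> p1; elim: m f => [|m IH] f.
  rewrite cexp0 /count /csum big_nat1 /= /csize /cweight !big_nat1 !copy1 eqxx oner_eq0.
  by rewrite mul1r.
rewrite cexp_count /= p1 -IH (eq_cexp _ _ (H := fun=> 0)) => [|c]; last exact: count_gt.
by rewrite cexp_cst mulr0 add0r mul1r mulfV ?mul1r// pnatr_eq0.
Qed.

Hypothesis p1 : p < 1.

(* The factor [(1 + p k) / k] only matters for the clusters that contain all of the
   [k] steps made so far. *)
Fixpoint dom j : R :=
  if j is j'.+1 then dom j' * Num.max 1 ((1 + p * j.+1%:R) / j.+1%:R)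
  else (1 + p) / (1 - p).

Lemma domS j : dom j.+1 = dom j * Num.max 1 ((1 + p * j.+2%:R) / j.+2%:R).
Proof. by []. Qed.

Lemma dom_ge1 j : 1 <= dom j.
Proof.
have [p0 _] := andP p01; have q0 : 0 < 1 - p by rewrite subr_gt0.
elim: j => [|j IH] /=.
  by rewrite ler_pdivlMr// mul1r lerBlDr -addrA lerDl addr_ge0 ?ltW.
by rewrite -[leLHS]mulr1 ler_pM// le_max lexx.
Qed.

Lemma dom_gt0 j : 0 < dom j.
Proof. exact: lt_le_trans (dom_ge1 j). Qed.

Lemma dom_le j : dom j <= dom j.+1.
Proof. by rewrite /= ler_peMr ?(ltW (dom_gt0 j))// le_max lexx. Qed.

Lemma dom_bounded : exists C, forall j, dom j <= C.
Proof.
have q0 : 0 < 1 - p by rewrite subr_gt0.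
pose J := Num.bound (1 - p)^-1; exists (dom J).
have up i : dom (J + i)%N = dom J.
  elim: i => [|i IH]; first by rewrite addn0.
  rewrite addnS domS IH (max_idPl _) ?mulr1// ler_pdivrMr ?ltr0n// mul1r -lerBrDr.
  have : (1 - p)^-1 <= (J + i).+2%:R.
    by rewrite (le_trans (ler_boundS _))// ler_nat ltnS -/J leqW// leq_addr.
  rewrite -[X in X <= _]mul1r ler_pdivrMr//; lra.
move=> j; have [Jj|jJ] := leqP J j; first by rewrite -(subnKC Jj) up.
elim: J jJ {up} => // J IH; rewrite ltnS leq_eqVlt => /predU1P[->|/IH h]; first exact: dom_le.
exact: le_trans h (dom_le J).
Qed.

(** Induction on time through [cexp_count]; up to [dom], the bound is the stationary profile of
    [size_freqS]. The initial value of [dom] is the one that fits the single cluster present at time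
    1. *)
Lemma cexp_count_le m j f : (forall w, `|w| <= j.+1%:R -> 0 <= f w) ->
  Ec m (count j f m.+1) <= dom j * (m.+1%:R * (size_freq j * erw_mean j f)).
Proof.
have [p0 _] := andP p01.
elim: m j f => [|m IH] j f f0.
  have h : 0 <= size_freq j * erw_mean j f.
    by rewrite mulr_ge0 ?erw_mean_ge0// ltW// size_freq_gt0.
  have [j0|j0] := posnP j.
    rewrite j0 cexp0 /count /csum big_nat1 /= /csize /cweight !big_nat1 !copy1 eqxx oner_eq0 /=.
    rewrite !mul1r mulrA le_eqVlt; apply/orP; left; apply/eqP; field.
    by rewrite !gt_eqF ?subr_gt0// addr_gt0.
  rewrite cexp0 count_gt// mul1r mulr_ge0//; exact/ltW/dom_gt0.
have m0 : 0 < m.+1%:R :> R by rewrite ltr0n.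
have mS : m.+2%:R = m.+1%:R + 1 :> R by rewrite -natr1.
case: j f0 => [|j] f0.
  rewrite cexp_count; set X := size_freq 0 * erw_mean 0 f.
  have X0 : 0 <= X by rewrite mulr_ge0 ?erw_mean_ge0// ltW// size_freq_gt0.
  have fX : (1 - p) * f 1 = (1 + p) * X by rewrite /X /=; field; rewrite gt_eqF// addr_gt0.
  have h := IH _ _ f0; rewrite -/X in h.
  have q : 0 <= 1 - p * 1 / m.+1%:R.
    by rewrite subr_ge0 ler_pdivrMr// mul1r mulr1 (le_trans (ltW p1))// ler1n.
  apply: le_trans (lerD (ler_wpM2l q h) (lexx _)) _.
  rewrite fX mS.
  have -> : (1 - p * 1 / m.+1%:R) * (dom 0 * (m.+1%:R * X)) = dom 0 * X * (m.+1%:R - p).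
    by field; rewrite nat1r pnatr_eq0.
  have : (1 + p) * X <= dom 0 * ((1 + p) * X).
    by rewrite ler_peMl ?dom_ge1// mulr_ge0// addr_ge0// ltW.
  lra.
rewrite cexp_count; set X := size_freq j.+1 * erw_mean j.+1 f.
have X0 : 0 <= X by rewrite mulr_ge0 ?erw_mean_ge0// ltW// size_freq_gt0.
have XE : p * j.+1%:R * (size_freq j * erw_mean j (erw_op j.+1 f)) =
    (1 + p * j.+2%:R) * X.
  by rewrite mulrA -size_freqS -mulrA.
have h := IH _ _ (erw_op_ge0 f0).
have {h}h2 : p * j.+1%:R / m.+1%:R * Ec m (count j (erw_op j.+1 f) m.+1) <=
    dom j * ((1 + p * j.+2%:R) * X).
  have -> : dom j * ((1 + p * j.+2%:R) * X) = p * j.+1%:R / m.+1%:R *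
      (dom j * (m.+1%:R * (size_freq j * erw_mean j (erw_op j.+1 f)))).
    by rewrite -XE; field; rewrite nat1r pnatr_eq0.
  by rewrite ler_wpM2l// divr_ge0// mulr_ge0// ltW.
(* For [j < m] the old count has a nonnegative coefficient and the induction hypothesis applies to
   it; otherwise size [j + 2] exceeds the time [m + 1] and the old count vanishes. *)
have [jm|mj] := ltnP j m.
  have h1 := IH _ _ f0; rewrite -/X in h1.
  have q : 0 <= 1 - p * j.+2%:R / m.+1%:R.
    rewrite subr_ge0 ler_pdivrMr// mul1r (@le_trans _ _ j.+2%:R)//.
      by rewrite ler_piMl// ltW.
    by rewrite ler_nat.
  apply: le_trans (lerD (ler_wpM2l q h1) h2) _; rewrite mS.
  have -> : (1 - p * j.+2%:R / m.+1%:R) * (dom j.+1 * (m.+1%:R * X)) =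
      dom j.+1 * X * (m.+1%:R - p * j.+2%:R).
    by field; rewrite nat1r pnatr_eq0.
  have : dom j * ((1 + p * j.+2%:R) * X) <= dom j.+1 * ((1 + p * j.+2%:R) * X).
    by rewrite ler_wpM2r ?dom_le// mulr_ge0// addr_ge0// mulr_ge0// ltW.
  move: (dom j.+1) (dom j) (m.+1%:R) => a b c; lra.
rewrite (eq_cexp _ _ (H := fun=> 0)) => [|x]; last by rewrite count_gt.
rewrite cexp_cst mulr0 add0r.
(* For [j = m] the cluster contains every step, and the extra factor of [dom] compensates the ratio
   of [1 + p (m + 2)] to [m + 2]. *)
have [jm|jm] := eqVneq j m.
  apply: le_trans h2 _; rewrite mulrA [leRHS]mulrA ler_wpM2r// -jm domS -mulrA ler_pM2l ?dom_gt0//.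
  by rewrite -ler_pdivrMr ?ltr0n// le_max lexx orbT.
rewrite (eq_cexp _ _ (H := fun=> 0)) => [|x].
  by rewrite cexp_cst mulr0; apply: mulr_ge0; [exact/ltW/dom_gt0|exact: mulr_ge0].
by rewrite count_gt// ltn_neqAle eq_sym jm.
Qed.

Let deviation j f m c := count j f m.+1 c - m.+1%:R * (size_freq j * erw_mean j f).

Lemma le_sum_options m (G H : choice3 -> R) : {in options m.+1, forall x, G x <= H x} ->
  \sum_(x <- options m.+1) weight m x * G x <= \sum_(x <- options m.+1) weight m x * H x.
Proof.
move=> GH; rewrite big_seq [leRHS]big_seq; apply: ler_sum => x xo.
by rewrite ler_wpM2l ?weight_ge0// GH.
Qed.

(** Only the cluster of the copied step changes, by [sum_copy_le1], and its old and new
    contributions are at most [M] each. *)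
Lemma count_step j f m c x (M : R) : (forall w, `|w| <= j.+1%:R -> `|f w| <= M) ->
  x \in options m.+1 ->
  `|count j f m.+2 (upd c m.+2 x) - count j f m.+1 c| <= 2 * M.
Proof.
move=> fM; have M0 : 0 <= M by rewrite (le_trans _ (fM 0 _)) ?normr0.
pose g k w := (k == j.+1)%:R * f w; have g0 : g 0%N 0 = 0 by rewrite /g mul0r.
have gM k w : `|w| <= k%:R -> `|g k w| <= M.
  rewrite /g; case: eqP => [->|_ _]; last by rewrite mul0r normr0.
  by rewrite mul1r; exact: fM.
move=> /allpairsP[[v [e h]] [vm _ ->]]; rewrite /count.
have {}vm : (1 <= v <= m.+1)%N by move: vm; rewrite mem_iota add1n.
rewrite /=.
case: e; last first.
  rewrite csum_new// addrC addKr (le_trans (gM _ _ _)) ?normr1//.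
  by rewrite ler_peMl// ler1n.
rewrite csum_copy// /csum -sumrB (le_trans (ler_norm_sum _ _ _))//.
apply: le_trans (_ : \sum_(1 <= i < m.+2) 2 * M * `|copy c i v| <= _); last first.
  by rewrite -mulr_sumr ler_piMr ?sum_copy_le1// mulr_ge0.
apply: ler_sum => i _; have [->|cn0] := eqVneq (copy c i v) 0.
  by rewrite oppr0 if_same addn0 addr0 subrr !normr0 mulr0.
have c1 : `|copy c i v| = 1 by rewrite normr_copy cn0.
rewrite c1 mulr1 (le_trans (ler_normB _ _))// (_ : 2 * M = M + M); last by ring.
rewrite lerD//; last first.
  by apply: gM; exact: cweight_le.
apply: gM; rewrite addn1 -natr1 (le_trans (ler_normD _ _))// lerD ?cweight_le//.
by case: h; rewrite ?normrN c1.
Qed.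

(** The mean increment pulls the deviation [D] back at rate [p (j + 1)] and is forced by [a e]. As
    [2 D e <= D^2 + e^2] and [a <= p (j + 1)], the cross term is absorbed, and each step adds at
    most [a C] from the forcing and [L^2] from the jump to the second moment. *)
Let deviation_step j f (M a C : R) (e : nat -> config -> R) :
  (forall w, `|w| <= j.+1%:R -> `|f w| <= M) -> 0 <= a <= p * j.+1%:R -> 0 <= C ->
  (forall m c, \sum_(x <- options m.+1) weight m x *
      (count j f m.+2 (upd c m.+2 x) - count j f m.+1 c - size_freq j * erw_mean j f) =
    (- (p * j.+1%:R) * deviation j f m c + a * e m c) / m.+1%:R) ->
  (forall m, Ec m (fun c => e m c ^+ 2) <= C * m.+1%:R) ->
  exists2 C' : R, 0 <= C' & forall m, Ec m (fun c => deviation j f m c ^+ 2) <= C' * m.+1%:R.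
Proof.
move=> fM /andP[a0 ap] C0 avg eC.
have M0 : 0 <= M by rewrite (le_trans _ (fM 0 _)) ?normr0.
set b := size_freq j * erw_mean j f in avg *.
pose L := 2 * M + `|b|; have L0 : 0 <= L by rewrite addr_ge0// mulr_ge0.
exists (a * C + L ^+ 2); first by rewrite addr_ge0 ?sqr_ge0// mulr_ge0.
elim=> [|m IH].
  rewrite cexp0 mulr1 ler_wpDl ?mulr_ge0// /deviation -/b mul1r.
  rewrite -[X in X <= _]real_normK ?num_real// ler_pXn2r ?nnegrE//.
  rewrite (le_trans (ler_normB _ _))// /L lerD2r.
  by rewrite (le_trans (normr_count _ _ fM))// mulr1 ler_peMl// ler1n.
have m0 : 0 < m.+1%:R :> R by rewrite ltr0n.
rewrite cexpS; apply: le_trans (_ : Ec m (fun c => deviation j f m c ^+ 2 +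
  (a / m.+1%:R * e m c ^+ 2 + L ^+ 2)) <= _).
  apply: le_cexp => c; pose D := deviation j f m c.
  pose del x := count j f m.+2 (upd c m.+2 x) - count j f m.+1 c - b.
  have avg' : \sum_(x <- options m.+1) weight m x * del x =
    (- (p * j.+1%:R) * D + a * e m c) / m.+1%:R := avg m c.
  have -> : \sum_(x <- options m.+1) weight m x * deviation j f m.+1 (upd c m.+2 x) ^+ 2 =
      D ^+ 2 + 2 * D * (\sum_(x <- options m.+1) weight m x * del x) +
      \sum_(x <- options m.+1) weight m x * del x ^+ 2.
    have D2 : D ^+ 2 = \sum_(x <- options m.+1) weight m x * D ^+ 2.
      by rewrite -mulr_suml sum_options1 mul1r.
    rewrite [X in X + _ + _]D2 mulr_sumr -!big_split/=.
    apply: eq_bigr => x _; rewrite /del /D /deviation -/b -natr1; ring.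
  have h1 : \sum_(x <- options m.+1) weight m x * del x ^+ 2 <= L ^+ 2.
    have -> : L ^+ 2 = \sum_(x <- options m.+1) weight m x * L ^+ 2.
      by rewrite -mulr_suml sum_options1 mul1r.
    apply: le_sum_options => x xo.
    rewrite -[X in X <= _]real_normK ?num_real// ler_pXn2r ?nnegrE//.
    by rewrite (le_trans (ler_normB _ _))// lerD2r; exact: count_step.
  rewrite -!addrA lerD2l lerD// avg' mulrA ler_pdivrMr//.
  rewrite [a / _ * _]mulrAC divfK ?gt_eqF//.
  have : a * D ^+ 2 <= p * j.+1%:R * D ^+ 2 by rewrite ler_wpM2r// sqr_ge0.
  have : 0 <= a * (D - e m c) ^+ 2 by rewrite mulr_ge0// sqr_ge0.
  have : 0 <= p * j.+1%:R * D ^+ 2 by rewrite mulr_ge0 ?sqr_ge0// (le_trans a0).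
  clear; clearbody D; move: (e m c) (p * j.+1%:R) => x q.
  have -> : a * (D - x) ^+ 2 = a * D ^+ 2 - 2 * (a * (D * x)) + a * x ^+ 2 by ring.
  have -> : 2 * D * (- q * D + a * x) = 2 * (a * (D * x)) - 2 * (q * D ^+ 2) by ring.
  lra.
rewrite cexpD cexpD cexpZ cexp_cst -[m.+2%:R]natr1 mulrDr mulr1 lerD// lerD2r.
apply: le_trans (ler_wpM2l _ (eC m)) _; first by rewrite divr_ge0// ltW.
by rewrite mulrCA mulrC divfK ?gt_eqF// mulrC.
Qed.

(** Induction on the size: the forcing for size [j + 2] and [f] is the deviation for size [j + 1]
    and [erw_op j.+1 f], a test function with the same bound [M]. *)
Lemma cexp_deviation j f (M : R) : (forall w, `|w| <= j.+1%:R -> `|f w| <= M) ->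
  exists2 C : R, 0 <= C & forall m, Ec m (fun c => deviation j f m c ^+ 2) <= C * m.+1%:R.
Proof.
have [p0 _] := andP p01; have p1' : 1 + p != 0 by rewrite gt_eqF// addr_gt0.
elim: j f M => [|j IH] f M fM.
  apply: (@deviation_step 0 f M 0 0 (fun _ _ => 0)) => //.
  - by rewrite lexx mulr1 ltW.
  - move=> m c; rewrite (eq_bigr (fun x => weight m x * count 0 f m.+2 (upd c m.+2 x) +
      weight m x * (- count 0 f m.+1 c - size_freq 0 * erw_mean 0 f))); last first.
      by move=> x _; ring.
    rewrite big_split/= -mulr_suml sum_options1 mul1r sum_options_count /deviation /=.
    by field; rewrite p1' nat1r pnatr_eq0.
  by move=> m; rewrite (eq_cexp _ _ (H := fun=> 0)) ?cexp_cst ?mul0r// => c; rewrite expr0n.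
have opM w : `|w| <= j.+1%:R -> `|erw_op j.+1 f w| <= M.
  move=> wj; have cstE x : erw_op j.+1 (fun=> M) x = M.
    by rewrite /erw_op; field; rewrite nat1r pnatr_eq0.
  have h1 := @erw_op_ge0 j (fun w => M + (-1) * f w) _ w wj.
  have h2 := @erw_op_ge0 j (fun w => M + f w) _ w wj.
  rewrite ler_norml; move: h1 h2; rewrite !erw_opD erw_opZ cstE => h1 h2.
  have {}h1 : 0 <= M + -1 * erw_op j.+1 f w.
    by apply: h1 => x /fM; rewrite ler_norml; lra.
  have {}h2 : 0 <= M + erw_op j.+1 f w.
    by apply: h2 => x /fM; rewrite ler_norml; lra.
  lra.
have [C C0 hC] := IH _ _ opM.
apply: (@deviation_step j.+1 f M (p * j.+1%:R) C (fun m c => deviation j (erw_op j.+1 f) m c)) => //.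
  by rewrite mulr_ge0 ?(ltW p0)// ler_wpM2l ?(ltW p0)// ler_nat.
move=> m c; rewrite (eq_bigr (fun x => weight m x * count j.+1 f m.+2 (upd c m.+2 x) +
    weight m x * (- count j.+1 f m.+1 c - size_freq j.+1 * erw_mean j.+1 f))); last first.
  by move=> x _; ring.
rewrite big_split; cbv beta.
rewrite -mulr_suml sum_options1 mul1r sum_options_count /deviation.
have := size_freqS j; rewrite [erw_mean j.+1 f]/=.
set E := erw_mean j _; set x := size_freq j.+1; set y := size_freq j => xy.
have xyE : p * j.+1%:R * (y * E) = (1 + p * j.+2%:R) * (x * E).
  by rewrite mulrA -xy -mulrA.
apply: (@mulIf _ m.+1%:R); first by rewrite pnatr_eq0.
rewrite divfK ?pnatr_eq0// -[LHS]/((_ + _) * _).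
have -> : p * j.+1%:R * (count j (erw_op j.+1 f) m.+1 c - m.+1%:R * (y * E)) =
  p * j.+1%:R * count j (erw_op j.+1 f) m.+1 c - m.+1%:R * ((1 + p * j.+2%:R) * (x * E)).
  by rewrite -xyE; ring.
by field; rewrite nat1r pnatr_eq0.
Qed.

End walk.

End forest.

(** * Moments of the elephant random walk *)

Section moments.
Context {R : realType}.
Variables (p r : R).
Hypothesis p01 : 0 < p < 1.
Hypothesis r01 : 0 <= r <= 1.
Let rho := 2 * r - 1.

(** Tangent at 1 of a concave power, obtained from Young's inequality with exponents [1 / s] and
    [1 / (1 - s)]. *)
Lemma powR_le_affine (x s : R) : 0 <= x -> 0 < s < 1 -> x `^ s <= 1 + s * (x - 1).
Proof.
move=> x0 /andP[s0 s1]; have q0 : 0 < 1 - s by rewrite subr_gt0.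
have := @conjugate_powR R (x `^ s) 1 s^-1 (1 - s)^-1 (powR_ge0 _ _) ler01.
rewrite !invr_gt0 !invrK mulr1 powR1 mul1r -powRrM mulfV ?gt_eqF// powRr1//.
by move=> /(_ s0 q0); rewrite addrC subrK => /(_ erefl); lra.
Qed.

(** Of order [j^gamma]: the comparison sequence for moment recursions of ratio [1 + gamma / j]. *)
Fixpoint growth (gamma : R) j : R :=
  if j is j'.+1 then growth gamma j' * (1 + gamma / j%:R) else 1.

Lemma growthS gamma j : growth gamma j.+1 = growth gamma j * (1 + gamma / j.+1%:R).
Proof. by []. Qed.

(** For [gamma = 2] the product telescopes to [(j + 1) (j + 2) / 2]. *)
Lemma growth_ge gamma j : 2 <= gamma -> j.+1%:R ^+ 2 / 2 <= growth gamma j.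
Proof.
move=> g2; suff : j.+1%:R * j.+2%:R / 2 <= growth gamma j.
  apply: le_trans; rewrite expr2 -!mulrA ler_wpM2l// ler_wpM2r// ler_nat//.
elim: j => [|j IH]; first by rewrite /= mul1r divff.
rewrite growthS; have j0 : 0 < j.+1%:R :> R by rewrite ltr0n.
have h : j.+3%:R / j.+1%:R <= 1 + gamma / j.+1%:R.
  have -> : j.+3%:R = j.+1%:R + 2 :> R by rewrite -[j.+3]addn2 natrD.
  by rewrite mulrDl divff ?gt_eqF// lerD2l ler_wpM2r// invr_ge0 ltW.
have -> : j.+2%:R * j.+3%:R / 2 = (j.+1%:R * j.+2%:R / 2) * (j.+3%:R / j.+1%:R) :> R.
  by field; rewrite nat1r pnatr_eq0.
by rewrite ler_pM// ?divr_ge0// mulr_ge0.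
Qed.

Lemma growth_ge1 gamma j : 0 <= gamma -> 1 <= growth gamma j.
Proof.
move=> g0; elim: j => // j IH; rewrite growthS -[leLHS]mulr1 ler_pM//.
by rewrite lerDl divr_ge0.
Qed.

(** One step multiplies the fourth moment by [1 + 4 rho / k] and adds terms of order [w^2].
    Completing a square trades these for [e w^4 / k] and a term of order [k]; the latter fits in the
    room between [4 rho + e] and [gamma = 4 rho + 2 e], because [growth gamma] is at least
    [k^2 / 2]. *)
Lemma erw_mean_pow4 gamma : 2 <= gamma -> 4 * rho < gamma ->
  exists2 C : R, 0 <= C & forall j, erw_mean r j (fun w => w ^+ 4) <= C * growth gamma j.
Proof.
move=> g2 g4; have [r0 r1] := andP r01; pose e := (gamma - 4 * rho) / 2; have e0 : 0 < e by rewrite /e; lra.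
(* Chosen so that [25 / e + 1 <= C e / 2]; 25 is the square of half of 10, which bounds the
   coefficient [6 + 4 rho / k] of [w^2]. *)
pose C := 2 * (25 / e + 1) / e + 1.
have C0 : 0 <= C.
  by rewrite /C addr_ge0// divr_ge0 ?(ltW e0)// mulr_ge0// addr_ge0// divr_ge0// ltW.
have C1 : 1 <= C.
  by rewrite /C lerDr divr_ge0 ?(ltW e0)// mulr_ge0// addr_ge0// divr_ge0// ltW.
have Ce : 25 / e + 1 <= C * e / 2.
  have -> : C * e / 2 = 25 / e + 1 + e / 2 by rewrite /C; field; rewrite gt_eqF.
  by rewrite lerDl divr_ge0// ltW.
clearbody C.
exists C => //; elim=> [|j IH]; first by rewrite /= expr1n mulr1.
have k0 : 0 < j.+1%:R :> R by rewrite ltr0n.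
have k1 : 1 <= j.+1%:R :> R by rewrite ler1n.
have Vk := growth_ge j g2.
rewrite growthS [erw_mean _ _ _]/=.
set k : R := j.+1%:R in k0 k1 Vk *; set V := growth gamma j in IH Vk *.
apply: le_trans (_ : erw_mean r j (fun w => (1 + (4 * rho + e) / k) * w ^+ 4 +
  (25 / e + 1) * k) <= _).
  apply: le_erw_mean => // w _; rewrite /erw_op -/k -/rho.
  have -> : (1 + rho * w / k) / 2 * (w + 1) ^+ 4 + (1 - rho * w / k) / 2 * (w - 1) ^+ 4 =
    (1 + 4 * rho / k) * w ^+ 4 + 6 * w ^+ 2 + 4 * (rho / k) * w ^+ 2 + 1.
    by field; rewrite gt_eqF.
  have -> : (1 + (4 * rho + e) / k) * w ^+ 4 + (25 / e + 1) * k =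
    (1 + 4 * rho / k) * w ^+ 4 + 10 * w ^+ 2 + e / k * (w ^+ 2 - 5 * k / e) ^+ 2 + k.
    by field; rewrite !gt_eqF.
  have h1 : 0 <= e / k * (w ^+ 2 - 5 * k / e) ^+ 2.
    by apply: mulr_ge0; [exact: divr_ge0 (ltW e0) (ltW k0)|exact: sqr_ge0].
  have h2 : rho / k * w ^+ 2 <= w ^+ 2.
    apply: ler_piMl; first exact: sqr_ge0.
    by rewrite ler_pdivrMr// mul1r (le_trans _ k1)// /rho; lra.
  rewrite -[4 * (rho / k) * _]mulrA; move: h1 h2 k1; clear.
  clearbody k; set x := e / k * _; set y := rho / k * _; set z := (1 + _) * _.
  by clearbody x y z; lra.
rewrite erw_meanD erw_meanZ erw_mean_cst//.
have q : 0 <= 1 + (4 * rho + e) / k.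
  have -> : 1 + (4 * rho + e) / k = (k + (4 * rho + e)) / k by field; rewrite gt_eqF.
  by apply: divr_ge0 (ltW k0); rewrite /e /rho; lra.
apply: le_trans (lerD (ler_wpM2l q IH) (lexx _)) _.
have -> : C * (V * (1 + gamma / k)) = (1 + (4 * rho + e) / k) * (C * V) + C * e / k * V.
  by rewrite /e; field; rewrite gt_eqF.
rewrite lerD2l; apply: le_trans (ler_wpM2r (ltW k0) Ce) _.
have -> : C * e / 2 * k = C * e / k * (k ^+ 2 / 2) by field; rewrite gt_eqF.
apply: ler_wpM2l Vk; apply: divr_ge0 (ltW k0); exact: mulr_ge0 C0 (ltW e0).
Qed.

(** Jensen's inequality in affine form: with [s = beta / 4] and [V] the growth of the fourth moment,
    [|w|^beta = V^s (w^4 / V)^s] is at most [V^s (1 + w^4 / V)]. *)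
Lemma erw_mean_powR gamma beta : 2 <= gamma -> 4 * rho < gamma -> 0 < beta < 4 ->
  exists2 C : R, 0 <= C & forall j, erw_mean r j (fun w => 1 + `|w| `^ beta) <=
    C * growth gamma j `^ (beta / 4).
Proof.
move=> g2 g4 /andP[b0 b4]; have [C C0 hC] := erw_mean_pow4 g2 g4.
have s01 : 0 < beta / 4 < 1 by rewrite divr_gt0//= ltr_pdivrMr// mul1r.
have [s0 s1] := andP s01; set s := beta / 4 in s01 s0 s1 *.
exists (2 + C); first by rewrite addr_ge0.
move=> j; set V := growth gamma j; have V1 : 1 <= V by apply: growth_ge1; lra.
have V0 : 0 < V by rewrite (lt_le_trans _ V1).
have Vs0 : 0 <= V `^ s by exact: powR_ge0.
have Vs : 1 <= V `^ s.
  have : 1 `^ s <= V `^ s by rewrite ge0_ler_powR ?nnegrE ?(ltW s0)// ltW.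
  by rewrite powR1.
apply: le_trans (_ : erw_mean r j (fun w => 2 * V `^ s + V `^ s / V * w ^+ 4) <= _).
  apply: le_erw_mean => // w _.
  have w4 : w ^+ 4 = `|w| ^+ 4 by rewrite -normrX ger0_norm// exprn_even_ge0.
  have -> : `|w| `^ beta = (w ^+ 4 / V) `^ s * V `^ s.
    rewrite -powRM ?(ltW V0) ?divr_ge0 ?(ltW V0) ?exprn_even_ge0// divfK ?gt_eqF//.
    by rewrite w4 -powR_mulrn// -powRrM /s mulrC divfK.
  have h1 : 0 <= w ^+ 4 / V by rewrite divr_ge0 ?(ltW V0)// exprn_even_ge0.
  have := powR_le_affine h1 s01; set z := w ^+ 4 / V in h1 *; set y := z `^ s => hy.
  have yz : y <= 1 + z by rewrite (le_trans hy)//; nra.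
  have : y * V `^ s <= (1 + z) * V `^ s by rewrite ler_wpM2r.
  have -> : V `^ s / V * w ^+ 4 = z * V `^ s by rewrite /z; ring.
  by clear -Vs; move: (V `^ s) Vs => v v1; lra.
rewrite erw_meanD erw_mean_cst (erw_meanZ r j (V `^ s / V)) [leRHS]mulrDl lerD2l.
apply: le_trans (ler_wpM2l _ (hC j)) _; first exact: divr_ge0 Vs0 (ltW V0).
by rewrite mulrCA -[_ / V * V]mulrA mulVf ?mulr1// gt_eqF.
Qed.

(** The terms satisfy [(1 + p (j + 2)) u (j + 1) <= p (j + 1 + gamma s) u j], so
    [(1 + p (j + 1)) u j] decreases by at least [(1 - p gamma s) u j] at each step and the sum
    telescopes. *)
Lemma sum_size_freq_growth gamma s : 0 < s < 1 -> 0 <= gamma -> p * (gamma * s) < 1 ->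
  forall n, \sum_(j < n) size_freq p j * growth gamma j `^ s <=
    (1 + p) * size_freq p 0 / (1 - p * (gamma * s)).
Proof.
move=> s01 g0 pgs n; have [p0 p1] := andP p01; have [s0 s1] := andP s01.
have p01' : 0 < p <= 1 by rewrite p0 ltW.
set q := 1 - _; have q0 : 0 < q by rewrite subr_gt0.
pose u j := size_freq p j * growth gamma j `^ s.
have u0 j : 0 <= u j by rewrite mulr_ge0 ?powR_ge0// ltW// size_freq_gt0.
have uS j : (1 + p * j.+2%:R) * u j.+1 <= p * (j.+1%:R + gamma * s) * u j.
  rewrite /u mulrA (size_freqS p01') growthS powRM; last 2 first.
  - by rewrite (le_trans _ (growth_ge1 _ g0)).
  - by rewrite addr_ge0// divr_ge0.
  have j0 : 0 < j.+1%:R :> R by rewrite ltr0n.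
  have := @powR_le_affine (1 + gamma / j.+1%:R) s _ s01.
  rewrite addr_ge0 ?divr_ge0// => /(_ isT); rewrite [1 + _ - 1]addrC addKr => h.
  have -> : p * (j.+1%:R + gamma * s) * (size_freq p j * growth gamma j `^ s) =
    p * j.+1%:R * size_freq p j * (growth gamma j `^ s * (1 + s * (gamma / j.+1%:R))).
    by field; rewrite nat1r pnatr_eq0.
  rewrite ler_wpM2l ?mulr_ge0 ?(ltW p0)//; first exact/ltW/size_freq_gt0.
  by rewrite ler_wpM2l ?powR_ge0.
rewrite ler_pdivlMr//.
suff claim : p * n.+1%:R * u n + u n + q * \sum_(j < n) u j <= (1 + p) * size_freq p 0.
  have : 0 <= p * n.+1%:R * u n by rewrite mulr_ge0 ?u0// mulr_ge0// ltW.
  by have := u0 n; rewrite [X in _ -> _ -> X <= _]mulrC -/u; move: claim; rewrite /u; lra.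
elim: n => [|n IH].
  by rewrite big_ord0 mulr0 addr0 mulr1 /u [growth _ _]/= powR1 mulr1; lra.
apply: le_trans IH; have -> : \sum_(j < n.+1) u j = \sum_(j < n) u j + u n.
  by rewrite big_ord_recr.
by have := uS n; rewrite /q; set k := n.+2%:R; set l := n.+1%:R; clearbody k l; lra.
Qed.

(** [g0 alpha / 4] is the larger of [alpha / 2] and [rho alpha]; times [p] it is below 1, in the
    first case since [alpha <= 2] and [p < 1], in the second by hypothesis. Strictness leaves room
    to raise both exponents by [e]. *)
Lemma sum_size_freq_bound alpha : 0 < alpha <= 2 -> rho * alpha * p < 1 ->
  exists2 beta, alpha < beta & exists C : R, forall n,
    \sum_(j < n) size_freq p j * erw_mean r j (fun w => 1 + `|w| `^ beta) <= C.
Proof.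
move=> /andP[a0 a2] sub; have [p0 p1] := andP p01; have [r0 r1] := andP r01.
pose g0 := Num.max 2 (4 * rho).
have g0a : p * (g0 * (alpha / 4)) < 1.
  rewrite /g0; case: (leP 2 (4 * rho)) => _; nra.
have rho1 : rho <= 1 by rewrite /rho; lra.
have [g02 g0r g04] : [/\ 2 <= g0, 4 * rho <= g0 & g0 <= 4].
  by rewrite /g0 !le_max !ge_max !lexx orbT; split => //; apply/andP; split; lra.
clearbody g0.
(* As [g0 <= 4], [alpha <= 2] and [e <= 1], the raised product exceeds the old one by at most
   [7 e / 4], less than the slack, which is at least [4 e]. *)
pose e := Num.min 1 ((1 - p * (g0 * (alpha / 4))) / 4).
have [e0 e1 e2] : [/\ 0 < e, e <= 1 & e <= (1 - p * (g0 * (alpha / 4))) / 4].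
  by rewrite /e lt_min ltr01 divr_gt0 ?subr_gt0// !ge_min !lexx orbT.
clearbody e.
pose gamma := g0 + e; pose beta := alpha + e.
have g2 : 2 <= gamma by rewrite /gamma; lra.
have g4 : 4 * rho < gamma by rewrite /gamma; lra.
have b4 : 0 < beta < 4 by rewrite /beta; apply/andP; split; lra.
have s01 : 0 < beta / 4 < 1 by rewrite /beta; apply/andP; split; lra.
have pgs : p * (gamma * (beta / 4)) < 1.
  have -> : p * (gamma * (beta / 4)) = p * (g0 * (alpha / 4)) + p * (e * (g0 + alpha + e) / 4).
    by rewrite /gamma /beta; field.
  have h : e * (g0 + alpha + e) / 4 <= 7 / 4 * e by nra.
  have : p * (e * (g0 + alpha + e) / 4) <= 1 * (7 / 4 * e).
    by apply: ler_pM; [lra|apply: divr_ge0 => //; apply: mulr_ge0; lra|lra|].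
  lra.
exists beta; first by rewrite /beta; lra.
have [C C0 hC] := erw_mean_powR g2 g4 b4.
exists (C * ((1 + p) * size_freq p 0 / (1 - p * (gamma * (beta / 4))))) => n.
have := sum_size_freq_growth s01 (le_trans _ g2) pgs n => /(_ (ler0n _ 2)) h.
apply: le_trans (ler_wpM2l C0 h); rewrite mulr_sumr; apply: ler_sum => j _.
rewrite mulrCA ler_wpM2l//; apply/ltW/size_freq_gt0 => //; lra.
Qed.

End moments.

(** * The beta function *)

Section beta.
Context {R : realType}.
Local Notation mu := (@lebesgue_measure R).

(** [B(m + 1, 1 + z)] on the closed interval; the absolute value makes the integrand continuous on
    the whole line for [z > 0]. *)
Definition beta_moment m (z : R) : R :=
  \int[mu]_(t in `[0, 1]) (t ^+ m * `|1 - t| `^ z).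

Lemma continuous_beta_moment m (z : R) : 0 < z ->
  continuous (fun t : R => t ^+ m * `|1 - t| `^ z).
Proof.
move=> z0 t; apply: cvgM; first exact: exprn_continuous.
apply: (@continuous_comp _ _ _ (fun t : R => 1 - t) (fun x => `|x| `^ z)).
  by apply: cvgB; [exact: cvg_cst|exact: cvg_id].
exact: continuous_norm_powR.
Qed.

Lemma integrable_continuous01 (f : R -> R) : continuous f ->
  mu.-integrable `[0, 1] (EFin \o f).
Proof.
move=> cf; apply: continuous_compact_integrable; first exact: segment_compact.
exact: continuous_subspaceT.
Qed.

Lemma integrable_beta_moment m (z : R) : 0 < z ->
  mu.-integrable `[0, 1] (EFin \o (fun t : R => t ^+ m * `|1 - t| `^ z)).
Proof. by move=> z0; exact/integrable_continuous01/continuous_beta_moment. Qed.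

Lemma betaE m (z : R) : 0 < z -> beta m.+1%:R (1 + z) = beta_moment m z.
Proof.
move=> z0; rewrite /beta_moment -Rintegral_itv_bndo_bndc; last first.
  apply: integrableS (integrable_beta_moment m z0) => //.
  by apply: subset_itvl; rewrite bnd_simp.
rewrite -Rintegral_itv_obnd_cbnd; last first.
  apply: integrableS (integrable_beta_moment m z0) => //.
  by apply: subset_itvW.
apply: eq_Rintegral => t; rewrite inE/= in_itv/= => /andP[t0 t1].
rewrite -natr1 addrK powR_mulrn ?(ltW t0)// [1 + z - 1]addrC addKr.
by rewrite ger0_norm// subr_ge0 ltW.
Qed.

Lemma beta_moment_split m (z : R) : 0 < z ->
  beta_moment m (1 + z) = beta_moment m z - beta_moment m.+1 z.
Proof.
move=> z0; rewrite /beta_moment -RintegralB//; last 2 first.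
- exact: integrable_beta_moment.
- exact: integrable_beta_moment.
apply: eq_Rintegral => t; rewrite inE/= in_itv/= => /andP[t0 t1].
rewrite powRD; last by rewrite gt_eqF ?addr_gt0// implybT.
have h : 0 <= 1 - t by rewrite subr_ge0.
rewrite powRr1 ?normr_ge0// ger0_norm// exprS; ring.
Qed.

(** Integration of the derivative of [t^m (1 - t)^(1 + z)]; the boundary contributes only at 0 and
    for [m = 0]. *)
Lemma beta_moment_parts m (z : R) : 0 < z ->
  (1 + z) * beta_moment m z = if m is m'.+1 then m%:R * beta_moment m' (1 + z) else 1.
Proof.
move=> z0; have z1 : 0 < 1 + z by rewrite addr_gt0.
pose F (t : R) := t ^+ m * (1 - t) `^ (1 + z).
pose f (t : R) := m%:R * (t ^+ m.-1 * `|1 - t| `^ (1 + z)) - (1 + z) * (t ^+ m * `|1 - t| `^ z).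
have cf : continuous f.
  move=> t; apply: cvgB.
    exact: (cvgM (cvg_cst _) (@continuous_beta_moment m.-1 _ z1 t)).
  exact: (cvgM (cvg_cst _) (@continuous_beta_moment m _ z0 t)).
have F01 (t : R) : 0 < t < 1 -> is_derive t 1 F (f t).
  move=> /andP[t0 t1]; have h : 0 < 1 - t by rewrite subr_gt0.
  have d1 : is_derive t 1 (fun s : R => 1 - s) (- 1).
    by rewrite -[- 1]sub0r; exact: is_deriveB.
  have d2 := @is_derive1_comp _ (fun s => s `^ (1 + z)) (fun s : R => 1 - s) t _ _ (is_derive1_powR (1 + z) h) d1.
  have d3 : is_derive t 1 (fun s : R => s ^+ m) (m%:R * t ^+ m.-1).
    have -> : (fun s : R => s ^+ m) = id ^+ m by apply/funext => s; rewrite exprfctE.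
    by apply: (is_derive_eq (is_deriveX _ (is_derive_id _ _))); rewrite scaler1.
  apply: (is_derive_eq (is_deriveM d3 d2)).
  rewrite /f ger0_norm ?(ltW h)// [1 + z - 1]addrC addKr /GRing.scale/=; ring.
have cG := @continuous_beta_moment m _ z1.
have F_end (t : R) (B : set_system R) : Filter B -> (\forall s \near B, s <= 1) -> t <= 1 ->
    B `=>` nbhs t -> F s @[s --> B] --> F t.
  move=> FB B1 t1 Bt; have -> : F t = t ^+ m * `|1 - t| `^ (1 + z).
    by rewrite /F ger0_norm// subr_ge0.
  apply: (@cvg_trans _ ((s ^+ m * `|1 - s| `^ (1 + z)) @[s --> B])).
    apply: near_eq_cvg; near=> s; rewrite /F ger0_norm// subr_ge0.
    by near: s.
  by apply: cvg_trans (cG t); exact: cvg_fmap2.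
have cF : derivable_oo_LRcontinuous F 0 1.
  split.
  - by move=> t; rewrite in_itv/= => /F01 h; exact: ex_derive.
  - apply: F_end => //; last exact: cvg_within.
    by near=> t; near: t; exact: nbhs_right_le.
  - apply: F_end => //; last exact: cvg_within.
    by near=> t; near: t; exact: nbhs_left_le.
have := continuous_FTC2 ltr01 (continuous_subspaceT cf) cF.
have F'f : {in `]0, 1[, F^`()%classic =1 f}.
  by move=> t; rewrite in_itv/= => /F01 h; rewrite derive1E derive_val.
move=> /(_ F'f); rewrite /F subrr powR0 ?gt_eqF// mulr0 subr0 powR1 mulr1 => h.
have : \int[mu]_(t in `[0, 1]) f t = - 0 ^+ m by rewrite /Rintegral h -EFinB sub0r.
have i1 := integrable_continuous01 (@continuous_beta_moment m.-1 _ z1).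
have i2 := integrable_continuous01 (@continuous_beta_moment m _ z0).
have Zi (k : R) (g : R -> R) : mu.-integrable `[0, 1] (EFin \o g) ->
    mu.-integrable `[0, 1] (EFin \o (fun t => k * g t)).
  move=> ig; rewrite (_ : EFin \o _ = (fun t => k%:E * (EFin \o g) t)%E)//.
  exact: integrableZl.
rewrite RintegralB ?RintegralZl//; last 2 first.
- exact: Zi.
- exact: Zi.
rewrite -/(beta_moment m.-1 _) -/(beta_moment m _).
set A := m%:R * _; set B := _ * beta_moment m z => /eqP.
rewrite subr_eq addrC -subr_eq opprK => /eqP <-; rewrite {}/A {B}.
by case: (m) => [|n] /=; rewrite ?expr0 ?mul0r ?add0r// exprS mul0r addr0.
Unshelve. all: by end_near.
Qed.

(** Splitting and integration by parts give [(1 + p (j + 2)) B_(j+1) = p (j + 1) B_j] for the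
    moments at [1 / p], the recursion that defines [size_freq]; for [j = 0] the moment is
    [p / (1 + p)]. *)
Lemma size_freq_beta (p : R) j : 0 < p ->
  size_freq p j = (1 - p) / p * beta j.+1%:R (1 + p^-1).
Proof.
move=> p0; have z0 : 0 < p^-1 by rewrite invr_gt0.
have pn : p != 0 by rewrite gt_eqF.
rewrite betaE//; elim: j => [|j IH].
  have := beta_moment_parts 0 z0 => h.
  have -> : beta_moment 0 p^-1 = p / (1 + p).
    have p1 : 1 + p != 0 by rewrite gt_eqF// addr_gt0.
    apply: (@mulfI _ (1 + p^-1)); first by rewrite gt_eqF// addr_gt0.
    by rewrite h; field; rewrite p1 pn.
  by rewrite [LHS]/=; field; rewrite pn gt_eqF// addr_gt0.
have k0 : 0 < 1 + p * j.+2%:R by rewrite addr_gt0// mulr_gt0// ltr0n.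
have h := beta_moment_parts j.+1 z0; rewrite /= beta_moment_split// in h.
rewrite [LHS]/= IH; apply: (mulIf (lt0r_neq0 k0)); rewrite divfK ?gt_eqF//.
have {}h : (1 + p * j.+2%:R) * beta_moment j.+1 p^-1 = p * j.+1%:R * beta_moment j p^-1.
  have -> : p * j.+1%:R * beta_moment j p^-1 = p * (j.+1%:R * (beta_moment j p^-1 - beta_moment j.+1 p^-1)
    + j.+1%:R * beta_moment j.+1 p^-1) by ring.
  by rewrite -h -[j.+2%:R]natr1; field.
by rewrite -[RHS]mulrA [_ * (1 + _)]mulrC h; ring.
Qed.

End beta.

(** * From the walks to finite sums *)

Section deterministic.
Context {R : realType}.
Implicit Types (c z : config).

Lemma srrw_increment_copy c z (x : nat -> R) m k N :
  (forall j, (j < m)%N -> z j.+2 = c j.+2) -> (k <= m.+1)%N -> (k < N)%N ->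
  srrw_increment (fun k => (z k).1.1) (fun k => (z k).1.2) (fun k => (z k).2) x k =
  \sum_(1 <= i < N) copy R c i k * x i.
Proof.
move=> zc; have [n] := ubnP k; elim: n k => // n IH [|[|k]] kn km kN.
- by rewrite big1// => i _; rewrite copy0 mul0r.
- rewrite srrw_increment1 big_ltn// copy1 eqxx mul1r big_nat big1 ?addr0// => i.
  by move=> /andP[i2 _]; rewrite copy1 ltn_eqF// mul0r.
under eq_bigr do rewrite copyE//.
rewrite {1}/srrw_increment [LHS]/recursive_seq {1}/srrw_step !historyE /= zc//.
case: (c k.+2).1.2; last first.
  rewrite (bigD1_seq k.+2) ?iota_uniq ?mem_index_iota//= eqxx mul1r.
  by rewrite big1 ?addr0// => i ik; rewrite eq_sym (negbTE ik) mul0r.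
have [uk|_] := ltnP (c k.+2).1.1 k.+2; last first.
  by rewrite oppr0 !if_same big1// => i _; rewrite mul0r.
rewrite -/(srrw_increment _ _ _ x _) IH ?(leq_trans uk) ?(ltnW kN)//; last by rewrite (leq_trans (ltnW uk)).
case: (c k.+2).2 => //; rewrite -sumrN; apply: eq_bigr => i _; exact: esym (mulNr _ _).
Qed.

Lemma srrw_cweight c z (x : nat -> R) m : (forall j, (j < m)%N -> z j.+2 = c j.+2) ->
  \sum_(1 <= k < m.+2) srrw_increment (fun k => (z k).1.1) (fun k => (z k).1.2)
    (fun k => (z k).2) x k = \sum_(1 <= i < m.+2) cweight R c i m.+1 * x i.
Proof.
move=> zc; transitivity (\sum_(1 <= k < m.+2) \sum_(1 <= i < m.+2) copy R c i k * x i).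
  rewrite big_nat [RHS]big_nat; apply: eq_bigr => k /andP[_ km].
  exact: srrw_increment_copy zc _ _.
by rewrite exchange_big/=; apply: eq_bigr => i _; rewrite mulr_suml.
Qed.

Definition past_valid m c := forall k, (k < m)%N -> (1 <= (c k.+2).1.1 <= k.+1)%N.

Lemma options_range n x : x \in options n -> (1 <= x.1.1 <= n)%N.
Proof.
by move=> /allpairsPdep[v [eh [+ _ ->]]] /=; rewrite mem_iota add1n ltnS.
Qed.

Lemma past_valid_upd m c x : past_valid m c -> x \in options m.+1 ->
  past_valid m.+1 (upd c m.+2 x).
Proof.
move=> cm xm k; rewrite ltnS leq_eqVlt /upd !eqSS => /predU1P[->|km].
  by rewrite eqxx; exact: options_range.
by rewrite ltn_eqF// cm.
Qed.

Lemma eq_sum_configs (V : nmodType) m (F G : config -> V) :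
  (forall c, past_valid m c -> F c = G c) ->
  \sum_(c <- configs m) F c = \sum_(c <- configs m) G c.
Proof.
elim: m F G => [|m IH] F G FG; first by rewrite /= !big_seq1 FG.
rewrite (_ : configs m.+1 = [seq upd c m.+2 x | c <- configs m, x <- options m.+1])//.
rewrite !big_allpairs_dep/=; apply: IH => c cm.
by apply: eq_big_seq => x xm; rewrite FG//; exact: past_valid_upd.
Qed.

Lemma sum_indicator_le1 (s : seq choice3) (x : choice3) : uniq s ->
  \sum_(y <- s) (x == y)%:R <= 1 :> R.
Proof.
move=> us; rewrite -natr_sum lern1 (_ : (\sum_(y <- s) (x == y))%N = count_mem x s).
  by rewrite count_uniq_mem// leq_b1.
by elim: s {us} => [|y s IH]; rewrite ?big_nil// big_cons IH/= eq_sym.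
Qed.

Lemma options_uniq n : uniq (options n).
Proof.
rewrite /options; apply: allpairs_uniq_dep => //; first exact: iota_uniq.
by move=> [v [e h]] [v' [e' h']] _ _ /= [-> -> ->].
Qed.

(** The members of [configs m] differ on the times from 2 to [m + 1], so at most one of them matches
    given choices [z]. *)
Lemma cexp_indicator_le1 z m : cexp (fun k x => (z k.+2 == x)%:R : R) m (fun=> 1) <= 1.
Proof.
elim: m => [|m IH]; first by rewrite cexp0.
rewrite cexpS; apply: le_trans IH; rewrite /cexp; apply: ler_sum => c _.
rewrite ler_wpM2l ?prodr_ge0//.
by under eq_bigr do rewrite mulr1; rewrite sum_indicator_le1// options_uniq.
Qed.

Lemma copy_first c m k : past_valid m c -> (forall j, (j < m)%N -> (c j.+2).1.2) ->
  (1 <= k <= m.+1)%N -> copy R c 1 k != 0 /\ forall i, (2 <= i)%N -> copy R c i k = 0.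
Proof.
move=> vc ec; have [n] := ubnP k; elim: n k => // n IH [|[|k]]//= kn km.
  by rewrite copy1 oner_eq0; split => // i i2; rewrite copy1 ltn_eqF.
have km' : (k < m)%N by [].
have /andP[u1 uk] := vc _ km'.
have [||I1 I2] := IH (c k.+2).1.1.
- exact: leq_ltn_trans uk kn.
- by rewrite u1 (leq_trans uk)// ltnW.
split; last first.
  by move=> i i2; rewrite copyE//= ltnS uk ec// I2// oppr0 if_same.
by rewrite copyE//= ltnS uk ec//; case: (c k.+2).2; rewrite ?oppr_eq0.
Qed.

Lemma count_single f c m : past_valid m c -> (forall j, (j < m)%N -> (c j.+2).1.2) ->
  count m f m.+1 c = f (cweight R c 1 m.+1).
Proof.
move=> vc ec; rewrite /count /csum big_ltn// (_ : csize R c 1 m.+1 = m.+1).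
  rewrite eqxx mul1r big_nat big1 ?addr0// => i /andP[i2 _].
  rewrite /csize big_nat big1 ?mul0r// => k /andP[k1 km].
  by have [|_ ->//] := copy_first vc ec (k := k); rewrite ?k1// eqxx.
rewrite /csize big_nat (eq_bigr (fun=> 1%N)); first by rewrite -big_nat sum_nat_const_nat subn1 muln1.
move=> k /andP[k1 km].
by have [|->//] := copy_first vc ec (k := k); rewrite ?k1.
Qed.

End deterministic.

(** * Total expectation over configurations *)

Section total_expectation.
Context d (T : measurableType d) (R : realType) (P : probability T R).
Variables (p r : R) (Z : nat -> T -> choice3).
Hypothesis mZ : forall k x, measurable (Z k @^-1` [set x]).

Definition past_event m (c : config) : set T :=
  \bigcap_(k in `I_m) (Z k.+2 @^-1` [set c k.+2]).

Lemma measurable_past_event m c : measurable (past_event m c).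
Proof. by apply: fin_bigcap_measurable => [|k _]; [exact: finite_II|exact: mZ]. Qed.

Lemma indic_past_event m c w : \1_(past_event m c) w =
  \prod_(k < m) (Z k.+2 w == c k.+2)%:R :> R.
Proof.
rewrite indicE; have [/set_mem h|/negP h] := boolP (w \in past_event m c).
  by rewrite big1// => k _; rewrite (h k)//= eqxx.
apply/esym; apply/eqP; rewrite prodf_seq_eq0.
have [k km zk] : exists2 k, (k < m)%N & Z k.+2 w <> c k.+2.
  by apply: contrapT => H; apply/h/mem_set => k km; apply: contrapT => zk; apply: H; exists k.
apply/hasP; exists (Ordinal km); first by rewrite mem_index_enum.
by rewrite /= pnatr_eq0 eqb0; apply/eqP.
Qed.

Hypothesis lawZ : forall m c, past_valid m c ->
  P (past_event m c) = (\prod_(k < m) weight p r k (c k.+2))%:E.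

Lemma Ex_past_event m c : past_valid m c ->
  Ex P (\1_(past_event m c)) = \prod_(k < m) weight p r k (c k.+2).
Proof. by move=> vc; rewrite Ex_indic ?lawZ//; exact: measurable_past_event. Qed.

(** The events [past_event m c] are disjoint and their probabilities, products of [weight], add up
    to 1. The remaining event, where a choice leaves its range, is therefore null: the error is at
    most [M (1 - K)], and [K] has mean 1. *)
Lemma total_Ex m (F : T -> R) : bounded_rv F ->
  Ex P F = \sum_(c <- configs m) Ex P (fun w => \1_(past_event m c) w * F w).
Proof.
move=> bF; have [M [M0 FM mF]] := bounded_rvP bF.
pose K w : R := \sum_(c <- configs m) \1_(past_event m c) w.
have b1 c : bounded_rv (\1_(past_event m c) : T -> R).
  exact/bounded_rv_indic/measurable_past_event.
have bK : bounded_rv K by exact: bounded_rv_sum.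
have K1 w : K w <= 1.
  apply: le_trans (cexp_indicator_le1 (fun k => Z k w) m); rewrite /cexp.
  by apply: ler_sum => c _; rewrite mulr1 indic_past_event.
have EK : Ex P K = 1.
  rewrite Ex_sum// (eq_sum_configs (G := fun c => (\prod_(k < m) weight p r k (c k.+2)) * 1)).
    exact: cexp_cst.
  by move=> c vc; rewrite Ex_past_event// mulr1.
rewrite -Ex_sum => [|c]; last exact: bounded_rvM.
apply/eqP; rewrite -subr_eq0 -normr_le0.
have bKF : bounded_rv (fun w => \sum_(c <- configs m) \1_(past_event m c) w * F w).
  by apply: bounded_rv_sum => c; exact: bounded_rvM.
rewrite -ExB//; apply: le_trans (normr_Ex _ (bounded_rvB bF bKF)) _.
have E0 : Ex P (fun w => M * (1 - K w)) = 0.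
  have bc := @bounded_rv_cst _ T R 1.
  by rewrite ExZ ?ExB ?EK ?Ex_cst ?subrr ?mulr0//; exact: bounded_rvB.
rewrite -[leRHS]E0; apply: le_Ex.
- split; last first.
    have [_ [N hN]] := bounded_rvB bF bKF; exists N => w; rewrite normr_id; exact: hN.
  by apply: measurableT_comp => //; case: (bounded_rvB bF bKF).
- by apply: bounded_rvZ; apply: bounded_rvB => //; exact: bounded_rv_cst.
move=> w /=; rewrite -mulr_suml -[X in X - _]mul1r -mulrBl -/(K w) normrM mulrC.
rewrite (@ger0_norm _ (1 - K w)) ?subr_ge0//.
by rewrite ler_wpM2r ?subr_ge0.
Qed.

Lemma total_EC m (F : T -> R[i]) : bounded_rvC F ->
  EC P F = \sum_(c <- configs m) EC P (fun w => (\1_(past_event m c) w)%:C%C * F w).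
Proof.
move=> [bR bI]; pose X c w : R := \1_(past_event m c) w * complex.Re (F w).
pose Y c w : R := \1_(past_event m c) w * complex.Im (F w).
transitivity (\sum_(c <- configs m) Complex (Ex P (X c)) (Ex P (Y c))).
  rewrite /EC (total_Ex m bR) (total_Ex m bI).
  elim: (configs m) => [|c s IH]; first by rewrite !big_nil.
  by rewrite !big_cons -IH.
apply: eq_bigr => c _; rewrite /EC; congr Complex; apply: eq_Ex => w.
  by rewrite /X; case: (F w) => a b /=; rewrite mul0r subr0.
by rewrite /Y; case: (F w) => a b /=; rewrite mul0r addr0.
Qed.

End total_expectation.

Section joint_law.
Context d (T : measurableType d) (R : realType) (P : probability T R).

Section one_sequence.
Context d' (T' : measurableType d') (D : set nat) (X : nat -> {RV P >-> T'}).
Variables (J : {fset nat}) (B : nat -> set T').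
Hypothesis JD : forall i, i \in J -> D i.
Hypothesis mB : forall i, measurable (B i).

Lemma sigma_seq_bigcap : sigma_seq D X (\bigcap_(i in [set` J]) (X i @^-1` B i)).
Proof.
apply: (@fin_bigcap_measurable _
  (g_sigma_algebraType (\bigcup_(n in D) g_sigma_algebra_preimage (X n)))).
  exact: finite_fset.
move=> i iJ; apply: sub_sigma_algebra; exists i; first exact: JD.
by exists (B i) => //; rewrite setTI.
Qed.

Lemma independent_seq_bigcap : independent_seq D X ->
  P (\bigcap_(i in [set` J]) (X i @^-1` B i)) = (\prod_(i <- J) P (X i @^-1` B i))%E.
Proof.
move=> ind; apply: ind => i iJ; split; first exact: JD.
by exists (B i) => //; rewrite setTI.
Qed.

End one_sequence.

Lemma independent_list_bigcap (Fs : seq (set_system T)) (A : nat -> set T) :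
  independent_list P Fs -> (forall i, (i < size Fs)%N -> nth set0 Fs i (A i)) ->
  P (\bigcap_(i in `I_(size Fs)) A i) = (\prod_(i < size Fs) P (A i))%E.
Proof.
move=> ind FA; pose J := [fset i in enum 'I_(size Fs)]%fset.
have mJ i : i \in J by rewrite !inE mem_enum.
transitivity (P (\bigcap_(i in [set` J]) A i)).
  congr (P _); apply/seteqP; split => w Aw i /= h; first exact/Aw/ltn_ord.
  exact: (Aw (Ordinal h) (mJ _)).
rewrite (ind J (fun i => A i)) => [|i _]; last by split => //; exact: FA.
apply: perm_big; apply: uniq_perm; [exact: fset_uniq|exact: index_enum_uniq|].
by move=> i; rewrite mem_index_enum; exact: mJ.
Qed.

Lemma indic_bigcap (J : {fset nat}) (A : nat -> set T) w :
  \1_(\bigcap_(i in [set` J]) A i) w = \prod_(i <- J) \1_(A i) w :> R.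
Proof.
rewrite indicE; have [/set_mem h|/negP h] := boolP (w \in _).
  by rewrite big_seq big1// => i /h Ai; rewrite indicE mem_set.
apply/esym; apply/eqP; rewrite prodf_seq_eq0.
have [i iJ Ai] : exists2 i, i \in J & ~ A i w.
  by apply: contrapT => H; apply/h/mem_set => i iJ; apply: contrapT => Ai; apply: H; exists i.
by apply/hasP; exists i => //=; rewrite indicE memNset.
Qed.

Lemma big_fset_iota1 (V : Type) (idx : V) (op : Monoid.com_law idx) n (F : nat -> V) :
  \big[op/idx]_(i <- [fset i in iota 1 n]%fset) F i = \big[op/idx]_(1 <= i < n.+1) F i.
Proof.
apply: perm_big; rewrite /index_iota subn1.
by apply: uniq_perm; [exact: fset_uniq|exact: iota_uniq|move=> i; rewrite !inE].
Qed.

Lemma big_fset_shift (V : Type) (idx : V) (op : Monoid.com_law idx) m (F : nat -> V) :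
  \big[op/idx]_(i <- [fset i in iota 2 m]%fset) F i = \big[op/idx]_(k < m) F k.+2.
Proof.
rewrite (perm_big (iota 2 m)) => [|]; last first.
  apply: uniq_perm; [exact: fset_uniq|exact: iota_uniq|].
  by move=> i; rewrite !inE.
by rewrite -[2%N]addn0 iotaDl big_map -[m in iota 0 m]subn0 -/(index_iota _ _) big_mkord.
Qed.

Lemma measurable_preimage_RV d' (T' : measurableType d') (X : {RV P >-> T'}) (A : set T') :
  measurable A -> measurable (X @^-1` A).
Proof. by move=> mA; rewrite -[X in measurable X]setTI; exact: measurable_funPT. Qed.

Lemma Ex_prod_indic (B : set T) (xi : nat -> {RV P >-> R}) (A : nat -> set R) n
    (J := [fset i in iota 1 n]%fset) :
  measurable B -> (forall i, measurable (A i)) ->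
  P (B `&` \bigcap_(i in [set` J]) (xi i @^-1` A i)) =
    (P B * \prod_(i <- J) P (xi i @^-1` A i))%E ->
  Ex P (fun w => \1_B w * \prod_(1 <= i < n.+1) \1_(A i) (xi i w)) =
  Ex P \1_B * \prod_(1 <= i < n.+1) Ex P (fun w => \1_(A i) (xi i w)).
Proof.
move=> mB mA BA; have mx i : measurable (xi i @^-1` A i) by exact: measurable_preimage_RV.
pose C := \bigcap_(i in [set` J]) (xi i @^-1` A i).
have mC : measurable C by apply: fin_bigcap_measurable => //; exact: finite_fset.
transitivity (Ex P (\1_(B `&` C))).
  apply: eq_Ex => w; rewrite indicI/=; congr (_ * _).
  by rewrite indic_bigcap big_fset_iota1.
rewrite !Ex_indic//; last exact: measurableI.
rewrite BA fineM ?fin_num_measure//; last first.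
  by rewrite big_fset_iota1; apply: prode_fin_num => i _; exact: fin_num_measure.
congr (_ * _); rewrite big_fset_iota1.
rewrite (eq_bigr (fun i => (Ex P (fun w => \1_(A i) (xi i w)))%:E)) => [|i _].
  by rewrite prodEFin.
by rewrite -[RHS]/((Ex P (\1_(xi i @^-1` A i)))%:E) Ex_indic// fineK// fin_num_measure.
Qed.

Variable r : R.
Hypothesis r01 : 0 <= r <= 1.

Lemma uniform_upto_preimage m (X : {RV P >-> nat}) k : uniform_upto m X ->
  (1 <= k <= m)%N -> P (X @^-1` [set k]) = (m%:R^-1)%:E.
Proof. by move=> uX km; rewrite -(uX _ km) /distribution. Qed.

Lemma bernoulli_preimage (X : {RV P >-> bool}) b : distribution P X = bernoulli_prob r ->
  P (X @^-1` [set b]) = (if b then r else 1 - r)%:E.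
Proof.
move=> dX; rewrite -[LHS]/(distribution P X [set b]) dX bernoulli_probE//.
have eb a : (a \in [set b]) = (a == b) by apply/idP/eqP; rewrite inE.
by rewrite !diracE !eb; case: b {dX eb} => /=; rewrite mule1 mule0 ?adde0 ?add0e.
Qed.

End joint_law.

Section reinforced_walk.
Context d (T : measurableType d) (R : realType) (P : probability T R).

Definition choices (U : nat -> {RV P >-> nat}) (eps eta : nat -> {RV P >-> bool}) k w : choice3 :=
  (U k w, eps k w, eta k w).

Lemma measurable_choices U eps eta k x : measurable (choices U eps eta k @^-1` [set x]).
Proof.
case: x => [[u e] h].
rewrite (_ : _ @^-1` _ = U k @^-1` [set u] `&` eps k @^-1` [set e] `&` eta k @^-1` [set h]).
  by apply: measurableI; [apply: measurableI|]; exact: measurable_preimage_RV.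
by apply/seteqP; split => w; rewrite /choices; [case=> <- <- <-|case=> -[/= -> ->] ->].
Qed.

Lemma past_event_choices U eps eta m c (J := [fset i in iota 2 m]%fset) :
  past_event (choices U eps eta) m c =
  \bigcap_(i in [set` J]) (U i @^-1` [set (c i).1.1]) `&`
  \bigcap_(i in [set` J]) (eps i @^-1` [set (c i).1.2]) `&`
  \bigcap_(i in [set` J]) (eta i @^-1` [set (c i).2]).
Proof.
have JE i : (i \in J) = (2 <= i < m.+2)%N by rewrite !inE mem_iota addnC addn2.
apply/seteqP; split => w.
  move=> h; have {}h i : i \in J -> choices U eps eta i w = c i.
    by rewrite JE; case: i => [|[|i]]//= im; exact: h.
  by split; [split|] => i /= /h; rewrite /choices => <-.
move=> [[h1 h2] h3] k km; have kJ : k.+2 \in J by rewrite JE.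
by move: (h1 _ kJ) (h2 _ kJ) (h3 _ kJ) => /= e1 e2 e3; rewrite /choices e1 e2 e3;
  case: (c k.+2) => -[].
Qed.

Variables (p r : R) (U : nat -> {RV P >-> nat}) (eps eta : nat -> {RV P >-> bool})
  (xi : nat -> {RV P >-> R}).
Hypothesis p01 : 0 <= p <= 1.
Hypothesis r01 : 0 <= r <= 1.
Hypothesis inputs : srrw_inputs p r U eps eta xi.
Local Notation Z := (choices U eps eta).

Lemma choices_joint_law m c n (A : nat -> set R) : past_valid m c ->
  (forall i, measurable (A i)) ->
  P (past_event Z m c `&` \bigcap_(i in [set` [fset i in iota 1 n]%fset]) (xi i @^-1` A i)) =
  ((\prod_(k < m) weight p r k (c k.+2))%:E *
   \prod_(i <- [fset i in iota 1 n]%fset) P (xi i @^-1` A i))%E.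
Proof.
move=> vc mA; set J := [fset i in iota 1 n]%fset; pose K := [fset i in iota 2 m]%fset.
have KD i : i \in K -> [set n | (2 <= n)%N] i.
  by rewrite !inE mem_iota => /andP[].
have JD i : i \in J -> [set n | (1 <= n)%N] i.
  by rewrite !inE mem_iota => /andP[].
rewrite past_event_choices -/K; set E1 := \bigcap_(i in _) _; set E2 := \bigcap_(i in _) _.
set E3 := \bigcap_(i in _) _; set E4 := \bigcap_(i in _) _.
pose E i := nth set0 [:: E1; E2; E3; E4] i.
have -> : E1 `&` E2 `&` E3 `&` E4 = \bigcap_(i in `I_4) E i.
  apply/seteqP; split => w.
    by move=> [[[h1 h2] h3] h4] [|[|[|[|]]]].
  by move=> h; split; [split; [split|]|]; [exact: (h 0%N)|exact: (h 1%N)|exact: (h 2%N)|exact: (h 3%N)].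
rewrite (independent_list_bigcap (srrw_indep inputs)); last first.
  by move=> [|[|[|[|//]]]] _; apply: sigma_seq_bigcap.
rewrite !big_ord_recl big_ord0 mule1 /=.
rewrite (independent_seq_bigcap KD _ (srrw_U_indep inputs))//.
rewrite (independent_seq_bigcap KD _ (srrw_eps_indep inputs))//.
rewrite (independent_seq_bigcap KD _ (srrw_eta_indep inputs))//.
rewrite (independent_seq_bigcap JD mA (srrw_xi_indep inputs)).
rewrite !muleA; congr (_ * _)%E.
rewrite /K !big_fset_shift -!big_split/= -prodEFin; apply: eq_bigr => k _.
rewrite (uniform_upto_preimage (srrw_U_uniform inputs _))//; last exact: vc.
rewrite (bernoulli_preimage p01 _ (srrw_eps_bernoulli inputs _))//.
rewrite (bernoulli_preimage r01 _ (srrw_eta_bernoulli inputs _))//.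
by rewrite -!EFinM /weight mulrA.
Qed.

Lemma choices_law m c : past_valid m c ->
  P (past_event Z m c) = (\prod_(k < m) weight p r k (c k.+2))%:E.
Proof.
move=> vc; have := @choices_joint_law m c 0 (fun=> setT) vc (fun=> measurableT).
have -> : [fset i in iota 1 0]%fset = fset0 :> {fset nat} by apply/fsetP => i; rewrite !inE.
by rewrite big_seq_fset0 mule1 set_fset0 bigcap_set0 setIT.
Qed.

Lemma EC_srrw m (s : R) :
  EC P (fun w => cis (s * srrw U eps eta xi m.+1 w)) =
  \sum_(c <- configs m) (\prod_(k < m) weight p r k (c k.+2))%:C%C *
    \prod_(1 <= i < m.+2) cf P (xi i) (s * cweight R c i m.+1).
Proof.
have mZ := measurable_choices U eps eta.
have bF : bounded_rvC (fun w => cis (s * srrw U eps eta xi m.+1 w)).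
  by apply: bounded_rvC_cis; apply: measurable_funM => //; exact: measurable_srrw.
rewrite (total_EC mZ choices_law m bF); apply: eq_sum_configs => c vc.
transitivity (EC P (fun w => (\1_(past_event Z m c) w)%:C%C *
    cis (\sum_(1 <= i < m.+2) (s * cweight R c i m.+1) * xi i w))).
  apply: eq_EC => w; rewrite indicE; have [/set_mem h|_] := boolP (w \in _); last by rewrite !mul0r.
  congr (_ * cis _); under [RHS]eq_bigr do rewrite -mulrA.
  rewrite -mulr_sumr; congr (s * _).
  exact: (@srrw_cweight R c (fun k => Z k w) (xi ^~ w) m h).
rewrite EC_prod_indep; last 3 first.
- exact: measurable_past_event.
- by move=> i; exact: measurable_funPT.
- move=> A mA; apply: Ex_prod_indic => //; first exact: measurable_past_event.
  by rewrite choices_joint_law// choices_law.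
by rewrite (Ex_past_event mZ choices_law).
Qed.

End reinforced_walk.

Section elephant_walk.
Context d (T : measurableType d) (R : realType) (P : probability T R).
Variables (r : R) (U : nat -> {RV P >-> nat}) (eta : nat -> {RV P >-> bool}).
Hypothesis r01 : 0 <= r <= 1.
Hypothesis inputs : erw_inputs r U eta.

(** The elephant walk as a reinforced walk that copies at every time: its choices have law
    [weight 1 r], and the calculus of configurations applies with [p = 1]. *)
Let Z k w : choice3 := (U k w, true, eta k w).

Let mZ k x : measurable (Z k @^-1` [set x]).
Proof.
case: x => [[u e] h]; have [->|e1] := eqVneq e true.
  rewrite (_ : _ @^-1` _ = U k @^-1` [set u] `&` eta k @^-1` [set h]).
    by apply: measurableI; exact: measurable_preimage_RV.
  by apply/seteqP; split => w; rewrite /Z; [case=> <- <-|case=> /= -> ->].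
rewrite (_ : _ @^-1` _ = set0); first exact: measurable0.
by apply/seteqP; split => w //=; rewrite /Z => -[_ ee]; move: e1; rewrite -ee eqxx.
Qed.

Let lawZ m c : past_valid m c ->
  P (past_event Z m c) = (\prod_(k < m) weight 1 r k (c k.+2))%:E.
Proof.
move=> vc; have [ec|] := pselect (forall j, (j < m)%N -> (c j.+2).1.2); last first.
  move=> /existsNP[j /not_implyP[jm ej]].
  rewrite (bigD1 (Ordinal jm))//= /weight (negbTE (introT negP ej)) subrr mul0r mulr0 mul0r.
  rewrite (_ : past_event _ _ _ = set0) ?measure0//; apply/seteqP; split => w //.
  by move=> /(_ j jm) /= zc; apply: ej; rewrite -zc.
pose K := [fset i in iota 2 m]%fset.
have KD i : i \in K -> [set n | (2 <= n)%N] i.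
  by rewrite !inE mem_iota => /andP[].
pose E1 := \bigcap_(i in [set` K]) (U i @^-1` [set (c i).1.1]).
pose E2 := \bigcap_(i in [set` K]) (eta i @^-1` [set (c i).2]).
pose E i := nth set0 [:: E1; E2] i.
have JE i : (i \in K) = (2 <= i < m.+2)%N by rewrite !inE mem_iota addnC addn2.
have -> : past_event Z m c = \bigcap_(i in `I_2) E i.
  apply/seteqP; split => w.
    move=> h; have {}h i : i \in K -> Z i w = c i.
      by rewrite JE; case: i => [|[|i]]//= im; exact: h.
    by case=> [|[|//]] _ i /= /h; rewrite /Z => <-.
  move=> h k km; have kJ : k.+2 \in K by rewrite JE.
  have /= e1 := h 0%N isT _ kJ; have /= e2 := h 1%N isT _ kJ.
  by move: (ec _ km); rewrite /= /Z e1 e2; case: (c k.+2) => -[a b] e /= ->.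
rewrite (independent_list_bigcap (erw_indep inputs)); last first.
  by move=> [|[|//]] _; apply: sigma_seq_bigcap.
rewrite !big_ord_recl big_ord0 mule1 /=.
rewrite (independent_seq_bigcap KD _ (erw_U_indep inputs))//.
rewrite (independent_seq_bigcap KD _ (erw_eta_indep inputs))//.
rewrite /K !big_fset_shift -!big_split/= -prodEFin; apply: eq_bigr => k _.
rewrite (uniform_upto_preimage (erw_U_uniform inputs _))//; last exact: vc.
rewrite (bernoulli_preimage r01 _ (erw_eta_bernoulli inputs _))//.
by rewrite -!EFinM /weight ec// mul1r.
Qed.

Lemma erwE n w : erw U eta n w = cweight R (Z ^~ w) 1 n.
Proof.
rewrite /erw; apply: eq_bigr => k _; apply: eq_recursive_seq => j past _.
by rewrite /erw_step /srrw_step; case: j => [//|[//|j]].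
Qed.

Lemma erw_cweight m c w : past_event Z m c w -> erw U eta m.+1 w = cweight R c 1 m.+1.
Proof.
move=> h; rewrite erwE /cweight big_nat [RHS]big_nat; apply: eq_bigr => k /andP[_ km].
apply: eq_recursive_seq => -[|[|j]] past jk //.
have jm : (j < m)%N by rewrite -ltnS -[(j.+1 < _)%N]ltnS (leq_ltn_trans jk).
by rewrite /srrw_step (h j jm).
Qed.

(** For [p = 1] a configuration that does not copy at every time has weight 0; in the others the
    first cluster has size [m + 1], so [count m f] is [f] at its weight. *)
Lemma Ex_erw m (f : R -> R) : bounded_rv (fun w => f (erw U eta m.+1 w)) ->
  Ex P (fun w => f (erw U eta m.+1 w)) = erw_mean r m f.
Proof.
move=> bf; rewrite (total_Ex mZ lawZ m bf) -(@cexp_count_erw _ 1 r)//.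
apply: eq_sum_configs => c vc.
transitivity (Ex P (fun w => f (cweight R c 1 m.+1) * \1_(past_event Z m c) w)).
  apply: eq_Ex => w; rewrite indicE; have [/set_mem h|_] := boolP (w \in _).
    by rewrite (erw_cweight h) mulrC.
  by rewrite mul0r mulr0.
rewrite ExZ; last exact/bounded_rv_indic/measurable_past_event.
rewrite (Ex_past_event mZ lawZ)// mulrC.
have [ec|] := pselect (forall j, (j < m)%N -> (c j.+2).1.2).
  by rewrite count_single.
move=> /existsNP[j /not_implyP[jm ej]].
by rewrite (bigD1 (Ordinal jm))//= /weight (negbTE (introT negP ej)) subrr mul0r mulr0 !mul0r.
Qed.

Lemma normr_erw n w : `|erw U eta n w| <= n%:R.
Proof.
by rewrite erwE (le_trans (cweight_le _ _ _ _))// ler_nat csize_le.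
Qed.

Lemma expectation_erw_powR m (alpha : R) : 0 < alpha ->
  ('E_P[fun w => (`|erw U eta m.+1 w| `^ alpha)%R] =
   (erw_mean r m (fun x => (`|x| `^ alpha)%R))%:E)%E.
Proof.
move=> a0; have bf : bounded_rv (fun w => `|erw U eta m.+1 w| `^ alpha).
  split; last first.
    exists (m.+1%:R `^ alpha) => w; rewrite ger0_norm ?powR_ge0// ge0_ler_powR ?nnegrE//.
      exact: ltW.
    exact: normr_erw.
  apply: (measurableT_comp (f := fun x : R => `|x| `^ alpha)).
    by apply: continuous_measurable_fun; exact: continuous_norm_powR.
  exact: measurable_erw.
by rewrite expectationE// -[in RHS](Ex_erw (f := fun x => `|x| `^ alpha)).
Qed.

End elephant_walk.

(** * Convergence of characteristic functions *)

Section characteristic_function.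
Context d (T : measurableType d) (R : realType) (P : probability T R).
Variable X : T -> R.
Hypothesis mX : measurable_fun setT X.

Let mtX t : measurable_fun setT (fun w => t * X w).
Proof. exact: measurable_funM. Qed.

Lemma cf0 : cf P X 0 = 1.
Proof.
rewrite /cf (eq_EC _ (G := fun=> (1 : R)%:C%C)) => [|w].
  by rewrite ECR (Ex_cst P 1) realC1.
by rewrite mul0r cis0 realC1.
Qed.

Lemma normc_cf t : normc (cf P X t) <= 1.
Proof.
rewrite -[leRHS](Ex_cst P); apply: normc_EC => [||w]; last by rewrite normc_cis.
  exact: bounded_rvC_cis.
exact: bounded_rv_cst.
Qed.

Lemma normc_1cfN t : normc (1 - cf P X (- t)) = normc (1 - cf P X t).
Proof.
have eC : Ex P (fun w => cos (- t * X w)) = Ex P (fun w => cos (t * X w)).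
  by apply: eq_Ex => w; rewrite mulNr cosN.
have eS : Ex P (fun w => sin (- t * X w)) = - Ex P (fun w => sin (t * X w)).
  rewrite -[RHS]mulN1r -(ExZ P (-1) (bounded_rv_sin (mtX t))).
  by apply: eq_Ex => w; rewrite mulNr sinN mulN1r.
by rewrite /cf /EC /= eC eS /Normc.normc /= !sub0r opprK sqrrN.
Qed.

(** Dominates [|cis (s x) - cis (t x)|] for [|s - t| <= delta]. Being bounded and continuous, it
    passes to weak limits, which yields one modulus of continuity for all large [n]. *)
Definition tail_fun (delta x : R) : R := Num.min 2 (delta * `|x|).

Lemma continuous_tail_fun delta : continuous (tail_fun delta).
Proof.
move=> x; apply: (@continuous_min _ _ (cst 2) (fun x => delta * `|x|)).
  exact: cvg_cst.
by apply: cvgM; [exact: cvg_cst|exact: norm_continuous].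
Qed.

Lemma tail_fun_bounded delta x : 0 <= delta -> 0 <= tail_fun delta x <= 2.
Proof. by move=> d0; rewrite /tail_fun ge_min le_min lexx ler0n mulr_ge0. Qed.

Lemma bounded_tail_fun delta : 0 <= delta -> bounded_rv (fun w => tail_fun delta (X w)).
Proof.
move=> d0; apply: bounded_rv_comp => //.
  by apply: continuous_measurable_fun; exact: continuous_tail_fun.
by exists 2 => x; have /andP[t0 t2] := tail_fun_bounded x d0; rewrite ger0_norm.
Qed.

Lemma normc_cfB s t delta : `|s - t| <= delta ->
  normc (cf P X s - cf P X t) <= Ex P (fun w => tail_fun delta (X w)).
Proof.
move=> st; have d0 : 0 <= delta by exact: le_trans st.
have b s' := bounded_rvC_cis (mtX s').
have -> : cf P X s - cf P X t = EC P (fun w => cis (s * X w) - cis (t * X w)).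
  rewrite /cf /EC /=; have [bs bs'] := b s; have [bt bt'] := b t.
  by congr Complex; [exact: esym (ExB P bs bt)|exact: esym (ExB P bs' bt')].
apply: normc_EC; [|exact: bounded_tail_fun|].
  by have [bs bs'] := b s; have [bt bt'] := b t; split; exact: bounded_rvB.
move=> w; apply: le_trans (normc_cisB_le _ _) _.
rewrite /tail_fun le_min !ge_min lexx /= -mulrBl normrM.
by apply/orP; right; exact: ler_wpM2r.
Qed.

Lemma Ex_tail_fun (e : R) : 0 < e ->
  exists2 delta, 0 < delta & Ex P (fun w => tail_fun delta (X w)) <= e.
Proof.
move=> e0; have : Ex P (fun w => tail_fun n.+1%:R^-1 (X w)) @[n --> \oo] --> Ex P (cst 0).
  apply: (Ex_dominated (M := 2)).
  - move=> n; have n0 : 0 <= n.+1%:R^-1 :> R by rewrite invr_ge0.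
    by have [] := bounded_tail_fun n0.
  - exact: measurable_cst.
  - move=> n w; have n0 : 0 <= n.+1%:R^-1 :> R by rewrite invr_ge0.
    have /andP[t0 t2] := tail_fun_bounded (X w) n0; by rewrite ger0_norm.
  move=> w; apply: (@squeeze_cvgr _ _ _ _ (cst 0) (fun n => n.+1%:R^-1 * `|X w|)).
  - apply: nearW => n; have n0 : 0 <= n.+1%:R^-1 :> R by rewrite invr_ge0.
    have /andP[t0 _] := tail_fun_bounded (X w) n0; rewrite [leLHS]/cst t0 /=; by rewrite /tail_fun ge_min lexx orbT.
  - exact: cvg_cst.
  - have -> : cst 0 w = 0 * `|X w| by rewrite mul0r.
    by apply: cvgM; [exact: cvg_harmonic|exact: cvg_cst].
rewrite Ex_cst => /cvgrPdist_le/(_ _ e0)[n _ /(_ n)] /= h.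
by exists n.+1%:R^-1 => //; move: h; rewrite leqnn => /(_ isT); rewrite sub0r normrN; exact/le_trans/ler_norm.
Qed.

Lemma cf_continuous (t e : R) : 0 < e ->
  exists2 delta : R, 0 < delta & forall s, `|s - t| < delta -> normc (cf P X s - cf P X t) <= e.
Proof.
move=> e0; have [delta d0 h] := Ex_tail_fun e0; exists delta => // s sd.
by apply: le_trans h; apply: normc_cfB; exact: ltW.
Qed.

End characteristic_function.

Section innovations.
Context d (T : measurableType d) (R : realType) (P : probability T R).
Variable (xi : nat -> {RV P >-> R}).
Local Notation D1 := [set n | (1 <= n)%N].

Lemma Ex_distribution (X : {RV P >-> R}) (f : R -> R) :
  continuous f -> (exists M : R, forall x, `|f x| <= M) ->
  Ex P (fun w => f (X w)) = fine (\int[distribution P X]_x (f x)%:E)%E.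
Proof.
move=> cf bf; have mf : measurable_fun setT f by exact: continuous_measurable_fun.
rewrite /Ex unlock; congr fine; rewrite integral_distribution//.
  exact/measurable_EFinP.
apply: bounded_rv_integrable; exact: bounded_rv_comp.
Qed.

Lemma eq_Ex_distribution (X Y : {RV P >-> R}) (f : R -> R) :
  (forall A, measurable A -> distribution P X A = distribution P Y A) ->
  continuous f -> (exists M : R, forall x, `|f x| <= M) ->
  Ex P (fun w => f (X w)) = Ex P (fun w => f (Y w)).
Proof.
move=> XY cf bf; rewrite !Ex_distribution//; congr fine.
by apply: eq_measure_integral => A mA _; exact: XY.
Qed.

Lemma cf_ident i t : identically_distributed D1 xi -> (1 <= i)%N ->
  cf P (xi i) t = cf P (xi 1%N) t.
Proof.
move=> ident i1; rewrite /cf /EC /=; congr Complex.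
  apply: (@eq_Ex_distribution _ _ (fun x => cos (t * x))); first exact: ident.
    apply: (@continuous_fun_comp _ (fun x => t * x) cos); last exact: continuous_cos.
    by move=> x; apply: cvgM; [exact: cvg_cst|exact: cvg_id].
  by exists 1 => x; exact: cos_max.
apply: (@eq_Ex_distribution _ _ (fun x => sin (t * x))); first exact: ident.
  apply: (@continuous_fun_comp _ (fun x => t * x) sin); last exact: continuous_sin.
  by move=> x; apply: cvgM; [exact: cvg_cst|exact: cvg_id].
by exists 1 => x; exact: sin_max.
Qed.

Lemma cf_sum n (s : R) : independent_seq D1 xi -> identically_distributed D1 xi ->
  cf P (fun w => \sum_(1 <= k < n.+1) xi k w) s = cf P (xi 1%N) s ^+ n.
Proof.
move=> ind ident.
transitivity (EC P (fun w => (\1_[set: T] w)%:C%C * cis (\sum_(1 <= k < n.+1) s * xi k w))).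
  by apply: eq_EC => w; rewrite indicT realC1 mul1r mulr_sumr.
rewrite EC_prod_indep//; last first.
  move=> A mA; apply: Ex_prod_indic => //; rewrite setTI probability_setT mul1e.
  apply: independent_seq_bigcap ind => //.
  by move=> i; rewrite !inE mem_iota => /andP[].
rewrite indicT (Ex_cst P 1) realC1 mul1r.
rewrite (eq_big_nat _ _ (F2 := fun=> cf P (xi 1%N) s)) => [|i /andP[i1 _]]; last exact: cf_ident.
by rewrite prodr_const_nat subn1.
Qed.


End innovations.

Section cf_convergence.
Context d (T : measurableType d) (R : realType) (P : probability T R).
Context d' (T' : measurableType d') (P' : probability T' R).
Variables (X : nat -> T -> R) (Y : T' -> R).
Hypothesis mX : forall n, measurable_fun setT (X n).
Hypothesis mY : measurable_fun setT Y.
Hypothesis cvgX : cvg_in_distribution P X P' Y.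

Lemma cvg_Ex (f : R -> R) : continuous f -> (exists M : R, forall x, `|f x| <= M) ->
  Ex P (fun w => f (X n w)) @[n --> \oo] --> Ex P' (fun w => f (Y w)).
Proof.
move=> cf bf; have mf : measurable_fun setT f by exact: continuous_measurable_fun.
apply: fine_cvg; have := cvgX cf bf; rewrite [X in _ --> X -> _]expectationE//.
by apply: bounded_rv_comp.
Qed.

Lemma cvg_cf (t e : R) : 0 < e -> \forall n \near \oo,
  normc (cf P (X n) t - cf P' Y t) <= e.
Proof.
move=> e0; have e20 : 0 < e / 2 by rewrite divr_gt0.
have ct : continuous (fun x : R => t * x).
  by move=> x; apply: cvgM; [exact: cvg_cst|exact: cvg_id].
have /cvgrPdist_le/(_ _ e20) hc : Ex P (fun w => cos (t * X n w)) @[n --> \oo] -->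
    Ex P' (fun w => cos (t * Y w)).
  apply: (@cvg_Ex (fun x => cos (t * x))).
    by apply: (continuous_fun_comp ct); exact: continuous_cos.
  by exists 1 => x; exact: cos_max.
have /cvgrPdist_le/(_ _ e20) hs : Ex P (fun w => sin (t * X n w)) @[n --> \oo] -->
    Ex P' (fun w => sin (t * Y w)).
  apply: (@cvg_Ex (fun x => sin (t * x))).
    by apply: (continuous_fun_comp ct); exact: continuous_sin.
  by exists 1 => x; exact: sin_max.
near=> n.
have h1 : `|Ex P' (fun w => cos (t * Y w)) - Ex P (fun w => cos (t * X n w))| <= e / 2.
  by near: n; exact: hc.
have h2 : `|Ex P' (fun w => sin (t * Y w)) - Ex P (fun w => sin (t * X n w))| <= e / 2.
  by near: n; exact: hs.
rewrite normcC; apply: le_trans (normc_leRI _) _.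
by rewrite [e in leRHS](splitr e) lerD.
Unshelve. all: by end_near. Qed.

(* Pointwise convergence on a finite grid together with equicontinuity. *)
Lemma cvg_cf_uniform (M e : R) : 0 < e -> \forall n \near \oo, forall t, `|t| <= M ->
  normc (cf P (X n) t - cf P' Y t) <= e.
Proof.
move=> e0; have e40 : 0 < e / 4 by rewrite divr_gt0.
have [delta d0 Yd] := Ex_tail_fun P' mY e40.
have := @cvg_Ex (tail_fun delta) (@continuous_tail_fun _ delta) _.
have bt : exists M : R, forall x, `|tail_fun delta x| <= M.
  by exists 2 => x; have /andP[t0 t2] := tail_fun_bounded x (ltW d0); rewrite ger0_norm.
move=> /(_ bt)/cvgrPdist_le/(_ _ e40) hX.
pose g j : R := - M + j%:R * delta; pose N := (Num.truncn (2 * M / delta)).+1.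
have grid : \forall n \near \oo, forall j, (j < N)%N ->
    normc (cf P (X n) (g j) - cf P' Y (g j)) <= e / 4.
  elim: N => [|N IH]; first exact: nearW.
  near=> n => j; rewrite ltnS leq_eqVlt => /predU1P[->|jN].
    by near: n; exact: cvg_cf.
  by move: j jN; near: n.
near=> n => t tM.
have M0 : 0 <= M by exact: le_trans tM.
have [t1 t2] : - M <= t /\ t <= M by apply/andP; rewrite -ler_norml.
pose j := Num.truncn ((t + M) / delta).
have /andP[j1 j2] : j%:R <= (t + M) / delta < j.+1%:R.
  by rewrite truncn_itv// divr_ge0 ?(ltW d0)//; lra.
have jN : (j < N)%N.
  by rewrite ltnS /j; apply: le_truncn; rewrite ler_pM2r ?invr_gt0//; lra.
have tg : `|t - g j| <= delta.
  rewrite ler_pdivlMr// in j1; rewrite ltr_pdivrMr// -natr1 mulrDl mul1r in j2.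
  by rewrite ler_norml /g; apply/andP; split; lra.
have h1 := le_trans (normc_cfB P' mY tg) Yd.
have h2 : normc (cf P (X n) t - cf P (X n) (g j)) <= e / 4 + e / 4.
  apply: le_trans (normc_cfB P (mX n) tg) _.
  have : `|Ex P' (fun w => tail_fun delta (Y w)) - Ex P (fun w => tail_fun delta (X n w))| <= e / 4.
    by near: n; exact: hX.
  by rewrite ler_norml; move: Yd; lra.
have h3 : normc (cf P (X n) (g j) - cf P' Y (g j)) <= e / 4.
  by move: (j) jN; near: n.
have -> : cf P (X n) t - cf P' Y t = (cf P (X n) t - cf P (X n) (g j)) +
  (cf P (X n) (g j) - cf P' Y (g j)) - (cf P' Y t - cf P' Y (g j)) by ring.
apply: le_trans (le_normcB _ _) _; apply: le_trans (lerD (le_normcD _ _) (lexx _)) _.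
by move: h1 h2 h3; lra.
Unshelve. all: by end_near. Qed.

End cf_convergence.

(** * Asymptotics of sums over clusters *)

Lemma sum_split (R : pzRingType) K n (F : nat -> R) : (K <= n)%N ->
  \sum_(j < n) F j = \sum_(j < K) F j + \sum_(j < n) (K <= j)%:R * F j.
Proof.
elim: n => [|n IH]; first by rewrite leqn0 => /eqP ->; rewrite !big_ord0 addr0.
rewrite leq_eqVlt => /predU1P[->|Kn].
  by rewrite [X in _ + X]big1 ?addr0// => j _; rewrite leqNgt ltn_ord mul0r.
rewrite ltnS in Kn; rewrite big_ord_recr IH// [in RHS]big_ord_recr /=.
by rewrite Kn mul1r addrA.
Qed.

Lemma near_lt_all (Q : nat -> nat -> Prop) N : (forall j, \forall n \near \oo, Q j n) ->
  \forall n \near \oo, forall j, (j < N)%N -> Q j n.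
Proof.
move=> hQ; elim: N => [|N IH]; first exact: nearW.
near=> n => j; rewrite ltnS leq_eqVlt => /predU1P[->|jN].
  by near: n; exact: hQ.
by move: j jN; near: n.
Unshelve. all: by end_near. Qed.

Lemma sum_tail (R : realType) (u : nat -> R) : (forall j, 0 <= u j) ->
  (exists C, forall n, \sum_(j < n) u j <= C) -> forall e, 0 < e ->
  exists K, forall n, \sum_(j < n) (K <= j)%:R * u j <= e.
Proof.
move=> u0 [C uC] e e0; pose S n := \sum_(j < n) u j.
have S_nd : nondecreasing_seq S.
  by apply/nondecreasing_seqP => n; rewrite /S big_ord_recr lerDl.
have S_cvg : cvgn S by apply: nondecreasing_is_cvgn => //; exists C => _ [n _ <-]; exact: uC.
have /cvgrPdist_le/(_ _ e0)[K _ /(_ K (leqnn _))] := S_cvg => hK; exists K => n.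
have [Kn|nK] := leqP K n; last first.
  by rewrite big1 ?ltW// => j _; rewrite leqNgt (ltn_trans (ltn_ord j))// mul0r.
have := nondecreasing_cvgn_le S_nd S_cvg n; rewrite {1}/S (sum_split u Kn) -/(S K).
by move: hK; rewrite ler_norml => /andP[_]; lra.
Qed.

Section limit.
Context {R : realType}.
Variables (p r alpha : R).
Hypothesis alpha02 : 0 < alpha <= 2.
Hypothesis p01 : 0 < p < 1.
Hypothesis r01 : 0 <= r <= 1.
Hypothesis sub : (2 * r - 1) * alpha * p < 1.
Local Notation Ec := (cexp (weight p r)).

Let p01' : 0 < p <= 1.
Proof. by case/andP: p01 => p0 p1; rewrite p0 ltW. Qed.

Let p1 : p < 1. Proof. by case/andP: p01. Qed.

Let size_freq_ge0 j : 0 <= size_freq p j.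
Proof. by rewrite ltW// size_freq_gt0. Qed.

Definition exponent_bound (beta : R) : Prop := alpha < beta /\ exists C : R, forall n,
  \sum_(j < n) size_freq p j * erw_mean r j (fun w => 1 + `|w| `^ beta) <= C.

(** Indices [j >= K] are handled by the tail of the convergent series, smaller ones by
    [|w| <= j + 1 <= K], where [h <= e']. The thresholds do not depend on [n] or [h], so [h] may be
    a rescaled function that varies with [n]. *)
Lemma size_sum_small (beta C e : R) : exponent_bound beta -> 0 <= C -> 0 < e ->
  exists (K : nat) (e' : R), 0 < e' /\ forall n (h : R -> R), (forall w, 0 <= h w) ->
    (forall w, h w <= C * (1 + `|w| `^ beta)) ->
    (forall w, `|w| <= K%:R -> h w <= e') ->
    \sum_(j < n) size_freq p j * erw_mean r j h <= e.
Proof.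
move=> [_ [B uB]] C0 e0; pose u j := size_freq p j * erw_mean r j (fun w => 1 + `|w| `^ beta).
have v0 (w : R) : 0 <= 1 + `|w| `^ beta by rewrite addr_ge0// powR_ge0.
have u0 j : 0 <= u j by rewrite mulr_ge0// erw_mean_ge0.
have eC : 0 < e / 2 / (C + 1) by rewrite !divr_gt0// ltr_wpDl.
have [K hK] := sum_tail u0 (ex_intro _ B uB) eC.
have B0 : 0 <= B by have := uB 0%N; rewrite big_ord0.
exists K, (e / 2 / (B + 1)); split; first by rewrite !divr_gt0// ltr_wpDl.
move=> n h h0 hC hs; set e' := e / 2 / (B + 1).
have e'0 : 0 <= e' by rewrite !divr_ge0 ?addr_ge0// ltW.
apply: le_trans (_ : e' * \sum_(j < n) u j + C * \sum_(j < n) (K <= j)%:R * u j <= _).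
  rewrite !mulr_sumr -big_split/=; apply: ler_sum => j _.
  have [Kj|jK] := leqP K j.
    apply: ler_wpDl; first by rewrite mulr_ge0.
    rewrite mul1r /u mulrCA ler_wpM2l// -erw_meanZ le_erw_mean// => w _; exact: hC.
  rewrite mul0r mulr0 addr0 /u mulrCA ler_wpM2l// -erw_meanZ le_erw_mean// => w wj.
  apply: le_trans (hs w _) _; first by rewrite (le_trans wj)// ler_nat.
  by rewrite ler_peMr// lerDl powR_ge0.
rewrite (splitr e); apply: lerD.
  apply: le_trans (ler_wpM2l e'0 (uB n)) _.
  by rewrite /e' mulrAC ler_pdivrMr ?ltr_wpDl// ler_wpM2l ?lerDl// divr_ge0 ?ltW.
apply: le_trans (ler_wpM2l C0 (hK n)) _.
by rewrite mulrC mulrAC ler_pdivrMr ?ltr_wpDl// ler_wpM2l ?lerDl// divr_ge0 ?ltW.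
Qed.

Lemma cexp_csum_le : exists2 D : R, 0 < D & forall m (h : R -> R), h 0 = 0 -> (forall w, 0 <= h w) ->
  Ec m (csum (fun=> h) m.+1) <=
  D * \sum_(j < m.+1) size_freq p j * erw_mean r j (fun w => m.+1%:R * h w).
Proof.
have [D hD] := dom_bounded p01' p1; exists (`|D| + 1); first by rewrite ltr_wpDl.
move=> m h h00 h0.
rewrite (eq_cexp _ _ (fun c => csum_count m.+1 c h00)) cexp_sum mulr_sumr.
apply: ler_sum => j _; apply: le_trans (cexp_count_le p01' r01 p1 _ (fun w _ => h0 w)) _.
rewrite erw_meanZ [size_freq p j * (_ * _)]mulrCA ler_wpM2r//.
  by rewrite mulr_ge0// mulr_ge0// erw_mean_ge0.
by rewrite (le_trans (hD j))// (le_trans (ler_norm _))// lerDl.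
Qed.

Let f (w : R) : R := `|w| `^ alpha.

Let alpha0 : 0 < alpha. Proof. by case/andP: alpha02. Qed.

Let f0 : f 0 = 0.
Proof. by rewrite /f normr0 powR0// gt_eqF. Qed.

Let f_ge0 w : 0 <= f w. Proof. exact: powR_ge0. Qed.

Lemma powR_le_1D (x a b : R) : 0 <= x -> 0 <= a -> a <= b -> x `^ a <= 1 + x `^ b.
Proof.
move=> x0 a0 ab; have [x1|/ltW x1] := leP x 1.
  have : x `^ a <= 1 `^ a by rewrite ge0_ler_powR// nnegrE.
  by rewrite powR1; have := powR_ge0 x b; lra.
by have := ler_powR x1 ab; lra.
Qed.

(** The constant [c(alpha, p, r)], by [limit_constantE]. *)
Definition asymptotic_constant : R :=
  limn (fun n => \sum_(j < n) size_freq p j * erw_mean r j f).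

Let v j := size_freq p j * erw_mean r j f.

Let v_ge0 j : 0 <= v j.
Proof. by rewrite mulr_ge0// erw_mean_ge0. Qed.

Let v_bounded : exists C : R, forall n, \sum_(j < n) v j <= C.
Proof.
have [beta alphabeta [C hC]] := sum_size_freq_bound p01 r01 alpha02 sub.
exists C => n; apply: le_trans (hC n); apply: ler_sum => j _.
by rewrite ler_wpM2l// le_erw_mean// => w _; rewrite powR_le_1D// ltW.
Qed.

Lemma cvg_asymptotic_constant :
  \sum_(j < n) v j @[n --> \oo] --> asymptotic_constant.
Proof.
apply: nondecreasing_is_cvgn.
  by apply/nondecreasing_seqP => n; rewrite big_ord_recr lerDl.
by have [C hC] := v_bounded; exists C => _ [n _ <-].
Qed.

Lemma asymptotic_constant_ge0 : 0 <= asymptotic_constant.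
Proof.
apply: limr_ge; first exact: cvgP cvg_asymptotic_constant.
by apply: nearW => n; apply: sumr_ge0 => j _; exact: v_ge0.
Qed.

Let dev j m c := count j f m.+1 c - m.+1%:R * v j.

Let cexp_dev_small j (e : R) : 0 < e ->
  \forall m \near \oo, Ec m (fun c => `|dev j m c|) <= e * m.+1%:R.
Proof.
move=> e0; have fM w : `|w| <= j.+1%:R -> `|f w| <= j.+1%:R `^ alpha.
  by move=> wj; rewrite ger0_norm// ge0_ler_powR ?nnegrE// ltW.
have [C C0 hC] := cexp_deviation p01' r01 fM.
near=> m.
have Cm : C <= e ^+ 2 * m.+1%:R.
  rewrite mulrC -ler_pdivrMr ?exprn_gt0// (@le_trans _ _ m%:R) ?ler_nat//.
  by near: m; exact: nbhs_infty_ger.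
have m0 : 0 <= e * m.+1%:R by rewrite mulr_ge0// ltW.
rewrite -(@ler_pXn2r _ 2)// ?nnegrE//; last by exact: cexp_ge0.
apply: le_trans (cexp_sqr p01' r01 m (dev j m)) _; apply: le_trans (hC m) _.
by rewrite exprMn [m.+1%:R ^+ 2]expr2 mulrA ler_wpM2r.
Unshelve. all: by end_near. Qed.

(** Sizes up to [K] concentrate by their second moments, larger ones are small in mean uniformly in
    time by [cexp_count_le], and [K] also cuts the limiting series: one third of [e] each. *)
Lemma cexp_mean_cvg (e : R) : 0 < e -> \forall m \near \oo,
  Ec m (fun c => `|csum (fun=> f) m.+1 c / m.+1%:R - asymptotic_constant|) <= e.
Proof.
move=> e0; have e30 : 0 < e / 3 by rewrite divr_gt0.
have [D0 hD0] := dom_bounded p01' p1; pose D := `|D0| + 1.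
have D1 : 0 < D by rewrite ltr_wpDl.
have hD j : dom p j <= D by rewrite (le_trans (hD0 j))// (le_trans (ler_norm _))// lerDl.
have [K1 hK1] := sum_tail v_ge0 v_bounded (divr_gt0 e30 D1).
have /cvgrPdist_le/(_ _ e30)[K2 _ hK2] := cvg_asymptotic_constant.
pose K := maxn K1 K2.
have e1 : 0 < e / 3 / K.+1%:R by rewrite divr_gt0// ltr0n.
have hdev0 := near_lt_all K (fun j => cexp_dev_small j e1).
near=> m; pose n := m.+1; have n0 : 0 < n%:R :> R by rewrite ltr0n.
have Kn : (K <= n)%N by apply: leqW; near: m; exact: nbhs_infty_ge.
have hdev : forall j, (j < K)%N -> Ec m (fun c => `|dev j m c|) <= e / 3 / K.+1%:R * n%:R.
  by rewrite /n; near: m; exact: hdev0.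
apply: le_trans (_ : Ec m (fun c => n%:R^-1 * (\sum_(j < K) `|dev j m c|) +
  (n%:R^-1 * (\sum_(j < n) (K <= j)%:R * count j f n c) + e / 3)) <= _).
  apply: le_cexp => // c.
  rewrite (csum_count n c (g := fun=> f) f0) (sum_split (fun j => count j f n c) Kn).
  have -> : (\sum_(j < K) count j f n c + \sum_(j < n) (K <= j)%:R * count j f n c) / n%:R -
      asymptotic_constant =
    n%:R^-1 * (\sum_(j < K) dev j m c) +
    (n%:R^-1 * (\sum_(j < n) (K <= j)%:R * count j f n c) +
     (\sum_(j < K) v j - asymptotic_constant)).
    rewrite /dev sumrB -mulr_sumr -/n; field; exact: lt0r_neq0.
  apply: le_trans (ler_normD _ _) _; apply: lerD.
    rewrite normrM ger0_norm ?invr_ge0 ?(ltW n0)//.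
    by rewrite ler_wpM2l ?invr_ge0 ?(ltW n0)// ler_norm_sum.
  apply: le_trans (ler_normD _ _) _; apply: lerD.
    rewrite ger0_norm// mulr_ge0 ?invr_ge0 ?(ltW n0)// sumr_ge0// => j _.
    by rewrite mulr_ge0// /count sumr_ge0// => i _; rewrite mulr_ge0.
  by rewrite distrC; apply: hK2; rewrite /= leq_maxr.
rewrite cexpD cexpZ cexp_sum cexpD (cexpZ _ _ n%:R^-1) cexp_cst cexp_sum.
have h1 : n%:R^-1 * \sum_(j < K) Ec m (fun c => `|dev j m c|) <= e / 3.
  rewrite mulrC ler_pdivrMr//.
  apply: le_trans (_ : \sum_(j < K) (e / 3 / K.+1%:R * n%:R) <= _).
    by apply: ler_sum => j _; exact: hdev.
  rewrite sumr_const card_ord -[_ *+ K]mulr_natr [leLHS]mulrAC ler_wpM2r ?(ltW n0)//.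
  by rewrite mulrAC ler_pdivrMr ?ltr0n// ler_wpM2l ?(ltW e30)// ler_nat.
have h2 : n%:R^-1 * \sum_(j < n) Ec m (fun c => (K <= j)%:R * count j f n c) <= e / 3.
  apply: le_trans (_ : D * \sum_(j < n) (K1 <= j)%:R * v j <= _); last first.
    by rewrite mulrC -ler_pdivlMr.
  rewrite mulrC ler_pdivrMr// mulr_sumr mulr_suml; apply: ler_sum => j _.
  rewrite cexpZ; have [Kj|jK] := leqP K j; last first.
    by rewrite mul0r mulr_ge0// mulr_ge0 ?(ltW D1)// mulr_ge0.
  rewrite (leq_trans (leq_maxl _ _) Kj) !mul1r.
  apply: le_trans (cexp_count_le p01' r01 p1 m (fun w _ => f_ge0 w)) _.
  rewrite -/(v j) [_ * v j]mulrC mulrA ler_wpM2r ?(ltW n0)//.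
  by rewrite ler_wpM2r.
by apply: le_trans (lerD h1 (lerD h2 (lexx _))) _; rewrite -!mulrDl ler_pdivrMr//; lra.
Unshelve. all: by end_near. Qed.

End limit.

(** * Limit of the characteristic function of the walk *)

Lemma near_inftyS (Q : nat -> Prop) : (\forall n \near \oo, Q n) -> \forall m \near \oo, Q m.+1.
Proof. by move=> [N _ h]; exists N => // m /= Nm; apply: h; exact: leqW. Qed.

Lemma expRN_lipschitz (R : realType) (x y : R) : 0 <= x -> 0 <= y ->
  `|expR (- x) - expR (- y)| <= `|x - y|.
Proof.
wlog xy : x y / x <= y => [wh x0 y0|x0 _].
  by have [xy|/ltW yx] := leP x y; [exact: wh|rewrite distrC [leRHS]distrC; exact: wh].
have e1 : expR (- x) <= 1 by rewrite -expR0 ler_expR oppr_le0.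
have ee : expR (- y) = expR (- x) * expR (- (y - x)) by rewrite -expRD; congr expR; ring.
have e2 := expR_ge1Dx (- (y - x)); have e3 : expR (- (y - x)) <= 1.
  by rewrite -expR0 ler_expR oppr_le0 subr_ge0.
rewrite ee -[X in X - _]mulr1 -mulrBr normrM ger0_norm ?expR_ge0//.
rewrite ger0_norm ?subr_ge0// distrC ger0_norm ?subr_ge0//.
apply: le_trans (_ : 1 * (y - x) <= _); last by rewrite mul1r.
by apply: ler_pM; rewrite ?expR_ge0 ?subr_ge0//; lra.
Qed.

Section char_limit.
Context {R : realType}.
Variables (p r alpha : R) (phi : R -> R[i]) (a : nat -> R).
Hypothesis alpha02 : 0 < alpha <= 2.
Hypothesis p01 : 0 < p < 1.
Hypothesis r01 : 0 <= r <= 1.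
Hypothesis sub : (2 * r - 1) * alpha * p < 1.
Hypothesis phi0 : phi 0 = 1.
Hypothesis phi_le1 : forall t, normc (phi t) <= 1.
Hypothesis phiN : forall t, normc (1 - phi (- t)) = normc (1 - phi t).
Hypothesis phi_cont : forall t e : R, 0 < e ->
  exists2 delta : R, 0 < delta & forall s, `|s - t| < delta -> normc (phi s - phi t) <= e.
Hypothesis a0 : forall n, (1 <= n)%N -> 0 < a n.
Hypothesis phi_pow : forall M e : R, 0 < e -> \forall n \near \oo, forall t, `|t| <= M ->
  normc (phi (t / a n) ^+ n - (expR (- (`|t| `^ alpha)))%:C%C) <= e.
Local Notation Ec := (cexp (weight p r)).

Let p01' : 0 < p <= 1.
Proof. by case/andP: p01 => p0 p1; rewrite p0 ltW. Qed.

Let alpha0 : 0 < alpha. Proof. by case/andP: alpha02. Qed.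

Definition walk_cf m (t : R) : R[i] :=
  \sum_(c <- configs m) (\prod_(k < m) weight p r k (c k.+2))%:C%C *
    \prod_(1 <= i < m.+2) phi (t / a m.+1 * cweight R c i m.+1).

Lemma normc_walk_cfB m t z : normc (walk_cf m t - z) <=
  Ec m (fun c => normc (\prod_(1 <= i < m.+2) phi (t / a m.+1 * cweight R c i m.+1) - z)).
Proof.
have zE : z = \sum_(c <- configs m) (\prod_(k < m) weight p r k (c k.+2))%:C%C * z.
  rewrite -mulr_suml -rmorph_sum /=.
  have := @cexp_cst R p r m 1; rewrite /cexp.
  by rewrite -mulr_suml mulr1 => ->; rewrite realC1 mul1r.
rewrite [X in normc (_ - X) <= _]zE /walk_cf -sumrB; apply: le_trans (le_normc_sum _ _ _) _.
rewrite /cexp; apply: ler_sum => c _; rewrite -mulrBr Normc.normcM normcR.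
by rewrite ger0_norm// prodr_ge0// => k _; exact: weight_ge0.
Qed.

Let beta_ex : exists beta, exponent_bound p r alpha beta.
Proof.
have [beta ab hb] := sum_size_freq_bound p01 r01 alpha02 sub.
by exists beta.
Qed.

(** The condition at 0 required by [levy_continuity]. The product differs from 1 by at most the sum
    of [chi] over the clusters, to which [size_sum_small] applies after multiplication by [n]. *)
Lemma walk_cf_equicontinuous (e : R) : 0 < e -> exists2 delta : R, 0 < delta &
  \forall m \near \oo, forall t, `|t| <= delta -> normc (walk_cf m t - 1) <= e.
Proof.
move=> e0; have [beta hb] := beta_ex; have ab := hb.1.
have [D D0 hD] := cexp_csum_le p01 r01.
have [C C0 hC] := chi_bound alpha0 phi0 phi_le1 phiN phi_cont a0 phi_pow ab.
have eD : 0 < e / D by rewrite divr_gt0.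
have [K [e' [e'0 hK]]] := size_sum_small p01 r01 hb C0 eD.
have e20 : 0 < e' / 2 by rewrite divr_gt0.
(* Makes [|t w|^alpha] at most [e' / 2] for [|t| <= delta] and [|w| <= K]; [delta <= 1] keeps the
   Potter bound independent of [t]. *)
pose delta := Num.min 1 ((e' / 2) `^ alpha^-1 / K.+1%:R).
have d0 : 0 < delta by rewrite lt_min ltr01 divr_gt0 ?powR_gt0 ?ltr0n.
have dK : delta * K%:R <= (e' / 2) `^ alpha^-1.
  apply: le_trans (_ : (e' / 2) `^ alpha^-1 / K.+1%:R * K%:R <= _).
    by rewrite ler_wpM2r// ge_min lexx orbT.
  rewrite mulrAC ler_pdivrMr ?ltr0n// ler_wpM2l ?powR_ge0// ler_nat//.
have d1 : delta <= 1 by rewrite ge_min lexx.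
exists delta => //.
have hA := chi_asymp alpha0 phi0 phi_cont a0 phi_pow (delta * K%:R) e20.
near=> m => t td.
have hCm : forall x, m.+1%:R * chi phi (x / a m.+1) <= C * (1 + `|x| `^ beta).
  by near: m; exact: (near_inftyS hC).
have hAm : forall x, `|x| <= delta * K%:R ->
    `|m.+1%:R * chi phi (x / a m.+1) - `|x| `^ alpha| <= e' / 2.
  by near: m; exact: (near_inftyS hA).
apply: le_trans (normc_walk_cfB _ _ _) _.
pose h w := chi phi (t * w / a m.+1).
have h0 : h 0 = 0 by rewrite /h mulr0 mul0r /chi phi0 subrr Normc.normc0.
have hge0 w : 0 <= h w by exact: normc_ge0.
apply: le_trans (_ : Ec m (csum (fun=> h) m.+1) <= _).
  apply: le_cexp => // c; rewrite -[X in _ - X](@big1_eq _ 1 *%R _ (index_iota 1 m.+2) predT).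
  apply: le_trans (normc_prodB _ _ _) _ => [i|i|]; [exact: phi_le1|by rewrite Normc.normc1|].
  by apply: ler_sum => i _; rewrite normcC /h /chi mulrAC.
apply: le_trans (hD m h h0 hge0) _; rewrite mulrC -ler_pdivlMr//.
apply: hK => [w|w|w wK].
- by rewrite mulr_ge0.
- apply: le_trans (hCm _) _; rewrite ler_wpM2l// lerD2l ge0_ler_powR ?nnegrE//.
    by rewrite ltW// (lt_trans alpha0).
  by rewrite normrM ler_piMl// (le_trans td).
have tw : `|t * w| <= delta * K%:R by rewrite normrM ler_pM.
have := hAm _ tw; rewrite ler_norml => /andP[_ hu].
have : `|t * w| `^ alpha <= e' / 2.
  have -> : e' / 2 = ((e' / 2) `^ alpha^-1) `^ alpha.
    by rewrite -powRrM mulVf ?gt_eqF// powRr1// ltW.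
  by rewrite ge0_ler_powR ?nnegrE ?powR_ge0 ?(ltW alpha0)// (le_trans tw).
by move: hu; rewrite /h; set x := _ * chi _ _; lra.
Unshelve. all: by end_near. Qed.

Let powR_le_1D_beta (beta w : R) : alpha < beta -> `|w| `^ alpha <= 1 + `|w| `^ beta.
Proof. by move=> ab; rewrite powR_le_1D// ltW. Qed.

Lemma walk_cf_cvg (t e : R) : 0 < e -> \forall m \near \oo,
  normc (walk_cf m t - (expR (- (asymptotic_constant p r alpha * `|t| `^ alpha)))%:C%C) <= e.
Proof.
move=> e0; have [beta hb] := beta_ex; have ab := hb.1; set L := asymptotic_constant _ _ _.
have L0 : 0 <= L by exact: asymptotic_constant_ge0.
have [D D0 hD] := cexp_csum_le p01 r01.
have [C C0 hC] := chi_bound alpha0 phi0 phi_le1 phiN phi_cont a0 phi_pow ab.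
have beta0 : 0 < beta by exact: lt_trans ab.
pose B := `|t| `^ alpha; pose B' := 1 + `|t| `^ beta.
have B0 : 0 <= B by exact: powR_ge0.
have B'0 : 0 <= B' by rewrite addr_ge0// powR_ge0.
have tw_beta (w : R) : 1 + `|t * w| `^ beta <= B' * (1 + `|w| `^ beta).
  rewrite normrM powRM// mulrDl mul1r mulrDr mulr1.
  by have := powR_ge0 `|t| beta; have := powR_ge0 `|w| beta; lra.
(* [C] comes from the Potter bound on [1 - phi], 1 from [1 - exp(- |t w|^alpha / n)], and [B']
   extracts [t] from [1 + |t w|^beta]. *)
have C'0 : 0 <= (C + 1) * B' by rewrite mulr_ge0// addr_ge0.
have e2D : 0 < e / 2 / D by rewrite !divr_gt0.
have [K [e' [e'0 hK]]] := size_sum_small p01 r01 hb C'0 e2D.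
have hR := phi_root alpha0 phi0 phi_cont a0 phi_pow (`|t| * K%:R) e'0.
have eB : 0 < e / 2 / (B + 1) by rewrite !divr_gt0// ltr_wpDl.
have hM := cexp_mean_cvg alpha02 p01 r01 sub eB.
near=> m; set n := m.+1; have n0 : 0 < n%:R :> R by rewrite ltr0n.
have hCm : forall x, n%:R * chi phi (x / a n) <= C * (1 + `|x| `^ beta).
  by rewrite /n; near: m; exact: (near_inftyS hC).
have hRm : forall x, `|x| <= `|t| * K%:R ->
    n%:R * normc (phi (x / a n) - (expR (- (`|x| `^ alpha / n%:R)))%:C%C) <= e'.
  by rewrite /n; near: m; exact: (near_inftyS hR).
apply: le_trans (normc_walk_cfB _ _ _) _; rewrite -/n.
pose E w : R := expR (- (`|t * w| `^ alpha / n%:R)).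
have x0 (w : R) : 0 <= `|t * w| `^ alpha / n%:R by rewrite divr_ge0 ?powR_ge0 ?(ltW n0).
pose h w := normc (phi (t * w / a n) - (E w)%:C%C).
have h0 : h 0 = 0.
  rewrite /h /E mulr0 mul0r phi0 normr0 powR0 ?gt_eqF// mul0r oppr0 expR0 realC1.
  by rewrite subrr Normc.normc0.
have hge0 w : 0 <= h w by exact: normc_ge0.
pose Q c := csum (fun _ w => `|w| `^ alpha) n c / n%:R.
apply: le_trans (_ : Ec m (fun c => csum (fun=> h) n c + B * `|Q c - L|) <= _).
  apply: le_cexp => // c.
  have Q0 : 0 <= Q c.
    by rewrite divr_ge0 ?(ltW n0)// sumr_ge0// => i _; exact: powR_ge0.
  have split (x y z : R[i]) : x - z = (x - y) + (y - z) by ring.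
  (* Replacing each [phi] by an exponential turns the product into a function of the single mean
     [Q c], whose limit is [L]. *)
  pose Y : R[i] := \prod_(1 <= i < n.+1) (E (cweight R c i n))%:C%C.
  have YE : Y = (expR (- (B * Q c)))%:C%C.
    rewrite /Y -rmorph_prod /= -expR_sum; congr (expR _)%:C%C.
    rewrite sumrN /Q /csum mulr_suml mulr_sumr; congr (- _).
    by apply: eq_bigr => i _; rewrite normrM powRM// mulrA.
  rewrite (split _ Y); apply: le_trans (le_normcD _ _) _; apply: lerD.
    apply: le_trans (normc_prodB _ _ _) _ => [i|i|]; first exact: phi_le1.
      by rewrite normcR ger0_norm ?expR_ge0// -expR0 ler_expR oppr_le0.
    by apply: ler_sum => i _; rewrite /h mulrAC.
  rewrite YE -rmorphB normcR; apply: le_trans (expRN_lipschitz _ _) _; [exact: mulr_ge0|exact: mulr_ge0|].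
  by rewrite [L * _]mulrC -mulrBr normrM ger0_norm.
rewrite cexpD cexpZ [e in leRHS](splitr e) lerD//; last first.
  apply: le_trans (_ : B * (e / 2 / (B + 1)) <= _).
    by rewrite ler_wpM2l// /Q /n; near: m; exact: hM.
  by rewrite mulrC mulrAC ler_pdivrMr ?ltr_wpDl// ler_wpM2l ?lerDl// divr_ge0 ?ltW.
apply: le_trans (hD m h h0 hge0) _; rewrite mulrC -ler_pdivlMr//.
apply: hK => [w|w|w wK].
- by rewrite mulr_ge0.
- apply: le_trans (_ : n%:R * chi phi (t * w / a n) + `|t * w| `^ alpha <= _).
    have -> : `|t * w| `^ alpha = n%:R * (`|t * w| `^ alpha / n%:R) by field; rewrite gt_eqF.
    rewrite -mulrDr ler_wpM2l ?(ltW n0)// /h /chi.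
    have -> : phi (t * w / a n) - (E w)%:C%C = (1 - E w)%:C%C - (1 - phi (t * w / a n)).
      by rewrite rmorphB /= realC1; ring.
    apply: le_trans (le_normcB _ _) _; rewrite addrC lerD2l normcR.
    have /andP[h1 _] := expRN_bounds (x0 w).
    have h2 : E w <= 1 by rewrite -expR0 ler_expR oppr_le0.
    by rewrite ger0_norm ?subr_ge0//; move: h1; rewrite -/(E w); lra.
  apply: le_trans (lerD (hCm _) (powR_le_1D_beta _ ab)) _.
  rewrite -[X in _ + X]mul1r -mulrDl -mulrA ler_wpM2l//.
  by rewrite addr_ge0.
by apply: hRm; rewrite normrM ler_wpM2l.
Unshelve. all: by end_near. Qed.

End char_limit.

(** By [size_freq_beta] the terms of the two series are proportional, with ratio [(1 - p) / p]; the
    shift by one reflects that [size_freq k] concerns size [k + 1]. Finiteness of the constant is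
    included. *)
Lemma limit_constantE (R : realType) (alpha p r : R)
    d (T : measurableType d) (P : probability T R)
    (U : nat -> {RV P >-> nat}) (eta : nat -> {RV P >-> bool}) :
  0 < alpha <= 2 -> 0 < p < 1 -> 0 <= r <= 1 -> (2 * r - 1) * alpha * p < 1 ->
  erw_inputs r U eta ->
  limit_constant alpha p P (erw U eta) = (asymptotic_constant p r alpha)%:E.
Proof.
move=> alpha02 p01 r01 sub hin; have [a0 _] := andP alpha02; have [p0 p1] := andP p01.
have q0 : (1 - p) / p != 0 by rewrite gt_eqF// divr_gt0// subr_gt0.
pose G k : R := erw_mean r k (fun x => `|x| `^ alpha) * beta k.+1%:R (1 + p^-1).
pose F k := ('E_P[fun w => (`|erw U eta k w| `^ alpha)%R] * (beta k%:R (1 + p^-1))%:E)%E.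
have GE k : G k = ((1 - p) / p)^-1 *
    (size_freq p k * erw_mean r k (fun x => `|x| `^ alpha)).
  rewrite size_freq_beta// /G; set q := _ / p in q0 *.
  by rewrite -[q * _ * _]mulrA mulKf// mulrC.
have FE n : (\sum_(1 <= k < n.+1) F k)%E = (\sum_(k < n) G k)%:E.
  rewrite big_add1 /= big_mkord -sumEFin; apply: eq_bigr => k _.
  by rewrite /F (expectation_erw_powR r01 hin).
rewrite /limit_constant.
have -> : (\sum_(1 <= k <oo) F k)%E =
    (((1 - p) / p)^-1 * asymptotic_constant p r alpha)%:E.
  apply/cvg_lim => //; rewrite -cvg_shiftS/=.
  under eq_fun do rewrite FE.
  apply: cvg_EFin; first exact: nearW.
  rewrite /comp /=; under eq_fun do under eq_bigr do rewrite GE.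
  under eq_fun do rewrite -mulr_sumr.
  by apply: cvgM; [exact: cvg_cst|exact: cvg_asymptotic_constant].
by rewrite -EFinM mulVKf.
Qed.

Section reinforced_cf.
Context d (T : measurableType d) (R : realType) (P : probability T R).
Variables (p r : R) (U : nat -> {RV P >-> nat}) (eps eta : nat -> {RV P >-> bool})
  (xi : nat -> {RV P >-> R}).
Hypothesis p01 : 0 <= p <= 1.
Hypothesis r01 : 0 <= r <= 1.
Hypothesis inputs : srrw_inputs p r U eps eta xi.

Lemma cf_srrw (a : nat -> R) m t :
  cf P (fun w => srrw U eps eta xi m.+1 w / a m.+1) t = walk_cf p r (cf P (xi 1%N)) a m t.
Proof.
transitivity (EC P (fun w => cis (t / a m.+1 * srrw U eps eta xi m.+1 w))).
  by apply: eq_EC => w; rewrite mulrA mulrAC.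
rewrite (EC_srrw p01 r01 inputs) /walk_cf; apply: eq_bigr => c _; congr (_ * _).
rewrite big_nat [RHS]big_nat; apply: eq_bigr => i /andP[i1 _].
by rewrite (cf_ident _ (srrw_xi_ident inputs)).
Qed.

Variables (dS : measure_display) (TS : measurableType dS) (PS : probability TS R)
  (S : {RV PS >-> R}) (psi : R -> R[i]).
Hypothesis hS : forall t, cf PS S t = psi t.

Lemma cf_normalized_sum (a : nat -> R) :
  cvg_in_distribution P (fun n w => (a n)^-1 * \sum_(1 <= k < n.+1) xi k w) PS S ->
  forall M e : R, 0 < e -> \forall n \near \oo, forall t, `|t| <= M ->
    normc (cf P (xi 1%N) (t / a n) ^+ n - psi t) <= e.
Proof.
move=> hcv M e e0.
have mX n : measurable_fun setT (fun w => (a n)^-1 * \sum_(1 <= k < n.+1) xi k w).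
  apply: measurable_funM; first exact: measurable_cst.
  by apply: measurable_sum => k; exact: measurable_funPT.
have mS : measurable_fun setT S by exact: measurable_funPT.
have H := cvg_cf_uniform mX mS hcv M e0.
near=> n => t tM; rewrite -hS -(cf_sum _ _ (srrw_xi_indep inputs) (srrw_xi_ident inputs)).
rewrite (_ : cf P _ (t / a n) =
    cf P (fun w => (a n)^-1 * \sum_(1 <= k < n.+1) xi k w) t).
  by move: t tM; near: n.
by apply: eq_EC => w; rewrite mulrA.
Unshelve. all: by end_near. Qed.

End reinforced_cf.

(** [c] is a sum in the extended reals and [S] is scaled through [fine c]; finiteness of [c] is
    therefore part of the conclusion. *)
Theorem theorem1p2 (R : realType) (alpha p r : R)
    (halpha : 0 < alpha <= 2) (hp : 0 < p < 1) (hr : 0 <= r <= 1)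
    (hsub : (2 * r - 1) * alpha * p < 1)
    (* the step-reinforced random walk *)
    (d : measure_display) (T : measurableType d) (P : probability T R)
    (U : nat -> {RV P >-> nat}) (eps eta : nat -> {RV P >-> bool})
    (xi : nat -> {RV P >-> R})
    (hin : srrw_inputs p r U eps eta xi)
    (* the symmetric stable limit S *)
    (dS : measure_display) (TS : measurableType dS) (PS : probability TS R)
    (S : {RV PS >-> R})
    (hS : forall t : R, char_fun S t = (expR (- (`|t| `^ alpha)))%:C%C)
    (* the normalizing sequence *)
    (a : nat -> R) (ha : forall n, (1 <= n)%N -> 0 < a n)
    (hcv : cvg_in_distribution
       P (fun n w => (a n)^-1 * \sum_(1 <= k < n.+1) xi k w)
       PS S)
    (* the elephant random walk *)
    (d0 : measure_display) (T0 : measurableType d0) (P0 : probability T0 R)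
    (U0 : nat -> {RV P0 >-> nat}) (eta0 : nat -> {RV P0 >-> bool})
    (hin0 : erw_inputs r U0 eta0) :
  let c := limit_constant alpha p P0 (erw U0 eta0) in
  c \is a fin_num /\
  cvg_in_distribution
    P (fun n w => srrw U eps eta xi n w / a n)
    PS (fun w => fine c `^ alpha^-1 * S w).
Proof.
move: halpha hp => alpha02 p01; have [alpha0 _] := andP alpha02; have [p0 p1] := andP p01.
have p01' : 0 <= p <= 1 by rewrite !ltW.
rewrite /= (limit_constantE alpha02 p01 hr hsub hin0); split => //=.
set L := asymptotic_constant p r alpha.
have L0 : 0 <= L by exact: asymptotic_constant_ge0.
have mxi : measurable_fun setT (xi 1%N) by exact: measurable_funPT.
have phi_pow := cf_normalized_sum hin hS hcv.
have phi0 := cf0 P (xi 1%N).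
have phi1 := normc_cf P mxi.
have phiN := normc_1cfN P mxi.
have phi_cont := cf_continuous P mxi.
have small := walk_cf_equicontinuous alpha02 p01 hr hsub phi0 phi1 phiN phi_cont ha phi_pow.
have lim := walk_cf_cvg alpha02 p01 hr hsub phi0 phi1 phiN phi_cont ha phi_pow.
pose X n w : R := srrw U eps eta xi n w / a n.
have XE m t : cf P (X m.+1) t = walk_cf p r (cf P (xi 1%N)) a m t.
  exact: (cf_srrw p01' hr hin).
pose Y w : R := L `^ alpha^-1 * S w.
have YE t : cf PS Y t = (expR (- (L * `|t| `^ alpha)))%:C%C.
  transitivity (cf PS S (t * L `^ alpha^-1)).
    by apply: eq_EC => w; rewrite mulrA.
  have hcS s : cf PS S s = (expR (- (`|s| `^ alpha)))%:C%C := hS s.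
  rewrite hcS; congr (expR (- _))%:C%C; rewrite normrM powRM ?normr_ge0//.
  rewrite (ger0_norm (powR_ge0 _ _)) -powRrM mulVf; last by rewrite gt_eqF.
  by rewrite (powRr1 L0) mulrC.
have mX n : measurable_fun setT (X n).
  by apply: measurable_funM; [exact: measurable_srrw|exact: measurable_cst].
have mY : measurable_fun setT Y.
  by apply: measurable_funM; [exact: measurable_cst|exact: measurable_funPT].
have cvg_cfX t e : 0 < e -> \forall n \near \oo, normc (cf P (X n) t - cf PS Y t) <= e.
  move=> /(lim t) [N _ h]; exists N.+1 => // -[//|m] Nm; rewrite XE YE; exact: h.
apply: (levy_continuity mX mY) => [t|t|e e0].
- apply/cvgrPdist_le => e /(cvg_cfX t); apply: filterS => n; apply: le_trans.
  by rewrite distrC; exact: le_trans (normr_Re (cf P (X n) t - cf PS Y t)) _.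
- apply/cvgrPdist_le => e /(cvg_cfX t); apply: filterS => n; apply: le_trans.
  by rewrite distrC; exact: le_trans (normr_Im (cf P (X n) t - cf PS Y t)) _.
have [delta delta0 [N _ h]] := small e e0.
exists delta => //; exists N.+1 => // -[//|m] /= Nm t td.
apply: le_trans (h m Nm t td); rewrite -XE normcC.
exact: le_trans (ler_norm _) (normr_Re (1 - cf P (X m.+1) t)).
Qed.
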